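(* There exist positive constants $\alpha=\alpha(\mathbf M,\mathbf p)$ and $\beta=\beta(\mathbf M,\mathbf p)$, depending only on $\mathbf M$ and $\mathbf p$, such that the following holds. Let $G$ be a uniformly transient, polyhedral, proper plane network with bounded codegrees and bounded local geometry, so that $\mathbf M=\mathbf M_G<\infty$, and let $\mathbf p>0$ be a uniform lower bound on its escape probabilities. Let $d_G$ denote the graph distance on the vertex set $V$, let $(P,P^\dagger)$ be a double circle packing of $G$ in the unit disc $\mathbb D$, and let $z(v)$ be the centre of the disc in $P$ corresponding to the vertex $v$. Then $z$ is an $(\alpha,\beta)$-rough isometry from $(V,d_G)$ to $(\mathbb D,d_{\mathbb H})$, where $d_{\mathbb H}$ is the hyperbolic metric on $\mathbb D$.
   Context: A network $(G,c)$ is a locally finite, connected graph $G=(V,E)$ together with conductances $c:E\to(0,\infty)$. The random walk on it steps from a vertex along an incident edge chosen with probability proportional to its conductance. The escape probability of $v$ is the probability that the random walk started at $v$ never returns to $v$ at a positive time; the network is uniformly transient if the escape probabilities are bounded below by a positive constant $\mathbf p$, uniformly over $v\in V$. A graph is polyhedral if it is simple and 3-connected (removing any two vertices leaves it connected). Proper plane networks: Let $\mathbb G$ be the metric graph obtained from $G$ by replacing each edge by a unit interval. A proper plane network is an infinite network together with a continuous injective map from $\mathbb G$ into a domain $D\subseteq\mathbb C\cup\{\infty\}$ homeomorphic to the plane, such that (1) every component of the complement in $D$ of the image (a face) is homeomorphic to a disc, and the oriented edges whose left-hand side is incident to it form a cycle or a bi-infinite path; (2) every compact subset of $D$ intersects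 at most finitely many edges. $F$ is the set of faces and $\deg(f)$ is the number of oriented edges with left-hand side incident to $f$. The dual $G^\dagger$ has vertex set $F$ and an edge for each edge of $G$, joining the two faces on its sides. Bounded codegrees means $\sup_f\deg(f)<\infty$; bounded local geometry means that vertex degrees are bounded and conductances are bounded above and away from $0$. Define $$\mathbf M_G=\max\Big\{\sup_{v\in V}\deg(v),\sup_{f\in F}\deg(f),\sup_{e\in E}c(e),\sup_{e\in E}c(e)^{-1}\Big\}.$$ Double circle packing: a double circle packing of $G$ is a pair of families of discs $P=\{P(v):v\in V\}$, $P^\dagger=\{P^\dagger(f):f\in F\}$, where discs within $P$ have disjoint interiors and likewise within $P^\dagger$, such that $P(u),P(v)$ are tangent iff $u,v$ are adjacent in $G$; $P^\dagger(f),P^\dagger(g)$ are tangent iff $f,g$ are adjacent in $G^\dagger$; and $P(v)\cap P^\dagger(f)\neq\emptyset$ iff $f$ is incident to $v$, in which case the boundary circles meet at right angles. It is in $\mathbb D$ if the union of all its discs is $\mathbb D$. (Networks as in the claim admit such a packing, unique up to Möbius transformations and reflections of $\mathbb D$.) The disc $\mathbb D$ is identified with the hyperbolic plane via the Poincaré disc model. Rough isometry: a (not necessarily continuous) function $\phi:X_1\to X_2$ between metric spaces $(X_1,d_1),(X_2,d_2)$ is an $(\alpha,\beta)$-rough isometry if $\alpha^{-1}d_1(x,y)-\beta\le d_2(\phi(x),\phi(y))\le\alpha d_1(x,y)+\beta$ for all $x,y\in X_1$, and for every $x_2\in X_2$ there exists $x_1\in X_1$ with $d_2(\phi(x_1),x_2)\le\beta$.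 *)

(* Defs.v *)
From HB Require Import structures.
From mathcomp Require Import all_boot all_order all_algebra.
From mathcomp Require Import all_classical all_reals all_analysis.
From mathcomp Require Import complex.

Set Implicit Arguments.
Unset Strict Implicit.
Unset Printing Implicit Defensive.

Import Order.TTheory GRing.Theory Num.Theory numFieldNormedType.Exports.

Local Open Scope classical_set_scope.
Local Open Scope ring_scope.
Local Open Scope complex_scope.

(** * Networks *)

(* Multigraphs are presented by their oriented edges: every unoriented edge is
   a pair {e, orev e}.  Simplicity is part of [polyhedral] below. *)
Record network (R : realType) := Network {
  vertex : choiceType;
  oedge : choiceType;
  osrc : oedge -> vertex;
  orev : oedge -> oedge;
  cond : oedge -> R;
  orevK : involutive orev;
  orev_neq : forall e, orev e <> e;
  cond_gt0 : forall e, 0 < cond e;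
  cond_rev : forall e, cond (orev e) = cond e }.

Section Networks.
Variables (R : realType) (G : network R).
Local Notation V := (vertex G).
Local Notation E := (oedge G).

Definition otgt (e : E) : V := osrc (orev e).

Definition out_edges (v : V) : set E := [set e | osrc e = v].

Definition degree (v : V) : \bar R := counting (out_edges v).

Definition locally_finite := forall v : V, finite_set (out_edges v).

(* All the vertices of the walk, including its endpoints, lie in A. *)
Fixpoint walk_within (A : set V) (n : nat) (u v : V) : Prop :=
  if n is n'.+1
  then A u /\ exists2 e : E, osrc e = u & walk_within A n' (otgt e) v
  else A u /\ u = v.

Definition connected_on (A : set V) :=
  forall u v : V, A u -> A v -> exists n, walk_within A n u v.

Definition graph_dist (u v : V) : R :=
  inf [set n%:R | n in [set n : nat | walk_within setT n u v]].

Definition simple_graph :=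
  (forall e : E, osrc e <> otgt e) /\
  (forall e e' : E, osrc e = osrc e' -> otgt e = otgt e' -> e = e').

Definition three_connected :=
  forall a b : V, a <> b -> connected_on (~` [set a; b]).

Definition polyhedral := simple_graph /\ three_connected.

Definition adjacent (u v : V) := exists2 e : E, osrc e = u & otgt e = v.

(** ** Random walk and escape probabilities *)

Definition transition (u v : V) : R :=
  (\sum_(e \in [set e : E | osrc e = u /\ otgt e = v]) cond e) /
  (\sum_(e \in out_edges u) cond e).

Definition random_walk_from (v : V) (d : measure_display)
    (Omega : measurableType d) (P : probability Omega R)
    (X : nat -> Omega -> V) :=
  (forall n x, measurable [set w | X n w = x]) /\
  (forall (n : nat) (x : nat -> V),
     P [set w | forall i, (i <= n)%N -> X i w = x i] =
     (if x 0%N == v then \prod_(i < n) transition (x i) (x i.+1)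
      else 0)%:E).

Definition never_returns (v : V) (Omega : Type) (X : nat -> Omega -> V) :=
  [set w : Omega | forall n, (0 < n)%N -> X n w <> v].

(* The law of the walk, hence q, does not depend on the probability space. *)
Definition escape_probability (v : V) (q : \bar R) :=
  exists (d : measure_display) (Omega : measurableType d)
         (P : probability Omega R) (X : nat -> Omega -> V),
    random_walk_from v P X /\ P (never_returns v X) = q.

Definition uniformly_transient (p : R) :=
  0 < p /\ forall v : V, exists2 q, escape_probability v q & (p%:E <= q)%E.

Definition bounded_local_geometry :=
  (exists N : nat, forall v : V, (degree v <= N%:R%:E)%E) /\
  (exists a b : R, 0 < a /\ forall e : E, a <= cond e <= b).

End Networks.

(** * The plane and the sphere *)

Definition plane (R : realType) : topologicalType := R[i]^o.
Definition sphere (R : realType) : topologicalType :=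
  one_point_compactification (plane R).

Section Plane.
Variable R : realType.

Definition modulus (z : R[i]) : R := complex.ComplexField.Normc.normc z.

Definition cis (t : R) : R[i] := cos t +i* sin t.

Definition unit_disc : set (plane R) := [set z | modulus z < 1].

Definition homeomorphic (S T : topologicalType) (A : set S) (B : set T) :=
  exists (f : S -> T) (g : T -> S),
    [/\ {within A, continuous f}, {within B, continuous g},
        (forall x, A x -> B (f x) /\ g (f x) = x) &
        (forall y, B y -> A (g y) /\ f (g y) = y)].

(* An orientation-preserving embedding of the unit disc in the plane: the image
   of a small circle winds once, counterclockwise, around the image of 0; theta
   is a continuous determination of the argument. *)
Definition positive_chart (h : plane R -> plane R) :=
  [/\ {within unit_disc, continuous h}, set_inj unit_disc h &
      exists (r : R) (theta : R -> R),
        [/\ 0 < r < 1, {within `[0, 1], continuous theta},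
            theta 1 = theta 0 + 2 * pi &
            forall t : R, 0 <= t <= 1 ->
              let u : R[i] := h (r%:C * cis (2 * pi * t)) - h 0 in
              u = (modulus u)%:C * cis (theta t)]].

End Plane.

(** * Proper plane networks *)

(* A map from the metric graph to the sphere, given on each piece: vpos on
   vertices and epos e on the unit interval of e, traversed from osrc e. *)
Record drawing (R : realType) (G : network R) := Drawing {
  domain : set (sphere R);
  vpos : vertex G -> sphere R;
  epos : oedge G -> R -> sphere R }.

Section Drawings.
Variables (R : realType) (G : network R) (D : drawing G).
Local Notation V := (vertex G).
Local Notation E := (oedge G).

Definition edge_image (e : E) : set (sphere R) := epos D e @` `[0, 1].

Definition graph_image : set (sphere R) :=
  range (vpos D) `|` \bigcup_(e in setT) edge_image e.

(* The metric graph is a quotient of V + E * [0, 1]: the first two clauses say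
   that the map is well defined on it; as the graph is locally finite, it is
   continuous iff each epos e is; the remaining clauses express injectivity. *)
Definition continuous_injective_drawing :=
  [/\ forall e, epos D e 0 = vpos D (osrc e) /\ epos D e 1 = vpos D (otgt e),
      forall e (t : R), 0 <= t <= 1 -> epos D (orev e) t = epos D e (1 - t),
      forall e, {within `[0, 1], continuous (epos D e)} &
      [/\ injective (vpos D),
          forall e (t : R) v, 0 < t < 1 -> epos D e t <> vpos D v &
          forall e e' (t t' : R), 0 < t < 1 -> 0 < t' < 1 ->
            epos D e t = epos D e' t' ->
            (e' = e /\ t' = t) \/ (e' = orev e /\ t' = 1 - t)]].

Definition is_face (f : set (sphere R)) :=
  exists2 x, (domain D `\` graph_image) x &
             f = connected_component (domain D `\` graph_image) x.

Definition face := {f : set (sphere R) | is_face f}.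

(* f lies on the left-hand side of e: in some positively oriented chart, the
   real diameter is a piece of e run through in the direction of e, and the
   upper half disc is contained in f. *)
Definition left_face (e : E) (f : face) :=
  exists (h : plane R -> plane R) (tau : R -> R),
    [/\ positive_chart h,
        forall x y : R, -1 < x -> x < y -> y < 1 -> tau x < tau y,
        forall x : R, -1 < x < 1 ->
          0 < tau x < 1 /\ Some (h x%:C) = epos D e (tau x) &
        forall z : plane R, unit_disc z -> 0 < complex.Im z ->
          sval f (Some (h z))].

Definition face_edges (f : face) : set E := [set e | left_face e f].

Definition codegree (f : face) : \bar R := counting (face_edges f).

Definition forms_cycle (A : set E) :=
  exists (n : nat) (w : nat -> E),
    [/\ (0 < n)%N, set_inj `I_n w, A = w @` `I_n &
        forall i, (i < n)%N -> otgt (w i) = osrc (w (i.+1 %% n)%N)].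

Definition forms_biinfinite_path (A : set E) :=
  exists w : int -> E,
    [/\ injective w, A = range w & forall i, otgt (w i) = osrc (w (i + 1))].

Definition proper_plane_network :=
  [/\ locally_finite G, connected_on [set: V], infinite_set [set: V],
      open (domain D) /\ homeomorphic (domain D) [set: plane R] &
   [/\ continuous_injective_drawing, graph_image `<=` domain D,
       forall f : face, homeomorphic (sval f) (@unit_disc R),
       forall f : face, forms_cycle (face_edges f) \/
                        forms_biinfinite_path (face_edges f) &
       forall K : set (sphere R), compact K -> K `<=` domain D ->
         finite_set [set e : E | edge_image e `&` K !=set0]]].

Definition bounded_codegrees :=
  exists N : nat, forall f : face, (codegree f <= N%:R%:E)%E.

Definition M_G : \bar R :=
  maxe (maxe (ereal_sup (range (@degree R G))) (ereal_sup (range codegree)))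
       (maxe (ereal_sup (range (fun e : E => (cond e)%:E)))
             (ereal_sup (range (fun e : E => (cond e)^-1%:E)))).

Definition dual_adjacent (f g : face) :=
  exists2 e : E, left_face e f & left_face (orev e) g.

Definition incident (f : face) (v : V) :=
  exists2 e : E, left_face e f & osrc e = v \/ otgt e = v.

End Drawings.

(** * Double circle packings *)

Record disc (R : realType) := Disc {
  centre : R[i];
  radius : R;
  radius_gt0 : 0 < radius }.

Section Packings.
Variable R : realType.

Definition closed_disc (B : disc R) : set R[i] :=
  [set z | modulus (z - centre B) <= radius B].

Definition open_disc (B : disc R) : set R[i] :=
  [set z | modulus (z - centre B) < radius B].

Definition circle (B : disc R) : set R[i] :=
  [set z | modulus (z - centre B) = radius B].

(* External tangency, the only one possible for discs of disjoint interiors. *)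
Definition tangent_discs (A B : disc R) :=
  modulus (centre A - centre B) = radius A + radius B.

Definition orthogonal_vectors (u v : R[i]) :=
  complex.Re u * complex.Re v + complex.Im u * complex.Im v = 0.

(* At each intersection point the radii, hence the tangents, are orthogonal. *)
Definition meet_at_right_angles (A B : disc R) :=
  circle A `&` circle B !=set0 /\
  forall x, circle A x -> circle B x ->
    orthogonal_vectors (x - centre A) (x - centre B).

Definition double_circle_packing (G : network R) (D : drawing G)
    (P : vertex G -> disc R) (Pd : face D -> disc R) :=
  [/\ forall u v, u <> v -> open_disc (P u) `&` open_disc (P v) = set0,
      forall f g, f <> g -> open_disc (Pd f) `&` open_disc (Pd g) = set0,
      forall u v, tangent_discs (P u) (P v) <-> adjacent u v,
      forall f g, tangent_discs (Pd f) (Pd g) <-> dual_adjacent f g &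
      forall v f,
        (closed_disc (P v) `&` closed_disc (Pd f) !=set0 <-> incident f v) /\
        (incident f v -> meet_at_right_angles (P v) (Pd f))].

Definition packing_in_unit_disc (G : network R) (D : drawing G)
    (P : vertex G -> disc R) (Pd : face D -> disc R) :=
  (\bigcup_(v in setT) closed_disc (P v)) `|`
  (\bigcup_(f in setT) closed_disc (Pd f)) = @unit_disc R.

(** * Rough isometries and the hyperbolic metric *)

(* Poincare disc metric of curvature -1: 2 artanh |(z - w) / (1 - z conj(w))|. *)
Definition hyperbolic_dist (z w : R[i]) : R :=
  let delta := modulus ((z - w) / (1 - z * w^*)) in
  ln ((1 + delta) / (1 - delta)).

Definition rough_isometry (a b : R) (T1 T2 : Type)
    (X1 : set T1) (d1 : T1 -> T1 -> R) (X2 : set T2) (d2 : T2 -> T2 -> R)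
    (phi : T1 -> T2) :=
  [/\ forall x, X1 x -> X2 (phi x),
      forall x y, X1 x -> X1 y ->
        a^-1 * d1 x y - b <= d2 (phi x) (phi y) <= a * d1 x y + b &
      forall x2, X2 x2 -> exists2 x1, X1 x1 & d2 (phi x1) x2 <= b].

End Packings.

(* Main.v *)
Require Import Defs.
From mathcomp Require Import all_boot all_order all_algebra.
From mathcomp Require Import all_classical all_reals all_analysis.
From mathcomp Require Import complex.
From mathcomp Require Import ring lra.

(** The ring lemma makes incident and adjacent discs comparable in size, and bounds the radius
    of a disc by its distance to the unit circle.  Conversely, if r(v) were much smaller than
    1 - |z(v)|, a logarithmic potential around z(v) would have small Dirichlet energy, since
    the discs are disjoint, against the uniform lower bound on the escape probability of v.
    So the hyperbolic sizes of the discs are bounded above and below.  A step of a walk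
    therefore covers a bounded hyperbolic distance; conversely a geodesic is replaced by a
    chain of logarithmically many segments, each comparable in length to its distance to the
    unit circle and meeting, by comparing areas, a bounded number of discs. *)

Set Implicit Arguments.
Unset Strict Implicit.
Unset Printing Implicit Defensive.

(* MathComp-Analysis has a [radius] too. *)
Import Defs.
Import Order.TTheory GRing.Theory Num.Theory numFieldNormedType.Exports.
Local Open Scope classical_set_scope.
Local Open Scope ring_scope.

(** * Discs and the ring lemma *)

(** The ring lemma uses the drawing only through one property: the boundary circle of every disc is
    covered by boundedly many incident discs of the other family. With tangency, orthogonality and
    disjointness it makes up [bipacking], which treats vertices and faces alike, so that each
    estimate serves both families; inversion in well chosen points turns the rest into polynomial
    inequalities. This property has to be earned. Faces are described by charts on the left of an
    edge only, so a face on the right has to be constructed by turning a chart through a half turn;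
    winding numbers show that the turned chart is still positively oriented. That every vertex lies
    on a face at all is propagated along edges from one face found by a Borsuk-Ulam argument. The
    energy argument needs test functions of finite support, hence the finiteness of the set of
    centres in every smaller concentric disc, which follows from compactness once every point of the
    unit disc has a neighbourhood covered by finitely many discs. Escape probabilities are compared
    with energies by a Hardy inequality for an explicit superharmonic function, which needs neither
    flows nor an exhaustion by finite networks. *)

Lemma pigeonhole_pair (T : finType) (P : nat -> T -> Prop) :
  (forall k, (k <= #|T|)%N -> exists t, P k t) ->
  exists k l t, [/\ (k < l)%N, (l <= #|T|)%N, P k t & P l t].
Proof.
move=> H.
have H' : forall k : 'I_#|T|.+1, exists t, P k t.
  by move=> k; apply: H; rewrite -ltnS.
have [f Hf] := choice H'.
have : ~~ injectiveb f.
  apply/negP => /injectiveP fi.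
  by have := leq_card f fi; rewrite card_ord ltnn.
case/injectivePn => x [y xy fxy].
have := xy; rewrite -val_eqE neq_ltn => /orP[lt|lt].
- exists x, y, (f x); split=> //; [by rewrite -ltnS | by rewrite fxy].
- exists y, x, (f x); split=> //; [by rewrite -ltnS | by rewrite fxy].
Qed.

(** Discs in real coordinates, so that the geometry of the ring lemma reduces to polynomial
    identities and inequalities. Positivity of the radius is left to the statements, which keeps
    similarities free of side conditions. *)
Record pdisc (R : Type) := PDisc { px : R; py : R; pr : R }.

Section Pdisc.
Variable R : rcfType.
Implicit Types D E : pdisc R.

Definition d2 D E : R := (px D - px E) ^+ 2 + (py D - py E) ^+ 2.
(* The power of the point (u, v): negative inside the circle, zero on it. *)
Definition pw D (u v : R) : R := (u - px D) ^+ 2 + (v - py D) ^+ 2 - pr D ^+ 2.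

(** In complex notation: multiplication by [l (a - i b)] after moving [(p1, p2)] to the origin. For
    [a ^+ 2 + b ^+ 2 = 1] and [0 < l] it is a similarity of ratio [l]. *)
Definition similarity (a b l p1 p2 : R) D : pdisc R :=
  PDisc (l * (a * (px D - p1) + b * (py D - p2)))
        (l * (- b * (px D - p1) + a * (py D - p2))) (l * pr D).

(** What the ring lemma retains of a double circle packing. Distances appear squared, so that no
    square root occurs. Only the first [N] values of [F] matter, and incidence is asserted only for
    the index that covers the given point. *)
Record bipacking (I J : Type) (A : I -> pdisc R) (B : J -> pdisc R)
    (inc : I -> J -> Prop) (N : nat) : Prop := Bipacking {
  bp_pos1 : forall i, 0 < pr (A i);
  bp_pos2 : forall j, 0 < pr (B j);
  bp_disj1 : forall i i', i <> i' -> (pr (A i) + pr (A i')) ^+ 2 <= d2 (A i) (A i');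
  bp_disj2 : forall j j', j <> j' -> (pr (B j) + pr (B j')) ^+ 2 <= d2 (B j) (B j');
  bp_inc : forall i j, inc i j -> d2 (A i) (B j) = pr (A i) ^+ 2 + pr (B j) ^+ 2;
  bp_ninc : forall i j, ~ inc i j -> (pr (A i) + pr (B j)) ^+ 2 < d2 (A i) (B j);
  bp_cover1 : forall i, exists F : nat -> J, forall u v, pw (A i) u v = 0 ->
     exists k : 'I_N, inc i (F k) /\ pw (B (F k)) u v <= 0;
  bp_cover2 : forall j, exists F : nat -> I, forall u v, pw (B j) u v = 0 ->
     exists k : 'I_N, inc (F k) j /\ pw (A (F k)) u v <= 0 }.

Lemma d2C D E : d2 D E = d2 E D.
Proof. by rewrite /d2; ring. Qed.

Lemma bipacking_dual (I J : Type) (A : I -> pdisc R) (B : J -> pdisc R) inc N :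
  bipacking A B inc N -> bipacking B A (fun j i => inc i j) N.
Proof.
case=> *; split=> //.
- by move=> j i /= ij; rewrite d2C addrC; auto.
- by move=> j i /= ij; rewrite d2C addrC; auto.
Qed.

Lemma d2_similarity a b l p1 p2 D E : a ^+ 2 + b ^+ 2 = 1 ->
  d2 (similarity a b l p1 p2 D) (similarity a b l p1 p2 E) = l ^+ 2 * d2 D E.
Proof.
move=> ab; rewrite /d2 /=.
transitivity (l ^+ 2 * (a ^+ 2 + b ^+ 2) *
  ((px D - px E) ^+ 2 + (py D - py E) ^+ 2)); first by ring.
by rewrite ab mulr1.
Qed.

Lemma bipacking_similarity (I J : Type) (A : I -> pdisc R) (B : J -> pdisc R) inc N
   (a b l p1 p2 : R) : a ^+ 2 + b ^+ 2 = 1 -> 0 < l ->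
  bipacking A B inc N ->
  bipacking (similarity a b l p1 p2 \o A) (similarity a b l p1 p2 \o B) inc N.
Proof.
move=> ab l0; have ln0 : l != 0 by rewrite gt_eqF.
have pwS : forall D u v, pw (similarity a b l p1 p2 D) u v =
    l ^+ 2 * pw D (p1 + (a * u - b * v) / l) (p2 + (b * u + a * v) / l).
  move=> D u v; rewrite /pw /=.
  have -> : u = (a ^+ 2 + b ^+ 2) * u by rewrite ab mul1r.
  have -> : v = (a ^+ 2 + b ^+ 2) * v by rewrite ab mul1r.
  have key : forall s : R, s = a ^+ 2 + b ^+ 2 -> s = 1 ->
    (s * u - l * (a * (px D - p1) + b * (py D - p2))) ^+ 2 +
    (s * v - l * (- b * (px D - p1) + a * (py D - p2))) ^+ 2 - (l * pr D) ^+ 2 =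
    l ^+ 2 * ((p1 + (a * (s * u) - b * (s * v)) / l - px D) ^+ 2 +
     (p2 + (b * (s * u) + a * (s * v)) / l - py D) ^+ 2 - pr D ^+ 2).
    move=> s sE s1; rewrite s1 !mul1r.
    have -> : (u - l * (a * (px D - p1) + b * (py D - p2))) ^+ 2 +
      (v - l * (- b * (px D - p1) + a * (py D - p2))) ^+ 2 =
      u ^+ 2 + v ^+ 2 - 2 * l * (u * (a * (px D - p1) + b * (py D - p2)) +
        v * (- b * (px D - p1) + a * (py D - p2))) +
      l ^+ 2 * (a ^+ 2 + b ^+ 2) * ((px D - p1) ^+ 2 + (py D - p2) ^+ 2) by ring.
    rewrite -sE s1.
    transitivity (s * (u ^+ 2 + v ^+ 2) - 2 * l * (u * (a * (px D - p1) + b * (py D - p2)) +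
        v * (- b * (px D - p1) + a * (py D - p2))) +
      l ^+ 2 * ((px D - p1) ^+ 2 + (py D - p2) ^+ 2) - (l * pr D) ^+ 2).
      by rewrite s1; ring.
    by rewrite sE; field.
  exact: (key _ erefl).
have sqD : forall x y : R, (l * x + l * y) ^+ 2 = l ^+ 2 * (x + y) ^+ 2 by move=> *; ring.
have l2 : 0 < l ^+ 2 by rewrite exprn_gt0.
case=> H1 H2 H3 H4 H5 H6 H7 H8; split=> /=.
- by move=> i; rewrite mulr_gt0.
- by move=> i; rewrite mulr_gt0.
- by move=> i i' ii'; rewrite d2_similarity // sqD ler_pM2l //; apply: H3.
- by move=> i i' ii'; rewrite d2_similarity // sqD ler_pM2l //; apply: H4.
- by move=> i j ij; rewrite d2_similarity // H5 //; ring.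
- by move=> i j ij; rewrite d2_similarity // sqD ltr_pM2l //; apply: H6.
- move=> i; have [F HF] := H7 i; exists F => u v; rewrite pwS => /eqP.
  rewrite mulf_eq0 gt_eqF //= => /eqP /HF [k [ik pk]]; exists k; split=> //.
  by rewrite pwS pmulr_rle0.
- move=> i; have [F HF] := H8 i; exists F => u v; rewrite pwS => /eqP.
  rewrite mulf_eq0 gt_eqF //= => /eqP /HF [k [ik pk]]; exists k; split=> //.
  by rewrite pwS pmulr_rle0.
Qed.

(** For a point in the closed disc [D] and the open disc [E], the Cauchy-Schwarz inequality would
    put the centres at distance less than the sum of the radii. *)
Lemma pw_disjoint D E u v : 0 < pr D -> 0 < pr E ->
  (pr D + pr E) ^+ 2 <= d2 D E -> pw D u v <= 0 -> 0 <= pw E u v.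
Proof.
rewrite /d2 /pw; case: D => a b r; case: E => c d s /= r0 s0 H1 H2.
set x := u - a in H2 *; set y := v - b in H2 *.
rewrite leNgt; apply/negP => H3.
set z := u - c in H3; set w := v - d in H3.
have E1 : a - c = z - x by rewrite /z /x; ring.
have E2 : b - d = w - y by rewrite /w /y; ring.
rewrite E1 E2 in H1.
have H4 : - (x * z + y * w) <= r * s.
  rewrite leNgt; apply/negP => H5.
  have rs : 0 < r * s by rewrite mulr_gt0.
  have : (r * s) ^+ 2 < (x * z + y * w) ^+ 2 by rewrite -[ltRHS]sqrrN; nra.
  have -> : (x * z + y * w) ^+ 2 = (x ^+ 2 + y ^+ 2) * (z ^+ 2 + w ^+ 2) - (x * w - y * z) ^+ 2 by ring.
  have := sqr_ge0 (x * w - y * z).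
  have : (x ^+ 2 + y ^+ 2) * (z ^+ 2 + w ^+ 2) <= r ^+ 2 * s ^+ 2.
    by apply: ler_pM; [apply: addr_ge0; exact: sqr_ge0|apply: addr_ge0; exact: sqr_ge0| lra | lra].
  rewrite exprMn; lra.
nra.
Qed.

(** The inequalities of two inverted discs, [A |z|^2 - 2 b y + C <= 0] and
    [A2 |z|^2 - 2 b2 x + C2 <= 0], centred on perpendicular axes: the product of the linear terms
    drops out, and disjointness reads [2 r r2 <= A C2 + A2 C]. A disc containing the points at both
    heights [t1] and [t2] has [A] of order at most [r / t2] and [C] of order at most [r t1]; the
    last two hypotheses then make the right-hand side too small. *)
Lemma annulus_core (A C b r A2 C2 r2 t1 t2 : R) :
  0 <= A -> 0 <= C -> 0 < r -> r ^+ 2 = b ^+ 2 - A * C -> 0 < t1 -> 4 * t1 <= t2 ->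
  A * t1 ^+ 2 - 2 * b * t1 + C <= 0 -> A * t2 ^+ 2 - 2 * b * t2 + C <= 0 ->
  0 < A2 -> 0 < C2 -> 0 < r2 -> 2 * r * r2 <= A * C2 + A2 * C ->
  4 * C2 <= r2 * t2 -> 4 * A2 * t1 <= r2 -> False.
Proof.
move=> A0 C0 r0 rE t10 t12 H1 H2 A20 C20 r20 H3 H4 H5.
have sq_le : forall t, 0 < t -> A * t ^+ 2 - 2 * b * t + C <= 0 ->
    A * t ^+ 2 - C <= 2 * r * t /\ C - A * t ^+ 2 <= 2 * r * t.
  move=> t t0 Ht.
  have Hsq : (A * t ^+ 2 - C) ^+ 2 <= (2 * r * t) ^+ 2.
    have -> : (2 * r * t) ^+ 2 = 4 * t ^+ 2 * b ^+ 2 - 4 * t ^+ 2 * (A * C).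
      by rewrite -mulrBr -rE; ring.
    have : (A * t ^+ 2 + C) ^+ 2 <= (2 * b * t) ^+ 2.
      rewrite ler_sqr ?nnegrE; first lra.
        by rewrite addr_ge0 // mulr_ge0 // sqr_ge0.
      have := mulr_ge0 A0 (sqr_ge0 t); lra.
    have -> : (2 * b * t) ^+ 2 = 4 * t ^+ 2 * b ^+ 2 by ring.
    have -> : (A * t ^+ 2 + C) ^+ 2 = (A * t ^+ 2 - C) ^+ 2 + 4 * t ^+ 2 * (A * C) by ring.
    lra.
  have rt : 0 <= 2 * r * t by rewrite mulr_ge0 ?mulr_ge0 //; lra.
  have : `|A * t ^+ 2 - C| <= 2 * r * t.
    by rewrite -(ger0_norm rt) -ler_sqr ?nnegrE ?normr_ge0 // !real_normK ?num_real.
  by rewrite ler_norml => /andP[? ?]; split; lra.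
have [_ K1] := sq_le _ t10 H1.
have t20 : 0 < t2 by lra.
have [K2 _] := sq_le _ t20 H2.
(* the disc covers [t1, t2], so its curvatures at both ends are small *)
have hA : A * (t2 - t1) <= 2 * r.
  have : (A * (t2 - t1)) * (t1 + t2) <= 2 * r * (t1 + t2) by nra.
  by rewrite ler_pM2r //; lra.
have hC : C * (t2 - t1) <= 2 * r * (t1 * t2).
  have : (C * (t2 - t1)) * (t1 + t2) <= (2 * r * (t1 * t2)) * (t1 + t2).
    have L1 := ler_wpM2r (ltW (exprn_gt0 2 t20)) K1.
    have L2 := ler_wpM2r (ltW (exprn_gt0 2 t10)) K2.
    have -> : C * (t2 - t1) * (t1 + t2) = (C - A * t1 ^+ 2) * t2 ^+ 2 + (A * t2 ^+ 2 - C) * t1 ^+ 2 by ring.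
    have -> : 2 * r * (t1 * t2) * (t1 + t2) = 2 * r * t1 * t2 ^+ 2 + 2 * r * t2 * t1 ^+ 2 by ring.
    lra.
  by rewrite ler_pM2r //; lra.
have L1 : A * C2 * (t2 - t1) <= r * r2 * t2 / 2.
  have := ler_wpM2r (ltW C20) hA; have := ler_wpM2l (ltW r0) H4; nra.
have L2 : A2 * C * (t2 - t1) <= r * r2 * t2 / 2.
  have := ler_wpM2l (ltW A20) hC.
  have := ler_wpM2l (ltW (mulr_gt0 r0 t20)) H5; nra.
have L3 : 2 * r * r2 * (t2 - t1) <= r * r2 * t2.
  have : 2 * r * r2 * (t2 - t1) <= (A * C2 + A2 * C) * (t2 - t1) by rewrite ler_wpM2r //; lra.
  lra.
have := mulr_gt0 r0 r20; nra.
Qed.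

Lemma eqW (x y : R) : x = y -> x <= y.
Proof. by move=> ->. Qed.

Definition power0 D := px D ^+ 2 + py D ^+ 2 - pr D ^+ 2.

(* The equation of [D] after inversion in the unit circle, see [pw_inversion]. *)
Definition inverted D (z1 z2 : R) :=
  power0 D * (z1 ^+ 2 + z2 ^+ 2) - 2 * (px D * z1 + py D * z2) + 1.

Lemma pw_inversion D z1 z2 : let n := z1 ^+ 2 + z2 ^+ 2 in n != 0 ->
  pw D (z1 / n) (z2 / n) * n = inverted D z1 z2.
Proof.
move=> n n0; rewrite /pw /inverted /power0.
have -> : (z1 / n - px D) ^+ 2 + (z2 / n - py D) ^+ 2 - pr D ^+ 2 =
  (z1 ^+ 2 + z2 ^+ 2) / n ^+ 2 - 2 * (px D * z1 + py D * z2) / n +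
   (px D ^+ 2 + py D ^+ 2 - pr D ^+ 2) by field.
rewrite -/n; by field.
Qed.

Lemma pw_inversion_le0 D z1 z2 : let n := z1 ^+ 2 + z2 ^+ 2 in 0 < n ->
  (pw D (z1 / n) (z2 / n) <= 0) = (inverted D z1 z2 <= 0).
Proof.
by move=> n n0; rewrite -pw_inversion ?gt_eqF // pmulr_lle0.
Qed.

Lemma pw_inversion_eq0 D z1 z2 : let n := z1 ^+ 2 + z2 ^+ 2 in 0 < n ->
  inverted D z1 z2 = 0 -> pw D (z1 / n) (z2 / n) = 0.
Proof.
move=> n n0; rewrite -pw_inversion ?gt_eqF // => /eqP.
by rewrite mulf_eq0 (gt_eqF n0) orbF => /eqP.
Qed.

(* If the discs [j1], [j2], both orthogonal to [i], are not tangent (S = T), their inversive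
   distance S / T is bounded away from 1.  Otherwise they nearly touch, and of the N discs
   covering the circle of [j1], one contains, by the pigeonhole principle, two of N + 1 test
   points in geometric progression towards the narrow gap: it overlaps [j2]. *)
Lemma inversive_gap_frame (I J : Type) (A : I -> pdisc R) (B : J -> pdisc R)
    inc N i j1 j2 :
  bipacking A B inc N -> inc i j1 -> inc i j2 -> j1 <> j2 ->
  px (A i) = 0 -> py (A i) = - pr (A i) ->
  px (B j1) = - pr (B j1) -> py (B j1) = 0 ->
  let S := d2 (B j1) (B j2) - pr (B j1) ^+ 2 - pr (B j2) ^+ 2 in
  let T := 2 * pr (B j1) * pr (B j2) in
  S = T \/ T ^+ 2 < 4 ^+ N * (S ^+ 2 - T ^+ 2).
Proof.
move=> bp inc1 inc2 j12 Ex Ey E1x E1y S T.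
have rx0 := bp_pos1 bp i; have r10 := bp_pos2 bp j1; have r20 := bp_pos2 bp j2.
have O2 := bp_inc bp inc2; have D12 := bp_disj2 bp j12.
have pw00 : pw (B j1) 0 0 <= 0 by rewrite /pw E1x E1y; apply: eqW; ring.
have k20 := pw_disjoint r10 r20 D12 pw00.
have : power0 (B j2) = pw (B j2) 0 0 by rewrite /power0 /pw; ring.
move=> kE; rewrite -kE in k20.
move: @S @T; set rx := pr (A i) in rx0 O2 Ey *.
set r1 := pr (B j1) in r10 D12 E1x *; set r2 := pr (B j2) in r20 O2 D12 *.
set k := power0 (B j2) in k20 kE.
set c1 := px (B j2) in O2 *; set c2 := py (B j2) in O2 *.
have kdef : k = c1 ^+ 2 + c2 ^+ 2 - r2 ^+ 2 by [].
(* Both circles pass through the origin. Inversion maps [B j1] to the half-plane [z1 <= - u / 2] and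
   [A i] to [z2 <= - w / 2], bounded by perpendicular lines with corner [(- u / 2, - w / 2)]. *)
pose u := r1^-1; pose w := rx^-1.
have ru : r1 * u = 1 by rewrite mulfV // gt_eqF.
have rw : rx * w = 1 by rewrite mulfV // gt_eqF.
have u0 : 0 < u by rewrite invr_gt0.
have w0 : 0 < w by rewrite invr_gt0.
rewrite /d2 Ex Ey in O2; rewrite -/c1 -/c2 in O2.
have c2k : k = - 2 * rx * c2 by rewrite kdef; move: O2; clear; lra.
have c2E : c2 = - k * w / 2 by rewrite c2k; transitivity (c2 * (rx * w)); [rewrite rw mulr1|field].
(* With the corner as origin, the inverted [B j2] is [k |z|^2 - 2 b2 x + C2 <= 0], with [C2] as
   below; there is no term in [y], by orthogonality to [A i]. *)
pose b2 := c1 + k * u / 2.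
move=> S T; have SE : S = 2 * r1 * b2.
  rewrite /S /d2 E1x E1y -/c1 -/c2 /b2.
  have -> : 2 * r1 * (c1 + k * u / 2) = 2 * r1 * c1 + k * (r1 * u) by field.
  by rewrite ru kdef; ring.
pose C2 := k * (u ^+ 2 / 4 - w ^+ 2 / 4) + c1 * u + 1.
have r2E : r2 ^+ 2 = b2 ^+ 2 - k * C2.
  have : r2 ^+ 2 = c1 ^+ 2 + c2 ^+ 2 - k by rewrite kdef; ring.
  by rewrite c2E => ->; rewrite /b2 /C2; field.
have b2r2 : r2 <= b2.
  have : 2 * r1 * r2 <= S by rewrite /S; move: D12; clear; lra.
  by rewrite SE ler_pM2l // mulr_gt0.
(* If [k = 0], the circle of [B j2] also passes through the origin and touches that of [B j1]
   there. *)
have [k0|kn0] := eqVneq k 0.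
  left; rewrite SE /T; congr (_ * _); apply/eqP.
  by rewrite -[_ == _](@eqrXn2 _ 2) ?(ltW r20) ?(le_trans (ltW r20) b2r2) // r2E k0; apply/eqP; ring.
have kgt0 : 0 < k by rewrite lt_def kn0.
have [b2E|b2n] := eqVneq b2 r2; first by left; rewrite SE b2E.
right; rewrite ltNge; apply/negP => small.
have b2gt : r2 < b2 by rewrite lt_def b2n.
have C20 : 0 < C2.
  rewrite -(pmulr_rgt0 _ kgt0).
  have : r2 ^+ 2 < b2 ^+ 2 by rewrite ltr_sqr ?nnegrE ?(ltW r20) //; apply: ltW; apply: lt_trans b2gt.
  by move: r2E; clear; lra.
have kC2 : 4 ^+ N * (k * C2) <= r2 ^+ 2.
  have e1 : S ^+ 2 - T ^+ 2 = 4 * r1 ^+ 2 * (k * C2).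
    have -> : k * C2 = b2 ^+ 2 - r2 ^+ 2 by move: r2E; clear; lra.
    by rewrite SE /T; ring.
  have e2 : T ^+ 2 = 4 * r1 ^+ 2 * r2 ^+ 2 by rewrite /T; ring.
  have q0 : 0 < 4 * r1 ^+ 2 by rewrite mulr_gt0 // exprn_gt0.
  by rewrite -(ler_pM2l q0); move: small; rewrite e1 {1}e2; lra.
have [F HF] := bp_cover2 bp j1.
(* Heights above the corner on the image of the circle of [B j1]. By [kC2], those of index at most
   [N] lie between the scales [C2 / r2] and [r2 / k], as the last two hypotheses of [annulus_core]
   require. *)
pose t n := 4 ^+ n * (C2 / r2) : R.
have t0 n : 0 < t n by rewrite mulr_gt0 ?exprn_gt0 // divr_gt0.
pose z1 := - u / 2 : R; pose z2 n := - w / 2 + t n.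
have n0 n : 0 < z1 ^+ 2 + z2 n ^+ 2.
  rewrite ltr_wpDr ?sqr_ge0 // exprn_even_gt0 //= lt_eqF // /z1; move: u0; clear; lra.
have [n [l [m [nl lN [in1 Hn] [_ Hl]]]]] : exists n l m, [/\ (n < l)%N, (l <= #|'I_N|)%N,
    inc (F (m : 'I_N)) j1 /\ inverted (A (F m)) z1 (z2 n) <= 0 &
    inc (F m) j1 /\ inverted (A (F m)) z1 (z2 l) <= 0].
  apply: (pigeonhole_pair (P := fun n (m : 'I_N) => inc (F m) j1 /\ inverted (A (F m)) z1 (z2 n) <= 0)).
  move=> n _; have : pw (B j1) (z1 / (z1 ^+ 2 + z2 n ^+ 2)) (z2 n / (z1 ^+ 2 + z2 n ^+ 2)) = 0.
    apply: pw_inversion_eq0 => //; rewrite /inverted /power0 E1x E1y -/r1 /z1.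
    have -> : - r1 * (- u / 2) = (r1 * u) / 2 by field.
    by rewrite ru; field.
  by move=> /HF[m [im pm]]; exists m; rewrite -pw_inversion_le0.
rewrite card_ord in lN; move: in1 Hn Hl; set i2 := F m => in1 Hn Hl.
have i2i : i <> i2.
  move=> ii; move: Hn; rewrite -ii /inverted /power0 Ex Ey -/rx.
  have -> : (0 ^+ 2 + (- rx) ^+ 2 - rx ^+ 2) * (z1 ^+ 2 + z2 n ^+ 2) - 2 * (0 * z1 + - rx * z2 n) + 1 =
     - (rx * w) + 1 + 2 * (rx * t n) by rewrite /z2; field.
  by rewrite rw; have := mulr_gt0 rx0 (t0 n); clear; lra.
have rz0 := bp_pos1 bp i2; have Di := bp_disj1 bp i2i.
have O1 := bp_inc bp in1.
have pwA0 : pw (A i) 0 0 <= 0 by rewrite /pw Ex Ey -/rx; apply: eqW; ring.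
have a0 := pw_disjoint rx0 rz0 Di pwA0.
have aE : power0 (A i2) = pw (A i2) 0 0 by rewrite /power0 /pw; ring.
rewrite -aE in a0; set a := power0 (A i2) in a0 aE.
rewrite /inverted -/a in Hn Hl.
set rz := pr (A i2) in rz0 Di O1.
move: Di O1; rewrite /d2 Ex Ey E1x E1y -/rx -/r1.
set d1 := px (A i2) in Hn Hl *; set e := py (A i2) in Hn Hl *; move=> Di O1.
have adef : a = d1 ^+ 2 + e ^+ 2 - rz ^+ 2 by [].
have ad1 : a = - 2 * r1 * d1 by rewrite adef; move: O1; clear; lra.
have d1E : d1 = - a * u / 2 by rewrite ad1; transitivity (d1 * (r1 * u)); [rewrite ru mulr1|field].
pose b := e + a * w / 2.
have brz : rz <= b.
  have : 2 * rx * rz <= a + 2 * rx * e by rewrite adef; move: Di; clear; lra.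
  have -> : a + 2 * rx * e = 2 * rx * b.
    have -> : 2 * rx * b = 2 * rx * e + a * (rx * w) by rewrite /b; field.
    by rewrite rw; ring.
  by rewrite ler_pM2l // mulr_gt0.
pose C := a * (w ^+ 2 / 4 - u ^+ 2 / 4) + e * w + 1.
have rzE : rz ^+ 2 = b ^+ 2 - a * C.
  have : rz ^+ 2 = d1 ^+ 2 + e ^+ 2 - a by rewrite adef; ring.
  by rewrite d1E => ->; rewrite /b /C; field.
have formE n' : a * (z1 ^+ 2 + z2 n' ^+ 2) - 2 * (d1 * z1 + e * z2 n') + 1 =
    a * t n' ^+ 2 - 2 * b * t n' + C.
  by rewrite d1E /z1 /z2 /b /C; field.
rewrite !formE in Hn Hl.
have C0 : 0 < C \/ 0 < a /\ 0 <= C.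
  have [az|an0] := eqVneq a 0.
    left; rewrite /C az.
    have e0 : 0 < e by move: brz rz0; rewrite /b az; clear; lra.
    by have := mulr_gt0 e0 w0; clear; lra.
  have agt0 : 0 < a by rewrite lt_def an0.
  right; split=> //; rewrite -(pmulr_rge0 _ agt0).
  have : rz ^+ 2 <= b ^+ 2.
    by rewrite ler_sqr ?nnegrE ?(ltW rz0) //; apply: le_trans brz; apply: ltW.
  by move: rzE; clear; lra.
have C0' : 0 <= C by case: C0 => [/ltW|[]].
(* The image of [A i2] has no term in [x], by orthogonality to [B j1]. If [i2] and [j2] were
   incident, orthogonality would make the right-hand side vanish, although it is positive. *)
have sep : 2 * rz * r2 <= a * C2 + k * C.
  have lhsE : d2 (A i2) (B j2) = rz ^+ 2 + r2 ^+ 2 + (a * C2 + k * C).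
    rewrite /d2 -/d1 -/e -/c1 -/c2.
    have -> : (d1 - c1) ^+ 2 + (e - c2) ^+ 2 =
      (d1 ^+ 2 + e ^+ 2 - a) + (c1 ^+ 2 + c2 ^+ 2 - k) + (a + k) - 2 * (d1 * c1 + e * c2) by ring.
    have -> : d1 ^+ 2 + e ^+ 2 - a = rz ^+ 2 by rewrite adef; ring.
    have -> : c1 ^+ 2 + c2 ^+ 2 - k = r2 ^+ 2 by rewrite kdef; ring.
    by rewrite d1E c2E /C2 /C; field.
  have [ij2|nij2] := pselect (inc i2 j2).
    have := bp_inc bp ij2; rewrite lhsE -/rz -/r2 => h0.
    have sum0 : a * C2 + k * C = 0 by move: h0; clear; lra.
    have kC : 0 <= k * C by rewrite mulr_ge0.
    have aC : 0 <= a * C2 by rewrite mulr_ge0 // ltW.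
    exfalso; case: C0 => [Cp|[ap _]].
      by have := mulr_gt0 kgt0 Cp; move: sum0 aC; clear; lra.
    by have := mulr_gt0 ap C20; move: sum0 kC; clear; lra.
  have := bp_ninc bp nij2; rewrite lhsE -/rz -/r2; clear; lra.
apply: (annulus_core (A := a) (C := C) (b := b) (r := rz) (A2 := k) (C2 := C2)
   (r2 := r2) (t1 := t n) (t2 := t l)) => //.
- have : (4 : R) ^+ n.+1 <= 4 ^+ l by rewrite ler_eXn2l // ltr1n.
  rewrite exprS => h; rewrite /t mulrA ler_pM2r // divr_gt0 //.
- rewrite /t.
  have -> : r2 * (4 ^+ l * (C2 / r2)) = 4 ^+ l * C2 by field; rewrite gt_eqF.
  rewrite ler_pM2r //.
  have : (4 : R) ^+ 1 <= 4 ^+ l by rewrite ler_weXn2l ?ler1n //; exact: leq_ltn_trans nl.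
  by rewrite expr1.
- rewrite /t -(ler_pM2r r20).
  have -> : 4 * k * (4 ^+ n * (C2 / r2)) * r2 = 4 ^+ n.+1 * (k * C2) by rewrite exprS; field; rewrite gt_eqF.
  rewrite -expr2; apply: le_trans kC2; rewrite ler_pM2r ?mulr_gt0 //.
  by rewrite ler_weXn2l ?ler1n //; exact: leq_trans nl lN.
Qed.

(** The new origin [(p1, p2)] is one of the two points where the circles meet; from there the two
    centres are seen in perpendicular directions. *)
Lemma orthogonal_frame D E : 0 < pr D -> 0 < pr E ->
  d2 D E = pr D ^+ 2 + pr E ^+ 2 ->
  exists a b p1 p2, let S := similarity a b 1 p1 p2 in
   [/\ a ^+ 2 + b ^+ 2 = 1, px (S D) = 0, py (S D) = - pr D,
      px (S E) = - pr E & py (S E) = 0].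
Proof.
case: D => x y r; case: E => x' y' s; rewrite /d2 /= => r0 s0.
pose d1 := x' - x; pose d2 := y' - y.
have -> : (x - x') ^+ 2 + (y - y') ^+ 2 = d1 ^+ 2 + d2 ^+ 2 by rewrite /d1 /d2; ring.
have -> : x' = x + d1 by rewrite /d1; ring.
have -> : y' = y + d2 by rewrite /d2; ring.
move: d1 d2 => d1 d2 dE.
pose q := r ^+ 2 + s ^+ 2.
have q0 : q != 0 by rewrite gt_eqF // addr_gt0 // exprn_gt0.
exists ((- s * d1 + r * d2) / q), ((- s * d2 - r * d1) / q),
  (x + (r ^+ 2 * d1 + r * s * d2) / q), (y + (r ^+ 2 * d2 - r * s * d1) / q).
have qs : s ^+ 2 = q - r ^+ 2 by rewrite /q; ring.
split.
- transitivity ((s ^+ 2 + r ^+ 2) * (d1 ^+ 2 + d2 ^+ 2) / q ^+ 2); first by field.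
  by rewrite dE qs; field.
- by field.
- transitivity (- r * (r ^+ 2 + s ^+ 2) * (d1 ^+ 2 + d2 ^+ 2) / q ^+ 2); first by field.
  by rewrite dE qs; field.
- transitivity (- s * (d1 ^+ 2 + d2 ^+ 2) * (s ^+ 2 + r ^+ 2) / q ^+ 2).
    by rewrite /q; field; exact: q0.
  by rewrite dE qs; field.
- by rewrite /q; field; exact: q0.
Qed.

Lemma inversive_gap (I J : Type) (A : I -> pdisc R) (B : J -> pdisc R)
    inc N i j1 j2 :
  bipacking A B inc N -> inc i j1 -> inc i j2 -> j1 <> j2 ->
  let S := d2 (B j1) (B j2) - pr (B j1) ^+ 2 - pr (B j2) ^+ 2 in
  let T := 2 * pr (B j1) * pr (B j2) in
  S = T \/ T ^+ 2 < 4 ^+ N * (S ^+ 2 - T ^+ 2).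
Proof.
move=> bp inc1 inc2 j12.
have [a [b [p1 [p2 [ab e1 e2 e3 e4]]]]] := orthogonal_frame (bp_pos1 bp i) (bp_pos2 bp j1) (bp_inc bp inc1).
have bp' := bipacking_similarity p1 p2 ab ltr01 bp.
have := inversive_gap_frame bp' inc1 inc2 j12 e1.
rewrite /comp d2_similarity //= expr1n !mul1r => h; apply: h.
- by rewrite -e2 /=; ring.
- by rewrite -e3 /=; ring.
- by rewrite -e4 /=; ring.
Qed.

(** A circle orthogonal to two tangent circles passes through their point of tangency, here the new
    origin, and has its centre on the common tangent. Only the side on which this centre lies
    remains undetermined, hence the disjunction. *)
Lemma tangent_frame D E E' : 0 < pr D -> 0 < pr E -> 0 < pr E' ->
  d2 D E = pr D ^+ 2 + pr E ^+ 2 -> d2 D E' = pr D ^+ 2 + pr E' ^+ 2 ->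
  d2 E E' = (pr E + pr E') ^+ 2 ->
  exists a b p1 p2, let S := similarity a b 1 p1 p2 in
   [/\ a ^+ 2 + b ^+ 2 = 1, px (S E) = - pr E, py (S E) = 0,
      px (S E') = pr E' & py (S E') = 0] /\
   px (S D) = 0 /\ (py (S D) = - pr D \/ py (S D) = pr D).
Proof.
case: D => x y r; case: E => x1 y1 s; case: E' => x2 y2 t; rewrite /d2 /= => r0 s0 t0 O1 O2 Tg.
have q0 : s + t != 0 by rewrite gt_eqF // addr_gt0.
pose q := s + t.
pose a := (x2 - x1) / q; pose b := (y2 - y1) / q.
have ab : a ^+ 2 + b ^+ 2 = 1.
  transitivity (((x1 - x2) ^+ 2 + (y1 - y2) ^+ 2) / q ^+ 2); first by rewrite /a /b; field.
  by rewrite Tg /q; field.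
have x2E : x2 = x1 + q * a by rewrite /a; field.
have y2E : y2 = y1 + q * b by rewrite /b; field.
exists a, b, (x1 + s * a), (y1 + s * b); split; first split => //.
- by transitivity (- s * (a ^+ 2 + b ^+ 2)); [ring|rewrite ab mulr1].
- by ring.
- transitivity (t * (a ^+ 2 + b ^+ 2)); last by rewrite ab mulr1.
  by rewrite x2E y2E /q; ring.
- by rewrite x2E y2E /q; ring.
set X := 1 * _; set Y := (X in X = - r); rewrite -/Y; split.
  have e1 : (x - x1) ^+ 2 + (y - y1) ^+ 2 = r ^+ 2 + s ^+ 2 := O1.
  have e2 : (x - x2) ^+ 2 + (y - y2) ^+ 2 = r ^+ 2 + t ^+ 2 := O2.
  have : 2 * q * X = 0.
    have -> : 2 * q * X = ((x - x1) ^+ 2 + (y - y1) ^+ 2) - ((x - x2) ^+ 2 + (y - y2) ^+ 2) +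
        (q ^+ 2 - 2 * q * s) * (a ^+ 2 + b ^+ 2).
      by rewrite /X x2E y2E; ring.
    by rewrite e1 e2 ab /q; ring.
  move/eqP; rewrite mulf_eq0 mulf_eq0 pnatr_eq0 /= (negbTE q0) /=; exact: eqP.
have : Y ^+ 2 = r ^+ 2.
  have -> : Y ^+ 2 = (a ^+ 2 + b ^+ 2) * ((x - x1) ^+ 2 + (y - y1) ^+ 2)
     - (X + s * (a ^+ 2 + b ^+ 2)) ^+ 2 by rewrite /X /Y; ring.
  rewrite ab mulr1 mul1r O1.
  suff -> : X = 0 by ring.
  have : 2 * q * X = 0.
    have -> : 2 * q * X = ((x - x1) ^+ 2 + (y - y1) ^+ 2) - ((x - x2) ^+ 2 + (y - y2) ^+ 2) +
        (q ^+ 2 - 2 * q * s) * (a ^+ 2 + b ^+ 2).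
      by rewrite /X x2E y2E; ring.
    by rewrite O1 O2 ab /q; ring.
  by move/eqP; rewrite mulf_eq0 mulf_eq0 pnatr_eq0 /= (negbTE q0) /=; exact: eqP.
by move/eqP; rewrite eqf_sqr => /orP[] /eqP ->; [right|left].
Qed.

(** Inverted in the point of tangency, [B j1] and [B j2] become half-planes on either side of a
    strip of width [h], and [A i] a half-plane across it. A bounded disc centred on one edge of the
    strip without crossing the other has diameter at most [2 h], so it cannot contain two of the
    test points, which are at least [3 h] apart. If [A i] were very small, [N + 1] of them would fit
    below the height of the centre of inversion. *)
Lemma tangent_curvature_frame (I J : Type) (A : I -> pdisc R) (B : J -> pdisc R)
    inc N i j1 j2 :
  bipacking A B inc N -> inc i j1 -> inc i j2 ->
  px (A i) = 0 -> py (A i) = - pr (A i) ->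
  px (B j1) = - pr (B j1) -> py (B j1) = 0 ->
  px (B j2) = pr (B j2) -> py (B j2) = 0 ->
  (pr (A i))^-1 < 3 * N.+1%:R * ((pr (B j1))^-1 + (pr (B j2))^-1).
Proof.
move=> bp inc1 inc2 Ex Ey E1x E1y E2x E2y.
have rx0 := bp_pos1 bp i; have r10 := bp_pos2 bp j1; have r20 := bp_pos2 bp j2.
move: rx0 r10 r20 Ey E1x E2x; set rx := pr (A i) => rx0 r10 r20 Ey E1x E2x.
move: r10 r20 E1x E2x; set r1 := pr (B j1); set r2 := pr (B j2) => r10 r20 E1x E2x.
pose u := r1^-1; pose w := rx^-1; pose u2 := r2^-1; rewrite -/u -/w -/u2.
have ru : r1 * u = 1 by rewrite mulfV // gt_eqF.
have rw : rx * w = 1 by rewrite mulfV // gt_eqF.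
have u0 : 0 < u by rewrite invr_gt0.
have u20 : 0 < u2 by rewrite invr_gt0.
have w0 : 0 < w by rewrite invr_gt0.
rewrite ltNge; apply/negP => small.
have [F HF] := bp_cover2 bp j1.
pose h := (u + u2) / 2.
have h0 : 0 < h by rewrite /h divr_gt0 // addr_gt0.
have h3 : 0 < 3 * h by rewrite mulr_gt0.
pose t n := 3 * h * n.+1%:R : R.
have t0 n : 0 < t n by rewrite mulr_gt0 ?ltr0n // mulr_gt0.
pose z1 := - u / 2 : R; pose z2 n := - w / 2 + t n.
have n0 n : 0 < z1 ^+ 2 + z2 n ^+ 2.
  by rewrite ltr_wpDr ?sqr_ge0 // exprn_even_gt0 //= lt_eqF // /z1; move: u0; clear; lra.
have [n [l [m [nl lN [in1 Hn] [_ Hl]]]]] : exists n l m, [/\ (n < l)%N, (l <= #|'I_N|)%N,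
    inc (F (m : 'I_N)) j1 /\ inverted (A (F m)) z1 (z2 n) <= 0 &
    inc (F m) j1 /\ inverted (A (F m)) z1 (z2 l) <= 0].
  apply: (pigeonhole_pair (P := fun n (m : 'I_N) => inc (F m) j1 /\ inverted (A (F m)) z1 (z2 n) <= 0)).
  move=> n _; have : pw (B j1) (z1 / (z1 ^+ 2 + z2 n ^+ 2)) (z2 n / (z1 ^+ 2 + z2 n ^+ 2)) = 0.
    apply: pw_inversion_eq0 => //; rewrite /inverted /power0 E1x E1y -/r1 /z1.
    have -> : - r1 * (- u / 2) = (r1 * u) / 2 by field.
    by rewrite ru; field.
  by move=> /HF[m [im pm]]; exists m; rewrite -pw_inversion_le0.
rewrite card_ord in lN; move: in1 Hn Hl; set i2 := F m => in1 Hn Hl.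
have i2i : i <> i2.
  move=> ii; move: Hn; rewrite -ii /inverted /power0 Ex Ey -/rx.
  have -> : (0 ^+ 2 + (- rx) ^+ 2 - rx ^+ 2) * (z1 ^+ 2 + z2 n ^+ 2) - 2 * (0 * z1 + - rx * z2 n) + 1 =
     - (rx * w) + 1 + 2 * (rx * t n) by rewrite /z2; field.
  by rewrite rw; have := mulr_gt0 rx0 (t0 n); clear; lra.
have rz0 := bp_pos1 bp i2; have Di := bp_disj1 bp i2i.
have O1 := bp_inc bp in1.
have pwA0 : pw (A i) 0 0 <= 0 by rewrite /pw Ex Ey -/rx; apply: eqW; ring.
have a0 := pw_disjoint rx0 rz0 Di pwA0.
have aE : power0 (A i2) = pw (A i2) 0 0 by rewrite /power0 /pw; ring.
rewrite -aE in a0; set a := power0 (A i2) in a0 aE.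
rewrite /inverted -/a in Hn Hl.
set rz := pr (A i2) in rz0 Di O1.
move: Di O1; rewrite /d2 Ex Ey E1x E1y -/rx -/r1.
set d1 := px (A i2) in Hn Hl *; set e := py (A i2) in Hn Hl *; move=> Di O1.
have adef : a = d1 ^+ 2 + e ^+ 2 - rz ^+ 2 by [].
have ad1 : a = - 2 * r1 * d1 by rewrite adef; move: O1; clear; lra.
have d1E : d1 = - a * u / 2 by rewrite ad1; transitivity (d1 * (r1 * u)); [rewrite ru mulr1|field].
pose b := e + a * w / 2.
have brz : rz <= b.
  have : 2 * rx * rz <= a + 2 * rx * e by rewrite adef; move: Di; clear; lra.
  have -> : a + 2 * rx * e = 2 * rx * b.
    have -> : 2 * rx * b = 2 * rx * e + a * (rx * w) by rewrite /b; field.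
    by rewrite rw; ring.
  by rewrite ler_pM2l // mulr_gt0.
pose C := a * (w ^+ 2 / 4 - u ^+ 2 / 4) + e * w + 1.
have rzE : rz ^+ 2 = b ^+ 2 - a * C.
  have : rz ^+ 2 = d1 ^+ 2 + e ^+ 2 - a by rewrite adef; ring.
  by rewrite d1E => ->; rewrite /b /C; field.
have formE n' : a * (z1 ^+ 2 + z2 n' ^+ 2) - 2 * (d1 * z1 + e * z2 n') + 1 =
    a * t n' ^+ 2 - 2 * b * t n' + C.
  by rewrite d1E /z1 /z2 /b /C; field.
rewrite !formE in Hn Hl.
(* If [A i2] passes through the centre of inversion, its image is a half-plane which starts above
   height [w / 2], beyond all the test points. *)
have [az|an0] := eqVneq a 0.
  have e0 : 0 < e by move: brz rz0; rewrite /b az; clear; lra.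
  have tw : t n <= w / 2.
    have : t n <= 3 * h * N.+1%:R.
      by rewrite /t (ler_pM2l h3) ler_nat ltnS; exact: (ltnW (leq_trans nl lN)).
    by move: small; rewrite /h; clear; lra.
  have := ler_wpM2l (ltW e0) tw.
  by move: Hn; rewrite /b /C az; clear; lra.
have agt0 : 0 < a by rewrite lt_def an0.
have ds s : a * t s ^+ 2 - 2 * b * t s + C <= 0 -> `|a * t s - b| <= rz.
  move=> Hs; rewrite -(ger0_norm (ltW rz0)) -ler_sqr ?nnegrE ?normr_ge0 // !real_normK ?num_real //.
  rewrite rzE; have := ler_wpM2l a0 Hs.
  by rewrite mulr0; clear; lra.
have len : a * (t l - t n) <= 2 * rz.
  have := ds _ Hn; have := ds _ Hl; rewrite !ler_norml => /andP[_ h1] /andP[h2 _].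
  by move: h1 h2; clear; lra.
have sep : 2 * rz * r2 <= a * (r2 * u + 1).
  have lhsE : d2 (A i2) (B j2) = rz ^+ 2 + r2 ^+ 2 + a * (r2 * u + 1).
    rewrite /d2 -/d1 -/e E2x E2y.
    have -> : (d1 - r2) ^+ 2 + (e - 0) ^+ 2 =
      (d1 ^+ 2 + e ^+ 2 - a) + a + r2 ^+ 2 - 2 * (d1 * r2) by ring.
    have -> : d1 ^+ 2 + e ^+ 2 - a = rz ^+ 2 by rewrite adef; ring.
    by rewrite d1E; field.
  have [ij2|nij2] := pselect (inc i2 j2).
    have := bp_inc bp ij2; rewrite lhsE -/rz -/r2 => h1.
    exfalso; have : 0 < a * (r2 * u + 1) by rewrite mulr_gt0 // ltr_wpDl // ltW // mulr_gt0.
    by move: h1; clear; lra.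
  by have := bp_ninc bp nij2; rewrite lhsE -/rz -/r2; clear; lra.
have : a * (3 * h) * r2 <= a * (2 * h * r2).
  have -> : 2 * h * r2 = r2 * u + (r2 * u2) by rewrite /h; field.
  have -> : r2 * u2 = 1 by rewrite mulfV // gt_eqF.
  apply: le_trans sep; rewrite ler_pM2r //; apply: le_trans len; rewrite ler_pM2l //.
  rewrite /t -mulrBr -natrB; last by rewrite ltnS ltnW.
  by rewrite ler_peMr ?(ltW h3) // ler1n subSS subn_gt0.
have := mulr_gt0 agt0 (mulr_gt0 h0 r20); clear; lra.
Qed.

Lemma tangent_curvature (I J : Type) (A : I -> pdisc R) (B : J -> pdisc R)
    inc N i j1 j2 :
  bipacking A B inc N -> inc i j1 -> inc i j2 ->
  d2 (B j1) (B j2) = (pr (B j1) + pr (B j2)) ^+ 2 ->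
  (pr (A i))^-1 < 3 * N.+1%:R * ((pr (B j1))^-1 + (pr (B j2))^-1).
Proof.
move=> bp inc1 inc2 tg.
have [a [b [p1 [p2 [[ab e1 e2 e3 e4] [e5 e6]]]]]] := tangent_frame (bp_pos1 bp i)
  (bp_pos2 bp j1) (bp_pos2 bp j2) (bp_inc bp inc1) (bp_inc bp inc2) tg.
case: e6 => e6.
  have bp' := bipacking_similarity p1 p2 ab ltr01 bp.
  have := tangent_curvature_frame bp' inc1 inc2 e5.
  rewrite /comp [pr (similarity _ _ _ _ _ (A i))]/= [pr (similarity _ _ _ _ _ (B j1))]/=
     [pr (similarity _ _ _ _ _ (B j2))]/= !mul1r => h; apply: h => //.
(* A further half turn, exchanging [j1] and [j2], brings the centre of [A i] below the origin. *)
have ab' : (- a) ^+ 2 + (- b) ^+ 2 = 1 by rewrite !sqrrN.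
have bp' := bipacking_similarity p1 p2 ab' ltr01 bp.
have := tangent_curvature_frame bp' inc2 inc1.
rewrite /comp [pr (similarity _ _ _ _ _ (A i))]/= [pr (similarity _ _ _ _ _ (B j1))]/=
   [pr (similarity _ _ _ _ _ (B j2))]/= !mul1r [_^-1 + _]addrC => h; apply: h.
- by rewrite -[RHS]oppr0 -e5 /=; ring.
- by rewrite -e6 /=; ring.
- by rewrite -e3 /=; ring.
- by rewrite -[RHS]oppr0 -e4 /=; ring.
- by rewrite -[RHS]opprK -e1 /=; ring.
- by rewrite -[RHS]oppr0 -e2 /=; ring.
Qed.

(** The new origin is the point of the circle of [D] farthest from the centre of [E]. Inversion in
    it turns the circle of [D] into the line at height -1, on which [E] cuts out an interval around
    0 of half-length at most the radius of [E]. *)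
Lemma antipodal_frame D E : 0 < pr D -> 0 < pr E ->
  d2 D E = pr D ^+ 2 + pr E ^+ 2 ->
  exists a b l p1 p2, let S := similarity a b l p1 p2 in
   [/\ a ^+ 2 + b ^+ 2 = 1, 0 < l, l * pr D = 1 / 2 &
     [/\ px (S D) = 0, py (S D) = - (1 / 2), px (S E) = 0 & py (S E) <= - 1]].
Proof.
case: D => x y r; case: E => x' y' s; rewrite /d2 /= => r0 s0 O.
pose q := Num.sqrt (r ^+ 2 + s ^+ 2).
have q2 : q ^+ 2 = r ^+ 2 + s ^+ 2 by rewrite sqr_sqrtr // addr_ge0 // sqr_ge0.
have q0 : 0 < q by rewrite sqrtr_gt0 addr_gt0 // exprn_gt0.
have qn : q != 0 by rewrite gt_eqF.
have rn : r != 0 by rewrite gt_eqF.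
pose a := (y - y') / q; pose b := - (x - x') / q.
have ab : a ^+ 2 + b ^+ 2 = 1.
  transitivity (((x - x') ^+ 2 + (y - y') ^+ 2) / q ^+ 2); first by rewrite /a /b; field.
  by rewrite O -q2; field.
have xE : x' = x + q * b by rewrite /b; field.
have yE : y' = y - q * a by rewrite /a; field.
exists a, b, (1 / (2 * r)), (x - r * b), (y + r * a); split => //.
- by rewrite divr_gt0 // mulr_gt0.
- by field.
split.
- by field.
- transitivity (- (1 / 2) * (a ^+ 2 + b ^+ 2)); last by rewrite ab mulr1.
  by field.
- by rewrite xE yE; field.
have -> : 1 / (2 * r) * (- b * (x' - (x - r * b)) + a * (y' - (y + r * a))) =
    - (r + q) / (2 * r) * (a ^+ 2 + b ^+ 2) by rewrite xE yE; field.
have rq : r <= q by rewrite -ler_sqr ?nnegrE ?(ltW r0) ?(ltW q0) // q2 lerDl sqr_ge0.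
by rewrite ab mulr1 mulNr lerN2 ler_pdivlMr ?mulr_gt0 //; move: rq; clear; lra.
Qed.

(** Two tangent discs orthogonal to the circle of centre (0,-1/2) and radius 1/2 cut out intervals
    on its inverted image, on either side of 0 and each reaching to within [T] of 0. If the first
    has radius below [R0], then [a >= 3/4]. If [a' >= 0], the intervals are kept apart by 0 and
    cannot be tangent; if [a' < 0], the second goes around infinity, and the two estimates of
    [r' - c] give [1 / 2 <= 8 r T]. The constant 17 is there to exclude this. *)
Lemma tangent_core (a c1 r a' c r' T R0 : R) :
  a < 1 -> 0 < c1 -> 0 < r -> r ^+ 2 = c1 ^+ 2 - a * (1 - a) ->
  1 - a <= T * (r + c1) -> c1 <= 2 * r -> r < R0 -> 0 < T -> 17 * R0 * T <= 1 -> 1 <= R0 ->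
  a' < 1 -> 0 < c -> 0 < r' -> r' ^+ 2 = c ^+ 2 - a' * (1 - a') ->
  a' * T ^+ 2 - 2 * c * T + (1 - a') <= 0 ->
  a * (1 - a') + a' * (1 - a) + 2 * c1 * c = 2 * r * r' -> False.
Proof.
move=> a1 c10 r0 rE H1 H2 rR T0 TR R1 a'1 c0 r'0 r'E H3 H4.
have TRr : 17 * T * r <= 1.
  by have := ler_wpM2l (ltW T0) (ltW rR); move: TR; clear; lra.
have T17 : 17 * T <= 1 by have := ler_wpM2l (ltW T0) R1; move: TR; clear; lra.
have a34 : 3 / 4 <= a.
  have := ler_wpM2l (ltW T0) H2; move: H1 TRr; clear; lra.
have rc1 : r <= c1.
  rewrite -ler_sqr ?nnegrE ?(ltW r0) ?(ltW c10) // rE.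
  have : 0 <= a * (1 - a) by rewrite mulr_ge0 //; move: a34 a1; clear; lra.
  by clear; lra.
have [a'0|a'0] := leP 0 a'.
  have r'c : r' <= c.
    rewrite -ler_sqr ?nnegrE ?(ltW r'0) ?(ltW c0) // r'E.
    have : 0 <= a' * (1 - a') by rewrite mulr_ge0 //; move: a'1; clear; lra.
    by clear; lra.
  have : r * r' <= c1 * c by rewrite ler_pM // ltW.
  have : 0 < a * (1 - a') by rewrite mulr_gt0 //; move: a34 a'1; clear; lra.
  have : 0 <= a' * (1 - a) by rewrite mulr_ge0 //; move: a1; clear; lra.
  by move: H4; clear; lra.
pose C := 1 - a'.
have C1 : 1 < C by rewrite /C; move: a'0; clear; lra.
have aC : a' = 1 - C by rewrite /C; ring.
rewrite aC in r'E H3 H4.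
have T2 : T ^+ 2 <= 1 / 2.
  have : T ^+ 2 <= T by rewrite expr2 ger_pMr //; move: T17 T0; clear; lra.
  by move: T17; clear; lra.
have CT : C <= 4 * c * T.
  have : C * T ^+ 2 <= C * (1 / 2) by rewrite ler_pM2l //; move: C1; clear; lra.
  have := sqr_ge0 T; move: H3; clear; lra.
have r'2 : r' ^+ 2 <= c ^+ 2 + C ^+ 2 by rewrite r'E; move: C1; clear; nra.
have cr' : c <= r'.
  rewrite -ler_sqr ?nnegrE ?(ltW r'0) ?(ltW c0) // r'E.
  have : 0 < (C - 1) * C by rewrite mulr_gt0 //; move: C1; clear; lra.
  by clear; lra.
have d1 : r' - c <= 2 * T * C.
  have : (r' - c) * (2 * c) <= (2 * T * C) * (2 * c).
    have : (r' - c) * (2 * c) <= C ^+ 2 by move: r'2 cr' c0; clear; nra.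
    have : C * C <= C * (4 * c * T) by rewrite ler_pM2l //; move: C1; clear; lra.
    by rewrite -expr2; clear; lra.
  by rewrite ler_pM2r // mulr_gt0.
have C0 : 0 < C by apply: lt_trans C1.
have e1 : C / 2 <= 2 * c1 * (r' - c).
  have : (C - 1) * (1 - a) <= C * (1 / 4).
    apply: ler_pM; move: C1 a34 a1; clear; lra.
  have : 3 / 4 * C <= a * C by rewrite ler_pM2r.
  have : r * r' <= c1 * r' by rewrite ler_pM2r.
  by move: H4; clear; lra.
have e2 : 2 * c1 * (r' - c) <= 2 * c1 * (2 * T * C) by rewrite ler_pM2l // mulr_gt0.
have e3 : c1 * T * C <= 2 * r * T * C by rewrite ler_pM2r // ler_pM2r.
have e4 : 17 * T * r * C <= 1 * C by rewrite ler_pM2r.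
by move: e1 e2 e3 e4 C0; clear; lra.
Qed.

(* Discs orthogonal to the circle of centre (0,-1/2) through the origin have
   centre (c,-a); T1 and T2 are inverted coordinates of two of its points. *)
Lemma two_points_core (a c r T1 T2 q : R) : a < 1 -> 0 < r ->
  r ^+ 2 = c ^+ 2 - a * (1 - a) -> 0 < T1 -> q * T1 <= T2 -> 3 <= q -> T1 <= 1 ->
  a * T1 ^+ 2 - 2 * c * T1 + (1 - a) <= 0 ->
  a * T2 ^+ 2 - 2 * c * T2 + (1 - a) <= 0 ->
  [/\ 0 < c, 1 - a <= T1 * (r + c), q * c <= (q + 3) * r & a * T2 <= r + c].
Proof.
move=> a1 r0 rE T10 T12 q3 T11 H1 H2.
have T20 : 0 < T2 by apply: lt_le_trans T12; rewrite mulr_gt0 //; move: q3; clear; lra.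
have C0 : 0 < 1 - a by move: a1; clear; lra.
have c0 : 0 < c.
  have : 0 < c * T1; last by rewrite pmulr_lgt0.
  have T2s : T1 ^+ 2 <= 1 by rewrite exprn_ile1 // ltW.
  have := sqr_ge0 T1.
  have [a0|a0] := leP 0 a; last first.
    move: H1; have := ler_wnM2l (ltW a0) T2s; move: C0; clear; lra.
  have := mulr_ge0 a0 (sqr_ge0 T1); move: H1 C0; clear; lra.
have dev T : 0 < T -> a * T ^+ 2 - 2 * c * T + (1 - a) <= 0 -> `|(1 - a) - c * T| <= r * T.
  move=> T0 HT; rewrite -(ger0_norm (ltW (mulr_gt0 r0 T0))) -ler_sqr ?nnegrE ?normr_ge0 //.
  rewrite !real_normK ?num_real // exprMn rE.
  have := ler_wpM2l (ltW C0) HT; rewrite mulr0; clear; lra.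
have := dev _ T10 H1; rewrite ler_norml => /andP[_ h1].
have := dev _ T20 H2; rewrite ler_norml => /andP[h2 _].
split => //.
- by move: h1; clear; lra.
- have k : c * T2 <= (r + c) * T1 + r * T2 by move: h1 h2; clear; lra.
  have k2 : q * (c * T2) <= (r + c) * T2 + q * (r * T2).
    have q0 : 0 <= q by move: q3; clear; lra.
    have := ler_wpM2l q0 k; have := ler_wpM2l (ltW (addr_gt0 r0 c0)) T12; clear; lra.
  have k3 : q * c <= r + c + q * r.
    by rewrite -(ler_pM2r T20); move: k2; clear; lra.
  have c2 : c <= 2 * r.
    have : (q - 1) * c <= (q - 1) * (2 * r).
      by have := ler_wpM2r (ltW r0) q3; move: k3; clear; lra.
    by rewrite ler_pM2l //; move: q3; clear; lra.
  by move: k3 c2; clear; lra.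
have [a0|a0] := leP a 0.
  have : a * T2 <= 0 by rewrite pmulr_lle0.
  by move: r0 c0; clear; lra.
have : `|a * T2 - c| <= r.
  rewrite -(ger0_norm (ltW r0)) -ler_sqr ?nnegrE ?normr_ge0 // !real_normK ?num_real // rE.
  have := ler_wpM2l (ltW a0) H2; rewrite mulr0; clear; lra.
by rewrite ler_norml => /andP[_]; clear; lra.
Qed.

(** The ratio of consecutive scales makes the inversive distance of the two discs found by the
    pigeonhole principle closer to 1 than [inversive_gap] permits: 144 comes from [up2] in
    [ring_frame] and [4 ^+ N] from the gap. In [ring_bound], [3 * N.+1] is the constant of
    [tangent_curvature], 17 that of [tangent_core], and the exponent leaves room for N^2 + 1
    scales. *)
Definition ring_scale (N : nat) : R := 144 * 4 ^+ N.
Definition ring_bound (N : nat) : R := 17 * (3 * N.+1%:R) * ring_scale N ^+ (N * N).+1.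
Lemma ring_bound_gt0 N : 0 < ring_bound N.
Proof. by rewrite !mulr_gt0 ?ltr0n ?exprn_gt0 // mulr_gt0 // exprn_gt0. Qed.

(* If [B j] is small, take N^2 + 1 geometrically spaced scales and, at each, a test point on
   either side of [B j].  By the pigeonhole principle one disc contains two test points on one
   side and one disc the two symmetric ones, so their inversive distance is close to 1.  They
   are then tangent by [inversive_gap], which contradicts [tangent_curvature]. *)
Lemma ring_frame (I J : Type) (A : I -> pdisc R) (B : J -> pdisc R) inc N i j :
  bipacking A B inc N -> inc i j ->
  px (A i) = 0 -> py (A i) = - (1 / 2) -> pr (A i) = 1 / 2 ->
  px (B j) = 0 -> py (B j) <= - 1 ->
  1 < ring_bound N * pr (B j).
Proof.
move=> bp ij Ex Ey Er Yx Yy.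
have s0 := bp_pos2 bp j; move: s0; set s := pr (B j) => s0.
rewrite ltNge; apply/negP => small.
pose q := ring_scale N; pose R0 := 3 * N.+1%:R : R.
have R01 : 1 <= R0.
  have : 1 <= N.+1%:R :> R by rewrite ler1n.
  by rewrite /R0; clear; lra.
have fourN : 1 <= 4 ^+ N :> R by rewrite exprn_ege1 // ler1n.
have q144 : 144 <= q by rewrite /q /ring_scale; move: fourN; clear; lra.
have q1 : 1 < q by move: q144; clear; lra.
have q0 : 0 < q by apply: lt_trans q1.
pose t n := s * q ^+ n.+1.
have t0 n : 0 < t n by rewrite mulr_gt0 // exprn_gt0.
have tN n : (n <= N * N)%N -> 17 * R0 * t n <= 1.
  move=> nN; apply: le_trans small; rewrite /ring_bound -/R0 /t.
  have -> : 17 * R0 * (s * q ^+ n.+1) = (17 * R0 * s) * q ^+ n.+1 by ring.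
  have -> : 17 * R0 * ring_scale N ^+ (N * N).+1 * s = (17 * R0 * s) * q ^+ (N * N).+1 by rewrite /q; ring.
  rewrite ler_pM2l; first by rewrite ler_weXn2l ?(ltW q1).
  by rewrite mulr_gt0 // mulr_gt0 //; move: R01; clear; lra.
have tq n l : (n < l)%N -> q * t n <= t l.
  move=> nl; have -> : q * t n = s * q ^+ n.+2 by rewrite /t [q ^+ n.+2]exprS; ring.
  by rewrite ler_pM2l // ler_weXn2l ?(ltW q1).
have orth j' : inc i j' -> power0 (B j') = - py (B j').
  move=> ij'; have := bp_inc bp ij'; rewrite /d2 Ex Ey Er /power0; clear; lra.
have form j' z : inc i j' -> inverted (B j') z (- 1) =
    (- py (B j')) * z ^+ 2 - 2 * px (B j') * z + (1 - - py (B j')).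
  by move=> ij'; rewrite /inverted (orth _ ij'); ring.
have [F HF] := bp_cover1 bp i.
have cov z : exists m : 'I_N, inc i (F m) /\ inverted (B (F m)) z (- 1) <= 0.
  have n0 : 0 < z ^+ 2 + (- 1) ^+ 2 by rewrite sqrrN expr1n ltr_wpDl ?sqr_ge0.
  have : pw (A i) (z / (z ^+ 2 + (- 1) ^+ 2)) ((- 1) / (z ^+ 2 + (- 1) ^+ 2)) = 0.
    apply: pw_inversion_eq0 => //; by rewrite /inverted /power0 Ex Ey Er; field.
  by move=> /HF[m [im pm]]; exists m; rewrite -pw_inversion_le0.
have [n [l [[m m'] [nl lN [[in1 H1] [in2 H1']] [[_ H2] [_ H2']]]]]] :
    exists n l (mm : 'I_N * 'I_N), [/\ (n < l)%N, (l <= N * N)%N,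
     (inc i (F mm.1) /\ inverted (B (F mm.1)) (t n) (- 1) <= 0) /\
     (inc i (F mm.2) /\ inverted (B (F mm.2)) (- t n) (- 1) <= 0) &
     (inc i (F mm.1) /\ inverted (B (F mm.1)) (t l) (- 1) <= 0) /\
     (inc i (F mm.2) /\ inverted (B (F mm.2)) (- t l) (- 1) <= 0)].
  have cN : #|{: 'I_N * 'I_N}| = (N * N)%N by rewrite card_prod card_ord.
  have := @pigeonhole_pair ('I_N * 'I_N)%type (fun n mm =>
     (inc i (F mm.1) /\ inverted (B (F mm.1)) (t n) (- 1) <= 0) /\
     (inc i (F mm.2) /\ inverted (B (F mm.2)) (- t n) (- 1) <= 0)).
  rewrite cN; apply.
  by move=> n _; have [m Hm] := cov (t n); have [m' Hm'] := cov (- t n); exists (m, m').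
rewrite /= in in1 in2 H1 H1' H2 H2'.
move: in1 in2 H1 H1' H2 H2'; set j1 := F m; set j2 := F m' => in1 in2.
rewrite !form //.
set a1 := - py (B j1); set c1 := px (B j1); set a2 := - py (B j2) => H1 H1' H2 H2'.
pose c2 := - px (B j2).
have {}H1' : a2 * t n ^+ 2 - 2 * c2 * t n + (1 - a2) <= 0 by rewrite /c2; move: H1'; clear; lra.
have {}H2' : a2 * t l ^+ 2 - 2 * c2 * t l + (1 - a2) <= 0 by rewrite /c2; move: H2'; clear; lra.
have Tn := tN n (ltnW (leq_trans nl lN)).
have Tn1 : t n <= 1.
  have : 1 * t n <= 17 * R0 * t n by rewrite ler_pM2r //; move: R01; clear; lra.
  by move: Tn; clear; lra.
(* The test points lie at distance more than [s] from 0 on the inverted line, hence outside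
   [B j]. *)
have nj z z' : z ^+ 2 = t z' ^+ 2 -> ~ inverted (B j) z (- 1) <= 0.
  move=> zE; rewrite form // Yx zE -/s; have := bp_inc bp ij.
  rewrite /d2 Ex Ey Er Yx; set y := py (B j) in Yy *; rewrite -/s => O.
  have : s < t z'.
    by rewrite /t -{1}[s]mulr1 ltr_pM2l // exprn_egt1.
  rewrite -ltr_sqr ?nnegrE ?(ltW s0) ?(ltW (t0 _)) // => st.
  have y0 : 0 < - y by move: Yy; clear; lra.
  have := ltr_pM2l y0 (s ^+ 2) (t z' ^+ 2); rewrite st.
  have : 0 <= (- y - 1) * s ^+ 2 by rewrite mulr_ge0 ?sqr_ge0 //; move: Yy; clear; lra.
  have : s ^+ 2 = (- y) * (- y - 1) by move: O; clear; lra.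
  move: Yy; clear => Yy sE k1 k2.
  have : 0 <= (- y - 1) ^+ 2 by exact: sqr_ge0.
  move: k2; rewrite sE; nra.
have jj1 : j <> j1.
  by move=> jE; apply: (nj (t n) n erefl); rewrite jE form.
have jj2 : j <> j2.
  move=> jE; apply: (nj (- t n) n); first by rewrite sqrrN.
  by rewrite jE form //; move: H1'; rewrite /c2 -/a2; clear; lra.
(* For a disc orthogonal to [A i], [1 + py] is the power of the point (0,-1). This point lies in
   [B j], hence outside the others. *)
have Alt j' : inc i j' -> j <> j' -> - py (B j') < 1.
  move=> ij' jj'; have := bp_disj2 bp jj'; have := bp_inc bp ij'; have := bp_inc bp ij.
  have rr := mulr_gt0 s0 (bp_pos2 bp j').
  rewrite /d2 Ex Ey Er Yx -/s; move: rr Yy.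
  set y := py (B j); set x' := px (B j'); set y' := py (B j'); set r := pr (B j').
  clear => rr Yy O1 O2 D.
  have : 0 < (- y) * (1 + y') + (1 + y) * (- y') by move: rr O1 O2 D; clear; lra.
  have := Yy; rewrite ltNge => Yy'; move/negP => k; rewrite ltNge; apply/negP => k'; apply: k.
  nra.
have a1lt := Alt _ in1 jj1; have a2lt := Alt _ in2 jj2.
rewrite -/a1 in a1lt; rewrite -/a2 in a2lt.
have r10 := bp_pos2 bp j1; have r20 := bp_pos2 bp j2.
have r1E := orth _ in1; have r2E := orth _ in2; rewrite -/a1 in r1E; rewrite -/a2 in r2E.
rewrite /power0 in r1E r2E.
move: r10 r20 r1E r2E; set r1 := pr (B j1); set r2 := pr (B j2) => r10 r20 r1E r2E.
have {}r1E : r1 ^+ 2 = c1 ^+ 2 - a1 * (1 - a1) by move: r1E; rewrite /a1 -/c1; clear; lra.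
have {}r2E : r2 ^+ 2 = c2 ^+ 2 - a2 * (1 - a2) by move: r2E; rewrite /a2 /c2; clear; lra.
have q3 : 3 <= q by move: q144; clear; lra.
have [c10 B1 C1 D1] := two_points_core a1lt r10 r1E (t0 n) (tq _ _ nl) q3 Tn1 H1 H2.
have [c20 B2 C2 D2] := two_points_core a2lt r20 r2E (t0 n) (tq _ _ nl) q3 Tn1 H1' H2'.
have j12 : j1 <> j2.
  move=> jE; move: c10 c20; rewrite /c2 /c1 jE; clear; lra.
have SE : d2 (B j1) (B j2) - r1 ^+ 2 - r2 ^+ 2 = a1 * (1 - a2) + a2 * (1 - a1) + 2 * c1 * c2.
  by rewrite r1E r2E /d2 -/c1 /a1 /a2 /c2; ring.
have c1r : c1 <= 2 * r1.
  rewrite -(ler_pM2l q0); apply: le_trans C1 _.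
  by have := ler_wpM2r (ltW r10) q3; clear; lra.
have c2r : c2 <= 2 * r2.
  rewrite -(ler_pM2l q0); apply: le_trans C2 _.
  by have := ler_wpM2r (ltW r20) q3; clear; lra.
have rr0 : 0 < r1 * r2 by rewrite mulr_gt0.
have [Tg|gap] := inversive_gap bp in1 in2 j12.
  rewrite -/r1 -/r2 SE in Tg.
  have tg : d2 (B j1) (B j2) = (r1 + r2) ^+ 2.
    by move: SE; rewrite Tg; clear; lra.
  (* [A i] has curvature 2, so [r1] and [r2] cannot both be at least [R0]; whichever is smaller than
     [R0] plays the first disc of [tangent_core]. *)
  have := tangent_curvature bp in1 in2 tg; rewrite Er -/r1 -/r2 -/R0 => kap.
  have [r1s|r1b] := ltP r1 R0.
    exact: (tangent_core a1lt c10 r10 r1E B1 c1r r1s (t0 n) Tn R01 a2lt c20 r20 r2E H1' Tg).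
  have [r2s|r2b] := ltP r2 R0.
    apply: (tangent_core a2lt c20 r20 r2E B2 c2r r2s (t0 n) Tn R01 a1lt c10 r10 r1E H1).
    by move: Tg; clear; lra.
  have R00 : 0 < R0 by apply: lt_le_trans R01.
  have e1 : R0 * r1^-1 <= 1 by rewrite ler_pdivrMr ?mul1r.
  have e2 : R0 * r2^-1 <= 1 by rewrite ler_pdivrMr ?mul1r.
  by move: kap e1 e2; rewrite mulrDr; clear; lra.
rewrite -/r1 -/r2 SE in gap.
have D12 := bp_disj2 bp j12; rewrite -/r1 -/r2 in D12.
have lo : 2 * r1 * r2 <= a1 * (1 - a2) + a2 * (1 - a1) + 2 * c1 * c2.
  by move: D12 SE; clear; lra.
(* The mixed terms are small: [a] is at most of order [r / t l] for one disc, and [1 - a'] at most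
   of order [r' t n] for the other. So the inversive distance is at most [1 + 18 / q]. *)
have up : q * (a1 * (1 - a2) + a2 * (1 - a1) + 2 * c1 * c2) <= (q + 18) * (2 * r1 * r2).
  have cross a c r a' c' r' : 0 < r -> 0 < r' -> 0 < c -> 0 < c' -> 0 < 1 - a' ->
      1 - a' <= t n * (r' + c') -> a * t l <= r + c -> c <= 2 * r -> c' <= 2 * r' ->
      q * (a * (1 - a')) <= 9 * (r * r').
    move=> r_0 r_0' c_0 c_0' a'lt h1 h2 h3 h4.
    have rc9 : (r + c) * (r' + c') <= 9 * (r * r').
      have -> : 9 * (r * r') = (3 * r) * (3 * r') by ring.
      by apply: ler_pM; move: r_0 r_0' c_0 c_0' h3 h4; clear; lra.
    have [an|ap] := leP a 0.
      have : q * (a * (1 - a')) <= 0 by rewrite pmulr_rle0 // pmulr_lle0.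
      by have := mulr_gt0 r_0 r_0'; clear; lra.
    apply: le_trans rc9.
    have : q * (a * (1 - a')) <= q * (a * (t n * (r' + c'))).
      by rewrite ler_pM2l // ler_pM2l.
    move/le_trans; apply.
    have -> : q * (a * (t n * (r' + c'))) = (a * (q * t n)) * (r' + c') by ring.
    rewrite ler_pM2r; last by rewrite addr_gt0.
    by apply: le_trans h2; rewrite ler_pM2l // tq.
  have a1lt' : 0 < 1 - a1 by move: a1lt; clear; lra.
  have a2lt' : 0 < 1 - a2 by move: a2lt; clear; lra.
  have X1 := cross _ _ _ _ _ _ r10 r20 c10 c20 a2lt' B2 D1 c1r c2r.
  have X2 := cross _ _ _ _ _ _ r20 r10 c20 c10 a1lt' B1 D2 c2r c1r.
  have X3 : (q * c1) * (q * c2) <= ((q + 3) * r1) * ((q + 3) * r2).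
    by apply: ler_pM => //; rewrite ltW // mulr_gt0.
  have X4 : q * (c1 * c2) <= (q + 9) * (r1 * r2).
    rewrite -(ler_pM2l q0).
    have k : (q + 3) ^+ 2 <= q * (q + 9) by move: q3; clear; nra.
    have := ler_wpM2r (ltW rr0) k; move: X3; clear; lra.
  by move: X1 X2 X4; clear; lra.
move: gap; apply/negP; rewrite -leNgt.
set S := a1 * (1 - a2) + _ + _ in lo up *; set T := 2 * r1 * r2 in lo up *.
have T0 : 0 < T by rewrite /T mulr_gt0 // mulr_gt0.
have up2 : q * (S ^+ 2 - T ^+ 2) <= 144 * T ^+ 2.
  have d0 : 0 <= S - T by rewrite subr_ge0.
  have e1 : q * (S - T) <= 18 * T by move: up; clear; lra.
  have e2 : S - T <= T.
    rewrite -(ler_pM2l q0); apply: le_trans e1 _; rewrite ler_pM2r //; move: q144; clear; lra.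
  have -> : q * (S ^+ 2 - T ^+ 2) = (q * (S - T)) * (S + T) by ring.
  have -> : 144 * T ^+ 2 = (18 * T) * (8 * T) by ring.
  apply: ler_pM => //; first by rewrite mulr_ge0 // ltW.
    by move: T0 lo; clear; lra.
  by move: e2 T0; clear; lra.
rewrite -(@ler_pM2l _ 144) //; apply: le_trans up2.
by rewrite /q /ring_scale mulrA.
Qed.

Lemma ring_lemma (I J : Type) (A : I -> pdisc R) (B : J -> pdisc R) inc N i j :
  bipacking A B inc N -> inc i j -> pr (A i) <= ring_bound N * pr (B j).
Proof.
move=> bp ij; have [a [b [l [p1 [p2 [ab l0 lr [e1 e2 e3 e4]]]]]]] :=
  antipodal_frame (bp_pos1 bp i) (bp_pos2 bp j) (bp_inc bp ij).
have bp' := bipacking_similarity p1 p2 ab l0 bp.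
have := ring_frame bp' ij e1 e2 lr e3 e4; rewrite /= => h.
rewrite -(ler_pM2l l0) lr; move: h.
have -> : ring_bound N * (l * pr (B j)) = l * (ring_bound N * pr (B j)) by ring.
by clear; lra.
Qed.

End Pdisc.

(** * Tangent and orthogonal discs *)

Section Tangency.
Variable R : realType.
Implicit Types D E : pdisc R.

(** The point of tangency divides the segment of centres in the ratio of the radii; Stewart's
    theorem gives its power with respect to [E]. *)
Lemma tangent_point_orthogonal D D' E : 0 < pr D -> 0 < pr D' ->
  d2 D D' = (pr D + pr D') ^+ 2 ->
  d2 D E = pr D ^+ 2 + pr E ^+ 2 -> d2 D' E = pr D' ^+ 2 + pr E ^+ 2 ->
  pw E ((pr D' * px D + pr D * px D') / (pr D + pr D'))
       ((pr D' * py D + pr D * py D') / (pr D + pr D')) = 0.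
Proof.
case: D => x y r; case: D' => x' y' r'; case: E => a b s; rewrite /d2 /pw /= => r0 r'0 T O O'.
have q0 : r + r' != 0 by rewrite gt_eqF // addr_gt0.
transitivity ((r' * ((x - a) ^+ 2 + (y - b) ^+ 2) + r * ((x' - a) ^+ 2 + (y' - b) ^+ 2)) / (r + r')
  - r * r' * ((x - x') ^+ 2 + (y - y') ^+ 2) / (r + r') ^+ 2 - s ^+ 2); first by field.
by rewrite T O O'; field.
Qed.

Lemma tangent_point_on_circle D D' : 0 < pr D -> 0 < pr D' ->
  d2 D D' = (pr D + pr D') ^+ 2 ->
  pw D ((pr D' * px D + pr D * px D') / (pr D + pr D'))
       ((pr D' * py D + pr D * py D') / (pr D + pr D')) = 0.
Proof.
case: D => x y r; case: D' => x' y' r'; rewrite /d2 /pw /= => r0 r'0 T.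
have q0 : r + r' != 0 by rewrite gt_eqF // addr_gt0.
transitivity (r ^+ 2 * ((x - x') ^+ 2 + (y - y') ^+ 2) / (r + r') ^+ 2 - r ^+ 2); first by field.
by rewrite T; field.
Qed.

Lemma tangent_point_on_circle_r D D' : 0 < pr D -> 0 < pr D' ->
  d2 D D' = (pr D + pr D') ^+ 2 ->
  pw D' ((pr D' * px D + pr D * px D') / (pr D + pr D'))
        ((pr D' * py D + pr D * py D') / (pr D + pr D')) = 0.
Proof.
move=> r0 r'0 T; have := @tangent_point_on_circle D' D r'0 r0.
rewrite d2C [pr D' + _]addrC [pr D * px D' + _]addrC [pr D * py D' + _]addrC; exact.
Qed.

Lemma tangent_direction D D' u v : 0 < pr D -> 0 < pr D' ->
  d2 D D' = (pr D + pr D') ^+ 2 -> pw D u v = 0 -> pw D' u v = 0 ->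
  exists a b, a ^+ 2 + b ^+ 2 = 1 /\
   [/\ px D = u - pr D * a, py D = v - pr D * b, px D' = u + pr D' * a & py D' = v + pr D' * b].
Proof.
case: D => x y r; case: D' => x' y' r'; rewrite /d2 /pw /= => r0 r'0 T H H'.
have q0 : r + r' != 0 by rewrite gt_eqF // addr_gt0.
pose a := (x' - x) / (r + r'); pose b := (y' - y) / (r + r').
have ab : a ^+ 2 + b ^+ 2 = 1.
  transitivity (((x - x') ^+ 2 + (y - y') ^+ 2) / (r + r') ^+ 2); first by rewrite /a /b; field.
  by rewrite T; field.
have x'E : x' = x + (r + r') * a by rewrite /a; field.
have y'E : y' = y + (r + r') * b by rewrite /b; field.
exists a, b; split=> //.
have : (u - x - r * a) ^+ 2 + (v - y - r * b) ^+ 2 = 0.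
  have e1 : (u - x) * a + (v - y) * b = r.
    have : 2 * (r + r') * ((u - x) * a + (v - y) * b) = 2 * (r + r') * r.
      have : (u - x) ^+ 2 + (v - y) ^+ 2 = r ^+ 2 by apply/eqP; rewrite -subr_eq0 H.
      have : (u - x') ^+ 2 + (v - y') ^+ 2 = r' ^+ 2 by apply/eqP; rewrite -subr_eq0 H'.
      rewrite x'E y'E => h1 h2.
      transitivity (((u - x) ^+ 2 + (v - y) ^+ 2) - ((u - (x + (r + r') * a)) ^+ 2 + (v - (y + (r + r') * b)) ^+ 2)
        + (r + r') ^+ 2 * (a ^+ 2 + b ^+ 2)); first by ring.
      by rewrite h1 h2 ab; ring.
    by apply: mulfI; rewrite mulf_neq0.
  transitivity (((u - x) ^+ 2 + (v - y) ^+ 2 - r ^+ 2) - 2 * r * ((u - x) * a + (v - y) * b)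
     + r ^+ 2 * (a ^+ 2 + b ^+ 2) + r ^+ 2); first by ring.
  by rewrite H e1 ab; ring.
move=> /eqP; rewrite paddr_eq0 ?sqr_ge0 // !sqrf_eq0 => /andP[/eqP e1 /eqP e2].
by rewrite x'E y'E; split; move: e1 e2; clear; lra.
Qed.

(** All common points lie on the radical axis, a line, on which the equation of a circle is
    quadratic: in the parameter [m] its roots are 0 and 1. *)
Lemma circles_meet_twice D E u1 v1 u2 v2 u v : 0 < d2 D E ->
  pw D u1 v1 = 0 -> pw E u1 v1 = 0 -> pw D u2 v2 = 0 -> pw E u2 v2 = 0 ->
  pw D u v = 0 -> pw E u v = 0 -> (u1, v1) <> (u2, v2) ->
  (u, v) = (u1, v1) \/ (u, v) = (u2, v2).
Proof.
case: D => x y r; case: E => x' y' s; rewrite /d2 /pw /= => d0 H1 K1 H2 K2 H K ne.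
pose e1 := u2 - u1; pose e2 := v2 - v1; pose w1 := u - u1; pose w2 := v - v1.
have E0 : 0 < e1 ^+ 2 + e2 ^+ 2.
  rewrite lt_def addr_ge0 ?sqr_ge0 // andbT; apply/negP.
  rewrite paddr_eq0 ?sqr_ge0 // !sqrf_eq0 !subr_eq0 => /andP[/eqP h1 /eqP h2].
  by apply: ne; rewrite h1 h2.
have P1 : (x - x') * e1 + (y - y') * e2 = 0 by rewrite /e1 /e2; move: H1 K1 H2 K2; clear; lra.
have P2 : (x - x') * w1 + (y - y') * w2 = 0 by rewrite /w1 /w2; move: H1 K1 H K; clear; lra.
have par : w1 * e2 - w2 * e1 = 0.
  have : ((x - x') ^+ 2 + (y - y') ^+ 2) * (w1 * e2 - w2 * e1) = 0.
    transitivity (((x - x') * w1 + (y - y') * w2) * ((x - x') * e2 - (y - y') * e1) -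
      ((x - x') * e1 + (y - y') * e2) * ((x - x') * w2 - (y - y') * w1)); first by ring.
    by rewrite P1 P2 !mul0r subrr.
  by move/eqP; rewrite mulf_eq0 gt_eqF //= => /eqP.
pose m := (w1 * e1 + w2 * e2) / (e1 ^+ 2 + e2 ^+ 2).
have En : e1 ^+ 2 + e2 ^+ 2 != 0 by rewrite gt_eqF.
have m1 : w1 = m * e1.
  transitivity (m * e1 + e2 * (w1 * e2 - w2 * e1) / (e1 ^+ 2 + e2 ^+ 2)); first by rewrite /m; field.
  by rewrite par mulr0 mul0r addr0.
have m2 : w2 = m * e2.
  transitivity (m * e2 - e1 * (w1 * e2 - w2 * e1) / (e1 ^+ 2 + e2 ^+ 2)); first by rewrite /m; field.
  by rewrite par mulr0 mul0r subr0.
have q1 : 2 * ((u1 - x) * e1 + (v1 - y) * e2) = - (e1 ^+ 2 + e2 ^+ 2).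
  by rewrite /e1 /e2; move: H1 H2; clear; lra.
have q2 : 2 * ((u1 - x) * w1 + (v1 - y) * w2) = - (w1 ^+ 2 + w2 ^+ 2).
  by rewrite /w1 /w2; move: H1 H; clear; lra.
have : m * (m - 1) * (e1 ^+ 2 + e2 ^+ 2) = 0.
  rewrite m1 m2 in q2.
  transitivity (m ^+ 2 * (e1 ^+ 2 + e2 ^+ 2) - m * (e1 ^+ 2 + e2 ^+ 2)); first by ring.
  by move: q2; have := congr1 (fun z => m * z) q1; clear; lra.
move/eqP; rewrite mulf_eq0 (negbTE En) orbF mulf_eq0 subr_eq0 => /orP[] /eqP mE.
  left; move: m1 m2; rewrite mE !mul0r /w1 /w2 => /eqP + /eqP.
  by rewrite !subr_eq0 => /eqP -> /eqP ->.
right; move: m1 m2; rewrite mE !mul1r /w1 /w2 /e1 /e2.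
by move=> /addIr -> /addIr ->.
Qed.

(** The circle of [D] leaves the point of tangency along the line of centres of [E] and [E']. A
    short displacement along the circle therefore has most of its length in this direction ([tW]),
    which leads into [E] or into [E'] according to its sign. *)
Lemma two_cover D E E' u v : 0 < pr D -> 0 < pr E -> 0 < pr E' ->
  d2 D E = pr D ^+ 2 + pr E ^+ 2 -> d2 E E' = (pr E + pr E') ^+ 2 ->
  pw D u v = 0 -> pw E u v = 0 -> pw E' u v = 0 ->
  exists2 m, 0 < m & forall u' v', (u' - u) ^+ 2 + (v' - v) ^+ 2 < m -> pw D u' v' = 0 ->
    pw E u' v' <= 0 \/ pw E' u' v' <= 0.
Proof.
move=> r0 s0 s'0 O Tg HD HE HE'.
have [a [b [ab [e1 e2 e3 e4]]]] := tangent_direction s0 s'0 Tg HE HE'.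
pose m := Num.min (pr D ^+ 2) (Num.min (pr E ^+ 2) (pr E' ^+ 2)).
have m0 : 0 < m by rewrite !lt_min !exprn_gt0.
exists m => // u' v'; rewrite !lt_min => /and3P[mD mE mE'] HD'.
have [w1 w1E] : exists w, w = u' - u by exists (u' - u).
have [w2 w2E] : exists w, w = v' - v by exists (v' - v).
pose t := w1 * a + w2 * b; pose n := w2 * a - w1 * b.
have tn : t ^+ 2 + n ^+ 2 = w1 ^+ 2 + w2 ^+ 2.
  transitivity ((w1 ^+ 2 + w2 ^+ 2) * (a ^+ 2 + b ^+ 2)); last by rewrite ab mulr1.
  by rewrite /t /n; ring.
rewrite -w1E -w2E in mD mE mE'.
set W := w1 ^+ 2 + w2 ^+ 2 in mD mE mE' tn.
have W0 : 0 <= W by rewrite addr_ge0 ?sqr_ge0.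
have pE : pw E u' v' = W + 2 * pr E * t.
  rewrite /pw e1 e2 /W /t w1E w2E.
  transitivity ((u' - u) ^+ 2 + (v' - v) ^+ 2 + 2 * pr E * ((u' - u) * a + (v' - v) * b) + pr E ^+ 2 * (a ^+ 2 + b ^+ 2) - pr E ^+ 2); first by ring.
  by rewrite ab; ring.
have pE' : pw E' u' v' = W - 2 * pr E' * t.
  rewrite /pw e3 e4 /W /t w1E w2E.
  transitivity ((u' - u) ^+ 2 + (v' - v) ^+ 2 - 2 * pr E' * ((u' - u) * a + (v' - v) * b) + pr E' ^+ 2 * (a ^+ 2 + b ^+ 2) - pr E' ^+ 2); first by ring.
  by rewrite ab; ring.
pose l := (py D - v) * a - (px D - u) * b.
have Dt : (px D - u) * a + (py D - v) * b = 0.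
  have : 2 * pr E * ((px D - u) * a + (py D - v) * b) = 0.
    move: O HD; rewrite /d2 /pw e1 e2 => O HD.
    transitivity (((px D - (u - pr E * a)) ^+ 2 + (py D - (v - pr E * b)) ^+ 2 - (pr D ^+ 2 + pr E ^+ 2))
      - ((u - px D) ^+ 2 + (v - py D) ^+ 2 - pr D ^+ 2) + pr E ^+ 2 * (1 - (a ^+ 2 + b ^+ 2))); first by ring.
    by rewrite O HD ab; ring.
  move/eqP; rewrite mulf_eq0 gt_eqF ?mulr_gt0 //; exact: eqP.
have l2 : l ^+ 2 = pr D ^+ 2.
  transitivity (((px D - u) ^+ 2 + (py D - v) ^+ 2) * (a ^+ 2 + b ^+ 2)
     - ((px D - u) * a + (py D - v) * b) ^+ 2); first by rewrite /l; ring.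
  by rewrite ab Dt; move: HD; rewrite /pw; clear; lra.
have WD : W = 2 * l * n.
  have e5 : px D - u = - l * b.
    transitivity ((px D - u) * (a ^+ 2 + b ^+ 2)); first by rewrite ab mulr1.
    transitivity (a * ((px D - u) * a + (py D - v) * b) - l * b); first by rewrite /l; ring.
    by rewrite Dt; ring.
  have e6 : py D - v = l * a.
    transitivity ((py D - v) * (a ^+ 2 + b ^+ 2)); first by rewrite ab mulr1.
    transitivity (b * ((px D - u) * a + (py D - v) * b) + l * a); first by rewrite /l; ring.
    by rewrite Dt; ring.
  transitivity (2 * ((px D - u) * w1 + (py D - v) * w2)); last by rewrite e5 e6 /n; ring.
  by move: HD HD'; rewrite /pw /W w1E w2E; clear; lra.
have nW : 4 * n ^+ 2 <= W.
  have [W_0|W1] := eqVneq W 0.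
    by move: tn (sqr_ge0 t) (sqr_ge0 n); rewrite W_0; clear; lra.
  have Wp : 0 < W by rewrite lt_def W1.
  have Dp : 0 < pr D ^+ 2 by rewrite exprn_gt0.
  rewrite -(ler_pM2l Wp) -expr2.
  have -> : W ^+ 2 = 4 * pr D ^+ 2 * n ^+ 2 by rewrite WD -l2; ring.
  have := ler_wpM2r (sqr_ge0 n) (ltW mD); clear; lra.
have tW : 3 * W <= 4 * t ^+ 2 by move: tn nW; clear; lra.
have key s z : 0 < s -> W < s ^+ 2 -> z ^+ 2 = t ^+ 2 -> 0 <= z -> W <= 2 * s * z.
  move=> s_0 Ws zt z0; rewrite -ler_sqr ?nnegrE //; last by rewrite mulr_ge0 ?mulr_ge0 // ltW.
  have -> : (2 * s * z) ^+ 2 = 4 * s ^+ 2 * t ^+ 2 by rewrite -zt; ring.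
  have : W ^+ 2 <= s ^+ 2 * W by rewrite expr2 ler_wpM2r // ltW.
  have := ler_wpM2l (sqr_ge0 s) tW; have := mulr_ge0 (sqr_ge0 s) W0; clear; lra.
have [t0|t0] := leP t 0.
  left; rewrite pE; have : 0 <= - t by rewrite oppr_ge0.
  by move/(key _ (- t) s0 mE (sqrrN _)); clear; lra.
right; rewrite pE'; have := key _ t s'0 mE' erefl (ltW t0); clear; lra.
Qed.

(** The centres of the four discs are seen from the common point in four pairwise opposite or
    perpendicular directions. Any displacement makes an angle of at most 45 degrees with one of them
    and, if short, ends in that disc. *)
Lemma four_cover D D' E E' u v : 0 < pr D -> 0 < pr D' -> 0 < pr E -> 0 < pr E' ->
  d2 D E = pr D ^+ 2 + pr E ^+ 2 -> d2 E E' = (pr E + pr E') ^+ 2 ->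
  d2 D D' = (pr D + pr D') ^+ 2 ->
  pw D u v = 0 -> pw D' u v = 0 -> pw E u v = 0 -> pw E' u v = 0 ->
  exists2 m, 0 < m & forall u' v', (u' - u) ^+ 2 + (v' - v) ^+ 2 < m ->
    [\/ pw D u' v' <= 0, pw D' u' v' <= 0, pw E u' v' <= 0 | pw E' u' v' <= 0].
Proof.
move=> r0 r'0 s0 s'0 O TgE TgD HD HD' HE HE'.
have [a [b [ab [e1 e2 e3 e4]]]] := tangent_direction s0 s'0 TgE HE HE'.
have [c [d [cd [f1 f2 f3 f4]]]] := tangent_direction r0 r'0 TgD HD HD'.
have acbd : a * c + b * d = 0.
  have : 2 * pr D * pr E * (a * c + b * d) = 0.
    move: O; rewrite /d2 e1 e2 f1 f2 => O.
    transitivity (pr D ^+ 2 * (c ^+ 2 + d ^+ 2) + pr E ^+ 2 * (a ^+ 2 + b ^+ 2) -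
      ((u - pr D * c - (u - pr E * a)) ^+ 2 + (v - pr D * d - (v - pr E * b)) ^+ 2)); first by ring.
    by rewrite O ab cd; ring.
  by move/eqP; rewrite mulf_eq0 gt_eqF ?mulr_gt0 //=; exact: eqP.
pose m := Num.min (Num.min (pr D ^+ 2) (pr D' ^+ 2)) (Num.min (pr E ^+ 2) (pr E' ^+ 2)).
have m0 : 0 < m by rewrite !lt_min !exprn_gt0.
exists m => // u' v'; rewrite !lt_min => /andP[/andP[mD mD'] /andP[mE mE']].
have [w1 w1E] : exists w, w = u' - u by exists (u' - u).
have [w2 w2E] : exists w, w = v' - v by exists (v' - v).
rewrite -w1E -w2E in mD mD' mE mE'.
set W := w1 ^+ 2 + w2 ^+ 2 in mD mD' mE mE'.
have W0 : 0 <= W by rewrite addr_ge0 ?sqr_ge0.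
pose t := w1 * a + w2 * b; pose n := w1 * c + w2 * d.
have pwE s x y F : 0 < pr F -> x ^+ 2 + y ^+ 2 = 1 -> px F = u + s * pr F * x -> py F = v + s * pr F * y ->
    s ^+ 2 = 1 -> pw F u' v' = W - 2 * s * pr F * (w1 * x + w2 * y).
  move=> F0 xy h1 h2 s1; rewrite /pw h1 h2 /W w1E w2E.
  transitivity ((u' - u) ^+ 2 + (v' - v) ^+ 2 - 2 * s * pr F * ((u' - u) * x + (v' - v) * y)
     + s ^+ 2 * pr F ^+ 2 * (x ^+ 2 + y ^+ 2) - pr F ^+ 2); first by ring.
  by rewrite s1 xy; ring.
have m1 : (- 1) ^+ 2 = 1 :> R by rewrite sqrrN expr1n.
have pE : pw E u' v' = W + 2 * pr E * t.
  by rewrite (pwE (- 1) a b) //; [rewrite /t; ring|rewrite e1; ring|rewrite e2; ring].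
have pE' : pw E' u' v' = W - 2 * pr E' * t.
  by rewrite (pwE 1 a b) ?expr1n //; [rewrite /t; ring|rewrite e3; ring|rewrite e4; ring].
have pD : pw D u' v' = W + 2 * pr D * n.
  by rewrite (pwE (- 1) c d) //; [rewrite /n; ring|rewrite f1; ring|rewrite f2; ring].
have pD' : pw D' u' v' = W - 2 * pr D' * n.
  by rewrite (pwE 1 c d) ?expr1n //; [rewrite /n; ring|rewrite f3; ring|rewrite f4; ring].
have tn : t ^+ 2 + n ^+ 2 = W.
  have k2 : (a * d - b * c) ^+ 2 = 1.
    transitivity ((a ^+ 2 + b ^+ 2) * (c ^+ 2 + d ^+ 2) - (a * c + b * d) ^+ 2); first by ring.
    by rewrite ab cd acbd; ring.
  have q1 : c ^+ 2 = b ^+ 2.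
    transitivity (c ^+ 2 * (a ^+ 2 + b ^+ 2)); first by rewrite ab mulr1.
    transitivity ((a * c + b * d) * (a * c - b * d) + b ^+ 2 * (c ^+ 2 + d ^+ 2)); first by ring.
    by rewrite acbd cd; ring.
  have q2 : d ^+ 2 = a ^+ 2 by move: q1 ab cd; clear; lra.
  have q3 : a * b + c * d = 0.
    transitivity (a * b * (c ^+ 2 + d ^+ 2) + c * d * (a ^+ 2 + b ^+ 2)); first by rewrite ab cd !mulr1.
    transitivity ((a * c + b * d) * (b * c + a * d)); first by ring.
    by rewrite acbd mul0r.
  transitivity (w1 ^+ 2 * (a ^+ 2 + c ^+ 2) + w2 ^+ 2 * (b ^+ 2 + d ^+ 2) + 2 * w1 * w2 * (a * b + c * d)).
    by rewrite /t /n; ring.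
  rewrite q1 q2 q3 ab addrC [b ^+ 2 + _]addrC ab /W; ring.
have key s z : 0 < s -> W < s ^+ 2 -> W <= 2 * z ^+ 2 -> 0 <= z -> W <= 2 * s * z.
  move=> s_0 Ws zt z0; rewrite -ler_sqr ?nnegrE //; last by rewrite mulr_ge0 ?mulr_ge0 // ltW.
  have -> : (2 * s * z) ^+ 2 = 2 * s ^+ 2 * (2 * z ^+ 2) by ring.
  have : W ^+ 2 <= s ^+ 2 * W by rewrite expr2 ler_wpM2r // ltW.
  have := ler_wpM2l (sqr_ge0 s) zt; have := mulr_ge0 (sqr_ge0 s) W0; clear; lra.
have [tW|nW] : W <= 2 * t ^+ 2 \/ W <= 2 * n ^+ 2.
  by have [h|h] := leP W (2 * t ^+ 2); [left|right; move: tn h; clear; lra].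
- have [t0|t0] := leP t 0.
    apply: Or43; rewrite pE; have : 0 <= - t by rewrite oppr_ge0.
    by move/(key _ (- t) s0 mE); rewrite sqrrN => /(_ tW); clear; lra.
  by apply: Or44; rewrite pE'; have := key _ t s'0 mE' tW (ltW t0); clear; lra.
- have [n0|n0] := leP n 0.
    apply: Or41; rewrite pD; have : 0 <= - n by rewrite oppr_ge0.
    by move/(key _ (- n) r0 mD); rewrite sqrrN => /(_ nW); clear; lra.
  by apply: Or42; rewrite pD'; have := key _ n r'0 mD' nW (ltW n0); clear; lra.
Qed.

End Tangency.

(** * Covering a circle by discs orthogonal to it *)

Section CircleCover.
Variable R : realType.
Implicit Types D E : pdisc R.

Lemma cos_sin_surj (x y : R) : x ^+ 2 + y ^+ 2 = 1 -> exists t, cos t = x /\ sin t = y.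
Proof.
move=> xy; have x1 : -1 <= x <= 1.
  by rewrite -ler_norml -(@ler_sqr _ _ 1) ?nnegrE // real_normK ?num_real // expr1n -xy lerDl sqr_ge0.
have s : sin (acos x) = `|y|.
  by rewrite sin_acos // -sqrtr_sqr; congr Num.sqrt; rewrite -xy; ring.
have c : cos (acos x) = x by rewrite acosK // in_itv.
have [y0|y0] := leP 0 y.
  by exists (acos x); rewrite c s ger0_norm.
by exists (- acos x); rewrite cosN sinN c s ltr0_norm // opprK.
Qed.

Lemma circle_param D u v : 0 < pr D -> pw D u v = 0 ->
  exists t, u = px D + pr D * cos t /\ v = py D + pr D * sin t.
Proof.
move=> r0 H; have rn : pr D != 0 by rewrite gt_eqF.
have [t [ct st]] : exists t, cos t = (u - px D) / pr D /\ sin t = (v - py D) / pr D.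
  apply: cos_sin_surj; transitivity ((pw D u v + pr D ^+ 2) / pr D ^+ 2); first by rewrite /pw; field.
  by rewrite H; field.
by exists t; rewrite ct st; split; field.
Qed.

Lemma pw_circle_param D t : pw D (px D + pr D * cos t) (py D + pr D * sin t) = 0.
Proof.
rewrite /pw; transitivity (pr D ^+ 2 * (cos t ^+ 2 + sin t ^+ 2) - pr D ^+ 2); first by ring.
by rewrite cos2Dsin2; ring.
Qed.

Lemma continuous_pw_param D E :
  continuous (fun t : R => pw E (px D + pr D * cos t) (py D + pr D * sin t)).
Proof.
have sq (f : R -> R) : continuous f -> continuous (fun t => f t ^+ 2).
  by move=> cf t; apply: (@continuous_comp _ _ _ f (fun x => x ^+ 2)); [exact: cf|exact: exprn_continuous].
have aff (f : R -> R) (a b c : R) : continuous f -> continuous (fun t => a + b * f t - c).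
  move=> cf t; apply: cvgB; last exact: cvg_cst.
  by apply: cvgD; [exact: cvg_cst|apply: cvgM; [exact: cvg_cst|exact: cf]].
move=> t; apply: cvgB; last exact: cvg_cst.
apply: cvgD.
  exact: (sq (fun s => px D + pr D * cos s - px E) (aff _ _ _ _ (@continuous_cos R)) t).
exact: (sq (fun s => py D + pr D * sin s - py E) (aff _ _ _ _ (@continuous_sin R)) t).
Qed.

(** The set of covered angles is closed as a finite union, open because where the circle leaves one
    disc a tangent disc takes over ([two_cover]), and not empty; the line is connected. *)
Lemma circle_cover D (n : nat) (T : 'I_n -> pdisc R) (Q : 'I_n -> Prop) :
  0 < pr D ->
  (forall k, Q k -> 0 < pr (T k) /\ d2 D (T k) = pr D ^+ 2 + pr (T k) ^+ 2) ->
  (forall k u v, Q k -> pw D u v = 0 -> pw (T k) u v = 0 ->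
     exists k', [/\ Q k', pw (T k') u v = 0 & d2 (T k) (T k') = (pr (T k) + pr (T k')) ^+ 2]) ->
  (exists k, Q k) ->
  forall u v, pw D u v = 0 -> exists k, Q k /\ pw (T k) u v <= 0.
Proof.
move=> r0 orth next [k0 Qk0] u0 v0 H0.
pose f k t := pw (T k) (px D + pr D * cos t) (py D + pr D * sin t).
have cf k : continuous (f k) by exact: continuous_pw_param.
pose S := \bigcup_(k in [set k | Q k]) [set t | f k t <= 0].
have ST : S = setT.
  have /connected_intervalP cT : is_interval [set: R] by [].
  apply: cT.
  (* A covered point: the one in the direction of the centre of [T k0]. *)
  - have [rT O] := orth _ Qk0; set E := T k0 in rT O.
    pose d := Num.sqrt (d2 D E).
    have dd : d ^+ 2 = pr D ^+ 2 + pr E ^+ 2.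
      by rewrite /d O sqr_sqrtr // addr_ge0 ?sqr_ge0.
    have dp : 0 < d by rewrite sqrtr_gt0 O addr_gt0 // exprn_gt0.
    have dn : d != 0 by rewrite gt_eqF.
    have [t [ct st]] : exists t, cos t = (px E - px D) / d /\ sin t = (py E - py D) / d.
      apply: cos_sin_surj; transitivity (d2 D E / d ^+ 2); first by rewrite /d2; field.
      by rewrite O -dd; field.
    exists t, k0 => //=; rewrite /f -/E ct st /pw.
    have -> : (px D + pr D * ((px E - px D) / d) - px E) ^+ 2 +
       (py D + pr D * ((py E - py D) / d) - py E) ^+ 2 - pr E ^+ 2 =
        (pr D / d - 1) ^+ 2 * d2 D E - pr E ^+ 2 by rewrite /d2; field.
    have -> : (pr D / d - 1) ^+ 2 * d2 D E = (d - pr D) ^+ 2 by rewrite O -dd; field.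
    have rd : pr D <= d by rewrite -ler_sqr ?nnegrE ?(ltW r0) ?(ltW dp) // dd lerDl sqr_ge0.
    by move: dd rd r0; clear; nra.
  - exists S; last by rewrite setTI.
    rewrite openE => t [k Qk /= fk]; rewrite /interior.
    have [lt0|] := ltP (f k t) 0.
      have : \forall s \near t, f k s < 0.
        exact: (cf k t (fun z => z < 0) (lt_nbhsl lt0)).
      by apply: filterS => s fs; exists k => //=; apply: ltW.
    move=> ge0; have f0 : f k t = 0 by apply/eqP; rewrite eq_le fk ge0.
    have [k' [Qk' fk' Tg]] := next k _ _ Qk (pw_circle_param D t) f0.
    have [rT O] := orth _ Qk; have [rT' O'] := orth _ Qk'.
    have [m m0 Hm] := two_cover r0 rT rT' O Tg (pw_circle_param D t) f0 fk'.
    (* An auxiliary disc of squared radius [m] expresses closeness to the point as negativity of a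
       power, so that [continuous_pw_param] applies again. *)
    pose P := PDisc (px D + pr D * cos t) (py D + pr D * sin t) (Num.sqrt m).
    pose g s := pw P (px D + pr D * cos s) (py D + pr D * sin s).
    have cg : continuous g by exact: continuous_pw_param.
    have gt : g t < 0 by rewrite /g /pw /= !subrr expr0n /= !add0r oppr_lt0 sqr_sqrtr // ltW.
    have : \forall s \near t, g s < 0.
      exact: (cg t (fun z => z < 0) (lt_nbhsl gt)).
    apply: filterS => s; rewrite /g /pw /= sqr_sqrtr ?(ltW m0) // subr_lt0 => gs.
    have [h|h] := Hm _ _ gs (pw_circle_param D s); [by exists k|by exists k'].
  - exists S; last by rewrite setTI.
    apply: closed_bigcup => [|k Qk]; first exact: finite_finset.
    have -> : [set t | f k t <= 0] = f k @^-1` [set x | x <= 0] by [].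
    by apply: closed_comp; [move=> t _; exact: cf|exact: closed_le].
have [t [-> ->]] := circle_param r0 H0.
have : S t by rewrite ST.
by case=> k Qk fk; exists k.
Qed.
End CircleCover.

(** * Winding numbers *)

Section Winding.
Variable R : realType.

Definition norm2 (x y : R) : R := Num.sqrt (x ^+ 2 + y ^+ 2).

(** The turning condition of [positive_chart], in real coordinates and detached from the chart. *)
Definition winds_once (u v : R -> R) := exists theta : R -> R,
  [/\ {within `[0, 1], continuous theta}, theta 1 = theta 0 + 2 * pi &
    forall t, 0 <= t <= 1 -> u t = norm2 (u t) (v t) * cos (theta t) /\
                             v t = norm2 (u t) (v t) * sin (theta t)].

Lemma cos_sin_atan (p q : R) : 0 < p ->
  norm2 p q * cos (atan (q / p)) = p /\ norm2 p q * sin (atan (q / p)) = q.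
Proof.
move=> p0; have pn : p != 0 by rewrite gt_eqF.
have c0 : cos (atan (q / p)) = p / norm2 p q.
  rewrite cos_atan; have -> : 1 + (q / p) ^+ 2 = (p ^+ 2 + q ^+ 2) / p ^+ 2 by field.
  rewrite sqrtrM ?addr_ge0 ?sqr_ge0 // sqrtrV ?sqr_ge0 // sqrtr_sqr gtr0_norm //.
  by rewrite invfM invrK mulrC.
have n0 : norm2 p q != 0 by rewrite gt_eqF // sqrtr_gt0 ltr_wpDr ?sqr_ge0 // exprn_gt0.
have s0 : sin (atan (q / p)) = q / norm2 p q.
  have : tan (atan (q / p)) = q / p by rewrite atanK.
  rewrite /tan c0 => /eqP; rewrite eqr_div ?mulf_neq0 ?invr_eq0 // => /eqP h.
  by apply: (mulIf pn); rewrite h; field; rewrite n0.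
by rewrite c0 s0; split; field.
Qed.

(* Multiplying by a complex number of positive real part adds a small angle. *)
Lemma winds_once_close (u v u' v' : R -> R) :
  continuous u -> continuous v -> continuous u' -> continuous v' ->
  u 0 = u 1 -> v 0 = v 1 -> u' 0 = u' 1 -> v' 0 = v' 1 ->
  (forall t, 0 <= t <= 1 ->
     (u' t - u t) ^+ 2 + (v' t - v t) ^+ 2 < u t ^+ 2 + v t ^+ 2) ->
  winds_once u v -> winds_once u' v'.
Proof.
move=> cu cv cu' cv' u01 v01 u'01 v'01 close [th [cth th1 thE]].
pose p t := u' t * u t + v' t * v t; pose q t := v' t * u t - u' t * v t.
have p0 t : 0 <= t <= 1 -> 0 < p t.
  move=> /close; have := sqr_ge0 (u' t); have := sqr_ge0 (v' t); rewrite /p; clear; lra.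
have cp : continuous p by move=> t; apply: cvgD; apply: cvgM; [exact: cu'|exact: cu|exact: cv'|exact: cv].
have cq : continuous q by move=> t; apply: cvgB; apply: cvgM; [exact: cv'|exact: cu|exact: cu'|exact: cv].
exists (fun t => th t + atan (q t / p t)); split.
- apply/subspace_continuousP => t /= t01; apply: cvgD.
    by move/subspace_continuousP : cth; apply.
  apply: cvg_within_filter.
  have pt : p t != 0 by rewrite gt_eqF // p0 //; move: t01; rewrite in_itv.
  apply: (@cvg_comp _ _ _ (fun t => q t / p t) atan (nbhs t) (nbhs (q t / p t))); last exact: continuous_atan.
  by apply: cvgM; [exact: cq|apply: cvgV => //; exact: cp].
- by rewrite th1 /q /p -u01 -v01 -u'01 -v'01; ring.
move=> t t01; have [e1 e2] := thE t t01.
have [c s] := cos_sin_atan (q t) (p0 t t01).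
have nz : 0 < u t ^+ 2 + v t ^+ 2.
  by apply: le_lt_trans (close t t01); rewrite addr_ge0 ?sqr_ge0.
have pq : norm2 (p t) (q t) = norm2 (u t) (v t) * norm2 (u' t) (v' t).
  rewrite /norm2 -sqrtrM ?ltW //; congr Num.sqrt; rewrite /p /q; ring.
set m := norm2 (u t) (v t) in e1 e2 pq *; set m' := norm2 (u' t) (v' t) in pq *.
rewrite pq in c s; rewrite cosD sinD; set C := cos (atan _) in c *; set S := sin (atan _) in s *.
have m0 : 0 < m by rewrite sqrtr_gt0.
have mn : m != 0 by rewrite gt_eqF.
have m2 : u t ^+ 2 + v t ^+ 2 = m ^+ 2 by rewrite sqr_sqrtr // ltW.
have mn2 : m ^+ 2 != 0 by rewrite expf_neq0.
split.
- apply: (mulfI mn2).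
  transitivity ((m * cos (th t)) * (m * m' * C) - (m * sin (th t)) * (m * m' * S)); last by ring.
  by rewrite c s -e1 -e2 -m2 /p /q; ring.
- apply: (mulfI mn2).
  transitivity ((m * sin (th t)) * (m * m' * C) + (m * cos (th t)) * (m * m' * S)); last by ring.
  by rewrite c s -e1 -e2 -m2 /p /q; ring.
Qed.

(** The parameters [s] whose loop winds once form an open and closed set, because [winds_once_close]
    transfers the property between nearby loops in either direction. *)
Lemma winds_once_homotopy (H1 H2 : R * R -> R) :
  continuous H1 -> continuous H2 ->
  (forall s t, 0 < H1 (s, t) ^+ 2 + H2 (s, t) ^+ 2) ->
  (forall s, H1 (s, 0) = H1 (s, 1) /\ H2 (s, 0) = H2 (s, 1)) ->
  forall s0 s1, winds_once (fun t => H1 (s0, t)) (fun t => H2 (s0, t)) ->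
    winds_once (fun t => H1 (s1, t)) (fun t => H2 (s1, t)).
Proof.
move=> c1 c2 nz per s0 s1 w0.
pose S := [set s | winds_once (fun t => H1 (s, t)) (fun t => H2 (s, t))].
have cpair (s : R) : continuous (fun t : R => (s, t)).
  by move=> t; exact: (cvg_pair (cvg_cst s) cvg_id).
have cH1 s : continuous (fun t => H1 (s, t)).
  by move=> t; apply: (@continuous_comp _ _ _ (fun t => (s, t)) H1); [exact: cpair|exact: c1].
have cH2 s : continuous (fun t => H2 (s, t)).
  by move=> t; apply: (@continuous_comp _ _ _ (fun t => (s, t)) H2); [exact: cpair|exact: c2].
pose dist2 (a b : R * R) := (H1 b - H1 a) ^+ 2 + (H2 b - H2 a) ^+ 2.
(* Uniform in [t] by compactness of [0, 1]. The first inequality serves openness of [S], the second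
   closedness. *)
have near_close s : \forall s' \near s, forall t, 0 <= t <= 1 ->
    dist2 (s, t) (s', t) < H1 (s, t) ^+ 2 + H2 (s, t) ^+ 2 /\
    dist2 (s', t) (s, t) < H1 (s', t) ^+ 2 + H2 (s', t) ^+ 2.
  have /compact_near_coveringP cpt := @segment_compact R 0 1.
  suff : \forall s' \near s, `[0, 1]%classic `<=` (fun t => dist2 (s, t) (s', t) < H1 (s, t) ^+ 2 + H2 (s, t) ^+ 2 /\
      dist2 (s', t) (s, t) < H1 (s', t) ^+ 2 + H2 (s', t) ^+ 2).
    by apply: filterS => s' Hs' t t01; apply: Hs'; rewrite /= in_itv.
  apply: (cpt R (nbhs s) (fun s' t => dist2 (s, t) (s', t) < H1 (s, t) ^+ 2 + H2 (s, t) ^+ 2 /\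
      dist2 (s', t) (s, t) < H1 (s', t) ^+ 2 + H2 (s', t) ^+ 2) (nbhs_filter s)).
  move=> x _.
  pose G (z : R * R) := H1 (s, z.1) ^+ 2 + H2 (s, z.1) ^+ 2 - dist2 (s, z.1) (z.2, z.1).
  pose G' (z : R * R) := H1 (z.2, z.1) ^+ 2 + H2 (z.2, z.1) ^+ 2 - dist2 (z.2, z.1) (s, z.1).
  have cst1 : continuous (fun z : R * R => (s, z.1)).
    by move=> z; exact: (cvg_pair (cvg_cst s) cvg_fst).
  have swp : continuous (fun z : R * R => (z.2, z.1)).
    by move=> z; exact: (cvg_pair cvg_snd cvg_fst).
  have sq (f : R * R -> R) : continuous f -> continuous (fun t => f t ^+ 2).
    by move=> cf t; apply: (@continuous_comp _ _ _ f (fun x => x ^+ 2)); [exact: cf|exact: exprn_continuous].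
  have k1 : continuous (fun z : R * R => H1 (s, z.1)).
    by move=> z; apply: (@continuous_comp _ _ _ (fun z : R * R => (s, z.1)) H1); [exact: cst1|exact: c1].
  have k2 : continuous (fun z : R * R => H2 (s, z.1)).
    by move=> z; apply: (@continuous_comp _ _ _ (fun z : R * R => (s, z.1)) H2); [exact: cst1|exact: c2].
  have l1 : continuous (fun z : R * R => H1 (z.2, z.1)).
    by move=> z; apply: (@continuous_comp _ _ _ (fun z : R * R => (z.2, z.1)) H1); [exact: swp|exact: c1].
  have l2 : continuous (fun z : R * R => H2 (z.2, z.1)).
    by move=> z; apply: (@continuous_comp _ _ _ (fun z : R * R => (z.2, z.1)) H2); [exact: swp|exact: c2].
  have sub (f g : R * R -> R) : continuous f -> continuous g -> continuous (fun z => f z - g z).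
    by move=> cf cg z; apply: cvgB; [exact: cf|exact: cg].
  have add (f g : R * R -> R) : continuous f -> continuous g -> continuous (fun z => f z + g z).
    by move=> cf cg z; apply: cvgD; [exact: cf|exact: cg].
  have cG : continuous G.
    exact: (sub _ _ (add _ _ (sq _ k1) (sq _ k2)) (add _ _ (sq _ (sub _ _ l1 k1)) (sq _ (sub _ _ l2 k2)))).
  have cG' : continuous G'.
    exact: (sub _ _ (add _ _ (sq _ l1) (sq _ l2)) (add _ _ (sq _ (sub _ _ k1 l1)) (sq _ (sub _ _ k2 l2)))).
  have Gx : 0 < G (x, s) by rewrite /G /dist2 /= !subrr expr0n /= addr0 subr0.
  have Gx' : 0 < G' (x, s) by rewrite /G' /dist2 /= !subrr expr0n /= addr0 subr0.
  have n1 : \forall z \near (x, s), 0 < G z by exact: (cG (x, s) (fun y => 0 < y) (lt_nbhsr Gx)).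
  have n2 : \forall z \near (x, s), 0 < G' z by exact: (cG' (x, s) (fun y => 0 < y) (lt_nbhsr Gx')).
  near=> z; split.
  - have : 0 < G z by near: z.
    by rewrite /G subr_gt0.
  - have : 0 < G' z by near: z.
    by rewrite /G' subr_gt0.
suff : S = setT by move=> /(congr1 (@^~ s1)) /= E; change (S s1); rewrite E.
have /connected_intervalP cT : is_interval [set: R] by [].
have step s s' : (forall t, 0 <= t <= 1 ->
    dist2 (s, t) (s', t) < H1 (s, t) ^+ 2 + H2 (s, t) ^+ 2) -> S s -> S s'.
  move=> cl; apply: winds_once_close => //; by [exact: (per _).1|exact: (per _).2].
apply: cT.
- by exists s0.
- exists S; last by rewrite setTI.
  rewrite openE => s Ss; rewrite /interior; apply: filterS (near_close s) => s' Hs'.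
  by apply: step Ss => t /Hs' [].
- exists S; last by rewrite setTI.
  move=> s cs; have [s' [Ss' Hs']] := cs _ (near_close s).
  by apply: step Ss' => t /Hs' [].
Unshelve. all: by end_near. Qed.

End Winding.

(** * Escape probabilities and energy *)

Section Walk.
Variables (R : realType) (G : network R).
Hypothesis lf : locally_finite G.
Hypothesis simple : simple_graph G.
Hypothesis has_edge : forall v : vertex G, exists e, osrc e = v.
Local Notation V := (vertex G).
Local Notation E := (oedge G).

Definition edges_from (v : V) : seq E := finmap.enum_fset (fset_set (out_edges v)).

Lemma mem_edges_from v e : (e \in edges_from v) = (osrc e == v).
Proof.
have := in_fset_set (lf v) e; rewrite /edges_from => ->.
by apply/idP/eqP => [/set_mem //|?]; exact/mem_set.
Qed.

Lemma uniq_edges_from v : uniq (edges_from v).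
Proof. exact: finmap.fset_uniq. Qed.

Definition weight (v : V) : R := \sum_(e <- edges_from v) cond e.

Lemma weight_gt0 v : 0 < weight v.
Proof.
have [e ev] := has_edge v; have ein : e \in edges_from v by rewrite mem_edges_from ev.
rewrite /weight (big_rem e) //= ltr_wpDr ?cond_gt0 //.
by apply: sumr_ge0 => e' _; rewrite ltW // cond_gt0.
Qed.

Definition prob (e : E) : R := cond e / weight (osrc e).

Lemma prob_ge0 e : 0 <= prob e.
Proof. by rewrite divr_ge0 // ltW ?cond_gt0 ?weight_gt0. Qed.

Lemma sum_prob v : \sum_(e <- edges_from v) prob e = 1.
Proof.
transitivity (\sum_(e <- edges_from v) cond e / weight v).
  by apply: eq_big_seq => e; rewrite mem_edges_from => /eqP <-.
by rewrite -mulr_suml divff // gt_eqF // weight_gt0.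
Qed.

Lemma transition_edge e : transition (osrc e) (otgt e) = prob e.
Proof.
rewrite /transition /prob /weight; congr (_ / _); last by rewrite fsbig_finite.
have -> : [set e' : E | osrc e' = osrc e /\ otgt e' = otgt e] = [set e].
  by apply/seteqP; split=> [e' [h1 h2]|e' ->] //=; apply: simple.2.
by rewrite fsbig_set1.
Qed.

Section Avoid.
Variable v : V.

(** The probability that the walk from [u] avoids [v] at the times 1 to [n], by recursion on the
    first step and without a probability space. *)
Fixpoint avoid (n : nat) (u : V) : R :=
  if n is n'.+1
  then \sum_(e <- edges_from u) prob e * (if otgt e == v then 0 else avoid n' (otgt e))
  else 1.

Lemma avoid_ge0 n u : 0 <= avoid n u.
Proof.
elim: n u => [|n IH] u /=; first exact: ler01.
by apply: sumr_ge0 => e _; rewrite mulr_ge0 ?prob_ge0 //; case: ifP.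
Qed.

Lemma avoid_decr n u : avoid n.+1 u <= avoid n u.
Proof.
elim: n u => [|n IH] u.
  rewrite /= -[X in _ <= X](sum_prob u); apply: ler_sum => e _.
  by case: ifP => _; rewrite ?mulr0 ?mulr1 //; exact: prob_ge0.
rewrite [in X in X <= _]/= [in X in _ <= X]/=; apply: ler_sum => e _.
apply: ler_wpM2l; first exact: prob_ge0.
by case: ifP => // _; exact: IH.
Qed.

Lemma avoid_le1 n u : avoid n u <= 1.
Proof. by elim: n u => [|n IH] u //; apply: le_trans (avoid_decr n u) _. Qed.

Lemma avoid_lim : exists b : V -> R, [/\ forall u, avoid n u @[n --> \oo] --> b u,
  forall u, 0 <= b u <= 1 &
  forall u, b u = \sum_(e <- edges_from u) prob e * (if otgt e == v then 0 else b (otgt e))].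
Proof.
have cv u : cvgn (fun n => avoid n u).
  apply: nonincreasing_is_cvgn; last by exists 0 => _ [n _ <-]; exact: avoid_ge0.
  move=> m n mn; rewrite -(subnK mn); elim: (n - m)%N => [|k IH]; first by rewrite add0n.
  by rewrite addSn; apply: le_trans (avoid_decr _ _) IH.
exists (fun u => limn (fun n => avoid n u)); split => //.
- move=> u; apply/andP; split.
    by apply: limr_ge => //; near=> n; exact: avoid_ge0.
  by apply: limr_le => //; near=> n; exact: avoid_le1.
move=> u; apply: cvg_lim => //.
have : (fun n => avoid n.+1 u) @ \oo --> \sum_(e <- edges_from u) prob e *
      (if otgt e == v then 0 else limn (fun n => avoid n (otgt e))).
  rewrite /=; elim: (edges_from u) => [|e s IH].
    by under eq_fun do rewrite big_nil; rewrite big_nil; exact: cvg_cst.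
  under eq_fun do rewrite big_cons; rewrite big_cons.
  apply: cvgD; last exact: IH.
  apply: cvgM; first exact: cvg_cst.
  by case: ifP => _; [exact: cvg_cst|exact: cv].
by rewrite -(cvg_shiftS (fun n => avoid n u)).
Unshelve. all: by end_near. Qed.

Section Process.
Variables (d : measure_display) (Omega : measurableType d) (P : probability Omega R).
Variable X : nat -> Omega -> V.
Hypothesis RW : random_walk_from v P X.

Definition avoiding_event (x : nat -> V) (m n : nat) : set Omega :=
  [set w | (forall i, (i <= m)%N -> X i w = x i) /\
           (forall j, (m < j <= m + n)%N -> X j w <> v)].

Lemma measurable_path (x : nat -> V) m : measurable [set w | forall i, (i <= m)%N -> X i w = x i].
Proof.
have -> : [set w | forall i, (i <= m)%N -> X i w = x i] =
    \bigcap_(i in [set i | (i <= m)%N]) [set w | X i w = x i] by [].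
by apply: bigcap_measurableType => k _; exact: RW.1.
Qed.

Lemma measurable_avoiding x m n : measurable (avoiding_event x m n).
Proof.
have -> : avoiding_event x m n = [set w | forall i, (i <= m)%N -> X i w = x i] `&`
    \bigcap_(j in [set j | (m < j <= m + n)%N]) ~` [set w | X j w = v] by [].
apply: measurableI; first exact: measurable_path.
by apply: bigcap_measurableType => k _; apply: measurableC; exact: RW.1.
Qed.

Definition extend (x : nat -> V) (m : nat) (y : V) (i : nat) : V :=
  if (i <= m)%N then x i else y.

Lemma path_prob (x : nat -> V) m : x 0%N = v ->
  P [set w | forall i, (i <= m)%N -> X i w = x i] =
  (\prod_(i < m) transition (x i) (x i.+1))%:E.
Proof. by move=> x0; rewrite RW.2 x0 eqxx. Qed.

Lemma path_prob_extend (x : nat -> V) m e : x 0%N = v -> osrc e = x m ->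
  P [set w | forall i, (i <= m.+1)%N -> X i w = extend x m (otgt e) i] =
  ((\prod_(i < m) transition (x i) (x i.+1)) * prob e)%:E.
Proof.
move=> x0 em; rewrite path_prob; last by rewrite /extend leq0n.
rewrite big_ord_recr /=; congr ((_ * _)%:E).
  by apply: eq_bigr => i _; rewrite /extend (ltnW (ltn_ord i)) ltn_ord.
by rewrite /extend leqnn ltnn -em transition_edge.
Qed.

(** Only cylinder probabilities are given, so the Markov property is replaced by an induction which
    lengthens the prescribed path by one vertex while the period of avoidance shrinks. An upper
    bound is all that the comparison with [avoid] requires. *)
Lemma avoiding_prob_le n : forall m x, x 0%N = v ->
  (P (avoiding_event x m n) <= ((\prod_(i < m) transition (x i) (x i.+1)) * avoid n (x m))%:E)%E.
Proof.
elim: n => [|n IH] m x x0.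
  rewrite /= mulr1 -path_prob //; apply: le_measure; rewrite ?inE.
  - exact: measurable_avoiding.
  - exact: measurable_path.
  - by move=> w [].
set pr := \prod_(i < m) _.
pose C := [set w | forall i, (i <= m)%N -> X i w = x i].
pose Ce e := [set w | forall i, (i <= m.+1)%N -> X i w = extend x m (otgt e) i].
have mC : measurable C by exact: measurable_path.
have mCe e : measurable (Ce e) by exact: measurable_path.
pose U := \bigcup_(e in out_edges (x m)) Ce e.
have mU : measurable U by apply: fin_bigcup_measurable.
have CeC e : Ce e `<=` C.
  by move=> w Hw i im; rewrite Hw ?leqW // /extend im.
(* After the prescribed path the walk almost surely follows an edge: the extensions of the path
   along the edges at [x m] exhaust its probability, as the transition probabilities sum to 1. *)
have PU : P U = P C.
  rewrite measure_fin_bigcup //; last first.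
    move=> e e' He He' [w [H1 H2]]; apply: simple.2; first by rewrite (He : _ = _) (He' : _ = _).
    by have := H1 m.+1 (leqnn _); rewrite (H2 m.+1 (leqnn _)) /extend ltnn.
  rewrite path_prob // -/pr fsbig_finite //=.
  rewrite -[in RHS](mulr1 pr) -(sum_prob (x m)) mulr_sumr -sumEFin.
  by apply: eq_big_seq => e; rewrite mem_edges_from => /eqP em; rewrite path_prob_extend.
have N0 : P (C `\` U) = 0%E.
  rewrite (measureD mC mU); last by rewrite ltey_eq fin_num_measure.
  rewrite setIidr; last by move=> w [e _ /CeC].
  transitivity (P C - P C)%E; last by rewrite subee // fin_num_measure.
  by congr (_ - _)%E; exact: PU.
pose A e := if otgt e == v then set0 else avoiding_event (extend x m (otgt e)) m.+1 n.
have mA e : measurable (A e) by rewrite /A; case: ifP => _; [exact: measurable0|exact: measurable_avoiding].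
have mUA : measurable (\bigcup_(e in out_edges (x m)) A e) by apply: fin_bigcup_measurable.
have sub : avoiding_event x m n.+1 `<=` (\bigcup_(e in out_edges (x m)) A e) `|` (C `\` U).
  move=> w [Cw Aw]; have [Uw|nUw] := pselect (U w); last by right.
  left; case: Uw => e em Cew; exists e => //; rewrite /A.
  have Xm : X m.+1 w = otgt e by rewrite Cew // /extend ltnn.
  have /negP/negPf -> : ~ (otgt e == v).
    by move/eqP; rewrite -Xm; apply: Aw; rewrite ltnSn addnS ltnS leq_addr.
  split=> // j /andP[j1 j2]; apply: Aw; rewrite (ltnW j1) /=.
  by rewrite addnS -addSn.
apply: (@le_trans _ _ (P ((\bigcup_(e in out_edges (x m)) A e) `|` (C `\` U)))).
  apply: le_measure => //; rewrite inE; first exact: measurable_avoiding.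
  by apply: measurableU => //; exact: measurableD.
apply: (@le_trans _ _ (P (\bigcup_(e in out_edges (x m)) A e) + P (C `\` U))%E).
  by apply: measureU2 => //; exact: measurableD.
rewrite N0 adde0.
apply: (@le_trans _ _ (\sum_(e \in out_edges (x m)) P (A e))%E); first exact: content_sub_fsum.
rewrite fsbig_finite //= mulr_sumr -sumEFin; 
rewrite !big_seq; apply: lee_sum => e; rewrite mem_edges_from => /eqP em.
rewrite /A; case: ifP => _; first by rewrite measure0 mulr0 mulr0.
apply: le_trans (IH m.+1 _ _) _; first by rewrite /extend leq0n.
rewrite lee_fin big_ord_recr /=.
have -> : \prod_(i < m) transition (extend x m (otgt e) i) (extend x m (otgt e) i.+1) = pr.
  by apply: eq_bigr => i _; rewrite /extend (ltnW (ltn_ord i)) ltn_ord.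
by rewrite /extend leqnn ltnn -em transition_edge mulrA.
Qed.

End Process.
End Avoid.
End Walk.

Section Escape.
Variables (R : realType) (G : network R).
Hypothesis lf : locally_finite G.
Hypothesis simple : simple_graph G.
Hypothesis has_edge : forall v : vertex G, exists e, osrc e = v.
Local Notation V := (vertex G).
Local Notation E := (oedge G).

Lemma escape_le_avoid (v : V) q n : escape_probability v q -> (q <= (avoid v n v)%:E)%E.
Proof.
move=> [d [T [P [X [RW <-]]]]].
have m0 : measurable [set w | X 0%N w = v] by exact: (RW.1).
have mN : measurable (never_returns v X).
  have -> : never_returns v X = \bigcap_(k in [set k | (0 < k)%N]) ~` [set w | X k w = v] by [].
  by apply: bigcap_measurableType => k _; apply: measurableC; exact: (RW.1).
have mA : measurable (avoiding_event v X (fun=> v) 0 n) by exact: (measurable_avoiding RW).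
(* The walk starts at [v] only almost surely; the exceptional event is carried along with measure
   0. *)
have P0 : P (~` [set w | X 0%N w = v]) = 0%E.
  rewrite probability_setC //.
  have -> : [set w | X 0%N w = v] = [set w | forall i, (i <= 0)%N -> X i w = (fun=> v) i].
    by apply/seteqP; split=> [w /= H i i0|w /= H]; [have -> : i = 0%N by move: i0; case: i|exact: (H 0%N)].
  by rewrite RW.2 eqxx big_ord0 subee.
have sub : never_returns v X `<=` avoiding_event v X (fun=> v) 0 n `|` ~` [set w | X 0%N w = v].
  move=> w Hw; have [X0|X0] := pselect (X 0%N w = v); last by right.
  left; split; first by move=> i; rewrite leqn0 => /eqP ->.
  by move=> j /andP[j0 _]; exact: Hw.
apply: (@le_trans _ _ (P (avoiding_event v X (fun=> v) 0 n `|` ~` [set w | X 0%N w = v]))).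
  by apply: le_measure => //; rewrite inE //; apply: measurableU => //; exact: measurableC.
apply: (@le_trans _ _ (P (avoiding_event v X (fun=> v) 0 n) + P (~` [set w | X 0%N w = v]))%E).
  by apply: measureU2 => //; exact: measurableC.
rewrite P0 adde0; have := @avoiding_prob_le _ _ lf simple has_edge v _ _ _ _ RW n 0 (fun=> v) erefl.
by rewrite big_ord0 mul1r.
Qed.

(* With [H > 0] superharmonic, [phi^2 / H] is tested against the Laplacian of [H];
   edge by edge this is [2 a b <= a^2 t + b^2 / t] with [t = H y / H x]. *)
Lemma hardy_inequality (S : seq V) (H phi : V -> R) :
  uniq S -> (forall u, 0 < H u) -> (forall u, u \notin S -> phi u = 0) ->
  \sum_(u <- S) \sum_(e <- edges_from u) cond e * (phi u ^+ 2 * (1 - H (otgt e) / H u)) <=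
  \sum_(u <- S) \sum_(e <- edges_from u) cond e * (phi u - phi (otgt e)) ^+ 2.
Proof.
move=> uS H0 supp.
pose w e := cond e * (phi (osrc e) ^+ 2 * (1 - H (otgt e) / H (osrc e))).
pose D e := cond e * (phi (osrc e) - phi (otgt e)) ^+ 2.
pose L := flatten [seq edges_from u | u <- S].
have memL e : (e \in L) = (osrc e \in S).
  apply/flatten_mapP/idP => [[u uS']|eS]; first by rewrite mem_edges_from // => /eqP ->.
  by exists (osrc e) => //; rewrite mem_edges_from.
have uL : uniq L.
  rewrite /L; elim: (S) uS => //= u s IH /andP[us {}/IH IH].
  rewrite cat_uniq uniq_edges_from IH andbT /=; apply/hasPn => e /flatten_mapP[u' u's].
  rewrite !mem_edges_from // => /eqP ->; apply: contraNN us => /eqP <- //.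
have toL (F : E -> R) (F' : V -> E -> R) : (forall e, F e = F' (osrc e) e) ->
    \sum_(u <- S) \sum_(e <- edges_from u) F' u e = \sum_(e <- L) F e.
  move=> FF; rewrite /L big_flatten big_map; apply: eq_bigr => u _.
  by apply: eq_big_seq => e; rewrite mem_edges_from // => /eqP <-.
rewrite (toL w) // (toL D) //.
have D0 e : 0 <= D e by rewrite mulr_ge0 ?sqr_ge0 // ltW ?cond_gt0.
rewrite (bigID (fun e => otgt e \in S)) [leRHS](bigID (fun e => otgt e \in S)) /=.
apply: lerD; last first.
  apply: ler_sum => e eS; rewrite /w /D (supp _ eS) subr0 ler_pM2l ?cond_gt0 //.
  by rewrite ler_piMr ?sqr_ge0 // gerBl divr_ge0 // ltW.
pose L' := [seq e <- L | otgt e \in S].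
have -> : \sum_(e <- L | otgt e \in S) w e = \sum_(e <- L') w e by rewrite big_filter.
have -> : \sum_(e <- L | otgt e \in S) D e = \sum_(e <- L') D e by rewrite big_filter.
have permL' : perm_eq (map (@orev _ G) L') L'.
  apply: uniq_perm.
  - by rewrite map_inj_uniq ?filter_uniq //; exact: (inv_inj (@orevK _ G)).
  - by rewrite filter_uniq.
  - move=> e; rewrite -{1}(orevK e) mem_map; last exact: (inv_inj (@orevK _ G)).
    by rewrite !mem_filter !memL /otgt orevK andbC.
have rev : \sum_(e <- L') w e = \sum_(e <- L') w (orev e) by rewrite -(perm_big _ permL') big_map.
have pair e : w e + w (orev e) <= D e.
  rewrite /w /D /otgt orevK cond_rev -/(otgt e) -mulrDr ler_pM2l ?cond_gt0 //.
  have hx := H0 (osrc e); have hy := H0 (otgt e).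
  set a := phi (osrc e); set b := phi (otgt e); set x := H (osrc e) in hx *; set y := H (otgt e) in hy *.
  have xn : x != 0 by rewrite gt_eqF.
  have yn : y != 0 by rewrite gt_eqF.
  rewrite -subr_ge0.
  have -> : (a - b) ^+ 2 - (a ^+ 2 * (1 - y / x) + b ^+ 2 * (1 - x / y)) = (a * y - b * x) ^+ 2 / (x * y).
    by field; rewrite xn yn.
  by rewrite divr_ge0 ?sqr_ge0 // ltW // mulr_gt0.
have : 2 * \sum_(e <- L') w e <= \sum_(e <- L') D e.
  have -> : 2 * \sum_(e <- L') w e = \sum_(e <- L') (w e + w (orev e)).
    by rewrite big_split /= -rev; ring.
  by apply: ler_sum => e _; exact: pair.
have : 0 <= \sum_(e <- L') D e by apply: sumr_ge0 => e _; exact: D0.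
move: (\sum_(e <- L') D e) (\sum_(e <- L') w e); move=> x y; lra.
Qed.

(** [b u] is the probability never to visit [v] at a positive time, so [H] is 1 plus the probability
    of ever visiting [v], time 0 included. It is harmonic off [v], and the left-hand side of
    [hardy_inequality] reduces to the term at [v], which is [weight v * b v / 2]. The summand 1
    makes positivity of [H] immediate, at the price of the factor 2. *)
Lemma escape_le_energy (v : V) q p (S : seq V) (phi : V -> R) :
  escape_probability v q -> (p%:E <= q)%E -> 0 <= p ->
  uniq S -> v \in S -> phi v = 1 -> (forall u, u \notin S -> phi u = 0) ->
  p * weight v <= 2 * \sum_(u <- S) \sum_(e <- edges_from u) cond e * (phi u - phi (otgt e)) ^+ 2.
Proof.
move=> esc pq p0 uS vS phiv supp.
have [b [cb b01 bE]] := avoid_lim lf has_edge v.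
have pb : p <= b v.
  rewrite -(cvg_lim _ (cb v)) //; apply: limr_ge; first by apply/cvg_ex; exists (b v).
  by near=> n; rewrite -lee_fin; apply: le_trans pq (escape_le_avoid n esc).
pose H u := 1 + (if u == v then 1 else 1 - b u).
have H0 u : 0 < H u.
  rewrite /H; case: ifP => _; first by lra.
  by case/andP: (b01 u) => _ h; rewrite ltr_pwDl // subr_ge0.
have := hardy_inequality uS H0 supp.
suff -> : \sum_(u <- S) \sum_(e <- edges_from u) cond e * (phi u ^+ 2 * (1 - H (otgt e) / H u)) =
    weight v * b v / 2.
  move=> h; have : p * weight v <= b v * weight v by rewrite ler_pM2r // weight_gt0.
  by move: h; set T := \sum_(u <- S) _; move: (weight v) (b v) => x y; lra.
have inner u : \sum_(e <- edges_from u) cond e * (phi u ^+ 2 * (1 - H (otgt e) / H u)) =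
   weight u * phi u ^+ 2 * (1 - (2 - b u) / H u).
  have wn : weight u != 0 by rewrite gt_eqF // weight_gt0.
  have Hn : H u != 0 by rewrite gt_eqF.
  transitivity (\sum_(e <- edges_from u) weight u * phi u ^+ 2 * (prob e - prob e * H (otgt e) / H u)).
    apply: eq_big_seq => e; rewrite mem_edges_from // => /eqP eu.
    by rewrite /prob eu; field; rewrite wn Hn.
  rewrite -mulr_sumr sumrB sum_prob //; congr (_ * (1 - _)).
  rewrite -mulr_suml; congr (_ / _); rewrite bE.
  have -> : 2 = \sum_(e <- edges_from u) prob e * 2 :> R by rewrite -mulr_suml sum_prob // mul1r.
  rewrite -sumrB; apply: eq_bigr => e _; rewrite -mulrBr /H; case: ifP => _; congr (_ * _); ring.
rewrite (eq_bigr _ (fun u _ => inner u)) (big_rem v) //= big1_seq ?addr0.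
  by rewrite phiv /H eqxx; field.
move=> u; rewrite mem_rem_uniq // inE => /andP[_ /andP[uv _]].
have Hn : H u != 0 by rewrite gt_eqF.
have HE : H u = 2 - b u by rewrite /H (negbTE uv); ring.
by rewrite -HE divff // subrr mulr0.
Unshelve. all: by end_near. Qed.

End Escape.

(** * Areas *)

Section Area.
Variable R : realType.

(* Compares areas of axis-parallel squares inscribed in the discs. *)
Lemma disjoint_discs_area (I : choiceType) (s : seq I) (c : I -> pdisc R) (x0 y0 rho : R) :
  uniq s -> 0 < rho -> (forall i, i \in s -> 0 < pr (c i)) ->
  (forall i j, i \in s -> j \in s -> i <> j -> (pr (c i) + pr (c j)) ^+ 2 <= d2 (c i) (c j)) ->
  (forall i, i \in s -> `|px (c i) - x0| + pr (c i) <= rho /\ `|py (c i) - y0| + pr (c i) <= rho) ->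
  \sum_(i <- s) pr (c i) ^+ 2 <= 4 * rho ^+ 2.
Proof.
move=> us rho0 r0 disj ins.
pose mu : set R -> \bar R := @lebesgue_measure R.
pose mu2 := (@lebesgue_measure R \x @lebesgue_measure R)%E.
pose Q i : set (R * R) := `[px (c i) - pr (c i) / 2, px (c i) + pr (c i) / 2]%classic `*`
   `[py (c i) - pr (c i) / 2, py (c i) + pr (c i) / 2]%classic.
pose K : set (R * R) := `[x0 - rho, x0 + rho]%classic `*` `[y0 - rho, y0 + rho]%classic.
have mI (a b : R) : measurable `[a, b]%classic by exact: measurable_itv.
have muI (a r : R) : 0 < r -> @lebesgue_measure R `[a - r, a + r]%classic = (2 * r)%:E.
  move=> rp; rewrite lebesgue_measure_itv /= lte_fin ltrD2l gtrN // -EFinB; congr (_%:E); ring.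
have muQ i : i \in s -> mu2 (Q i) = (pr (c i) ^+ 2)%:E.
  move=> is_; have h : 0 < pr (c i) / 2 by rewrite divr_gt0 // r0.
  rewrite /mu2 product_measure1E; [|exact: mI|exact: mI].
  transitivity ((2 * (pr (c i) / 2))%:E * (2 * (pr (c i) / 2))%:E)%E.
    by congr (_ * _)%E; exact: muI.
  by rewrite -EFinM; congr (_%:E); field.
have muK : mu2 K = (4 * rho ^+ 2)%:E.
  rewrite /mu2 product_measure1E; [|exact: mI|exact: mI].
  transitivity ((2 * rho)%:E * (2 * rho)%:E)%E; first by congr (_ * _)%E; exact: muI.
  by rewrite -EFinM; congr (_%:E); ring.
have mQ i : measurable (Q i) by apply: measurableX.
have mK : measurable K by apply: measurableX.
have triv : trivIset [set` s] Q.
  move=> i j /= is_ js [[u v] [[/= u1 v1] [/= u2 v2]]]; apply: contrapT => ij.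
  move: u1 v1 u2 v2; rewrite !in_itv /= => /andP[a1 a2] /andP[b1 b2] /andP[a3 a4] /andP[b3 b4].
  have := disj i j is_ js ij; rewrite /d2.
  have := r0 i is_; have := r0 j js; move: a1 a2 a3 a4 b1 b2 b3 b4.
  set r := pr (c i); set r' := pr (c j); set x := px (c i); set x' := px (c j).
  set y := py (c i); set y' := py (c j); clear => a1 a2 a3 a4 b1 b2 b3 b4 rp' rp D.
  (* Overlapping squares would have centres at squared distance at most [(r + r') ^+ 2 / 2]. *)
  have e1 : (x - x') ^+ 2 <= ((r + r') / 2) ^+ 2.
    rewrite -real_normK ?num_real // ler_sqr ?nnegrE ?normr_ge0 //; [rewrite ler_norml; apply/andP; split|]; move: a1 a2 a3 a4 b1 b2 b3 b4 rp rp'; clear; lra.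
  have e2 : (y - y') ^+ 2 <= ((r + r') / 2) ^+ 2.
    rewrite -real_normK ?num_real // ler_sqr ?nnegrE ?normr_ge0 //; [rewrite ler_norml; apply/andP; split|]; move: a1 a2 a3 a4 b1 b2 b3 b4 rp rp'; clear; lra.
  have : 0 < (r + r') ^+ 2 by rewrite exprn_gt0 // addr_gt0.
  by move: e1 e2 D; clear; lra.
have sub : \bigcup_(i in [set` s]) Q i `<=` K.
  move=> [u v] [i /= is_] [/= u1 v1]; move: u1 v1; rewrite !in_itv /= => /andP[a1 a2] /andP[b1 b2].
  have [h1 h2] := ins i is_; have h3 := r0 i is_.
  have n1 : `|px (c i) - x0| <= rho - pr (c i) by move: h1; clear; lra.
  have n2 : `|py (c i) - y0| <= rho - pr (c i) by move: h2; clear; lra.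
  move: n1 n2; rewrite !ler_norml => /andP[n1 n1'] /andP[n2 n2'].
  by split; rewrite /= in_itv /=; apply/andP; split; move: a1 a2 b1 b2 n1 n1' n2 n2' h3; clear; lra.
have eqU : mu2 (\bigcup_(i in [set` s]) Q i) = (\sum_(i <- s) pr (c i) ^+ 2)%:E.
  transitivity (\sum_(i \in [set` s]) mu2 (Q i))%E; first by apply: (@measure_fin_bigcup _ R _ (@lebesgue_measure R \x @lebesgue_measure R)%E) => // i _; exact: mQ.
  by rewrite -fsbig_seq // (eq_big_seq _ muQ) sumEFin.
rewrite -lee_fin -eqU -muK; apply: (@le_measure _ _ _ (@lebesgue_measure R \x @lebesgue_measure R)%E) => //; rewrite inE //.
by apply: fin_bigcup_measurable => [|i _]; [exact: finite_seq|exact: mQ].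
Qed.

End Area.

Local Open Scope complex_scope.

(** * The plane and the sphere *)

Section PlaneTopology.
Variable R : realType.
Implicit Types z w : R[i].

Lemma modulusE z : modulus z = norm2 (complex.Re z) (complex.Im z).
Proof. by case: z. Qed.

Lemma modulus_ge0 z : 0 <= modulus z.
Proof. by rewrite modulusE sqrtr_ge0. Qed.

Lemma modulus_sqr z : modulus z ^+ 2 = complex.Re z ^+ 2 + complex.Im z ^+ 2.
Proof. by rewrite modulusE sqr_sqrtr // addr_ge0 ?sqr_ge0. Qed.

Lemma modulusD z w : modulus (z + w) <= modulus z + modulus w.
Proof. exact: complex.le_normcD. Qed.

Lemma modulusM z w : modulus (z * w) = modulus z * modulus w.
Proof. exact: complex.ComplexField.Normc.normcM. Qed.

Lemma modulusN z : modulus (- z) = modulus z.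
Proof. exact: complex.normcN. Qed.

Lemma modulusB z w : modulus (z - w) = modulus (w - z).
Proof. by rewrite -modulusN opprB. Qed.

Lemma modulus0 : modulus (0 : R[i]) = 0.
Proof. exact: complex.ComplexField.Normc.normc0. Qed.

Lemma modulus_eq0 z : modulus z = 0 -> z = 0.
Proof. exact: complex.ComplexField.Normc.eq0_normc. Qed.

Lemma modulus_real (x : R) : modulus x%:C = `|x|.
Proof. by rewrite modulusE /norm2 /= expr0n addr0 sqrtr_sqr. Qed.

Lemma modulus_cis (t : R) : modulus (cis t) = 1.
Proof. by rewrite modulusE /norm2 /= cos2Dsin2 sqrtr1. Qed.

Lemma modulus_triangle w z z' : modulus (z - z') <= modulus (z - w) + modulus (w - z').
Proof. by apply: le_trans (modulusD _ _); rewrite addrA subrK. Qed.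

Lemma normC_modulus z : `|z| = (modulus z)%:C.
Proof. by rewrite normc_def modulusE. Qed.

Lemma Re_le_modulus z : `|complex.Re z| <= modulus z.
Proof. by rewrite modulusE -sqrtr_sqr ler_wsqrtr // lerDl sqr_ge0. Qed.

Lemma Im_le_modulus z : `|complex.Im z| <= modulus z.
Proof. by rewrite modulusE -sqrtr_sqr ler_wsqrtr // lerDr sqr_ge0. Qed.

Lemma modulus_le_ReIm z : modulus z <= `|complex.Re z| + `|complex.Im z|.
Proof.
rewrite -ler_sqr ?nnegrE ?modulus_ge0 ?addr_ge0 ?normr_ge0 // modulus_sqr.
rewrite -(real_normK (num_real (complex.Re z))) -(real_normK (num_real (complex.Im z))).
have := normr_ge0 (complex.Re z); have := normr_ge0 (complex.Im z); clear; nra.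
Qed.

(** The norm of [R[i]] takes its values in [R[i]], and so do the radii of its balls; a positive one
    has imaginary part 0, which gives back real radii. *)
Lemma nbhs_planeP (z : plane R) (U : set (plane R)) :
  nbhs z U <-> exists2 e : R, 0 < e & forall w, modulus (w - z) < e -> U w.
Proof.
split.
- move=> /(@nbhs_ballP R[i] (R[i]^o)) [e /= e0 H].
  exists (complex.Re e); first by move: e0; rewrite ltcE /= => /andP[].
  move=> w wz; apply: H; rewrite /ball /= -opprB normrN normC_modulus.
  by move: e0; rewrite !ltcE /= => /andP[]; rewrite eq_sym => /eqP -> _; rewrite eqxx.
- move=> [e e0 H]; apply/(@nbhs_ballP R[i] (R[i]^o)); exists e%:C; first by rewrite /= ltcR.
  move=> w; rewrite /ball /= -opprB normrN normC_modulus ltcR; exact: H.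
Qed.

Lemma continuous_planeP (f : plane R -> plane R) z :
  {for z, continuous f} <-> forall e, 0 < e -> exists2 d, 0 < d &
    forall w, modulus (w - z) < d -> modulus (f w - f z) < e.
Proof.
split.
  move=> cf e e0; have : nbhs (f z) [set y | modulus (y - f z) < e].
    by apply/nbhs_planeP; exists e.
  by move=> /cf /nbhs_planeP [d d0 H]; exists d.
move=> H U /nbhs_planeP [e e0 HU]; apply/nbhs_planeP; have [d d0 Hd] := H _ e0.
by exists d => // w /Hd /HU.
Qed.

Lemma continuous_Re : continuous (fun z : plane R => complex.Re z).
Proof.
move=> z U /nbhs_ballP [e /= e0 HU]; apply/nbhs_planeP; exists e => // w wz.
apply: HU; rewrite /ball /= -opprB normrN; apply: le_lt_trans wz.
by rewrite -(raddfB (@complex.Re R)) Re_le_modulus.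
Qed.

Lemma continuous_Im : continuous (fun z : plane R => complex.Im z).
Proof.
move=> z U /nbhs_ballP [e /= e0 HU]; apply/nbhs_planeP; exists e => // w wz.
apply: HU; rewrite /ball /= -opprB normrN; apply: le_lt_trans wz.
by rewrite -(raddfB (@complex.Im R)) Im_le_modulus.
Qed.

Lemma cvg_complex (T : Type) (F : set_system T) {FF : Filter F} (f g : T -> R) (a b : R) :
  f @ F --> a -> g @ F --> b -> (fun x => (f x +i* g x : plane R)) @ F --> (a +i* b : plane R).
Proof.
move=> cf cg U /nbhs_planeP [e e0 HU].
have e2 : 0 < e / 2 by rewrite divr_gt0.
have nf : \forall x \near F, `|a - f x| < e / 2 by exact: (cf _ (nbhsx_ballx a (e / 2) e2)).
have ng : \forall x \near F, `|b - g x| < e / 2 by exact: (cg _ (nbhsx_ballx b (e / 2) e2)).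
change (F [set x | U (f x +i* g x)]); move: nf ng; apply: filterS2 => x h1 h2; apply: HU.
apply: le_lt_trans (modulus_le_ReIm _) _ => /=.
by rewrite distrC [X in _ + X]distrC; move: h1 h2; clear; lra.
Qed.

Lemma plane_hausdorff : hausdorff_space (plane R).
Proof. exact: (@norm_hausdorff R[i] (R[i]^o)). Qed.

Lemma closed_ball_compact z (r : R) : compact [set w : plane R | modulus (w - z) <= r].
Proof.
case: z => a b.
pose K := `[a - r, a + r]%classic `*` `[b - r, b + r]%classic : set (R * R).
have cK : compact K by apply: compact_setX; exact: segment_compact.
pose g (x : R * R) : plane R := x.1 +i* x.2.
have cg : continuous g by move=> x; apply: cvg_complex; [exact: cvg_fst|exact: cvg_snd].
have cgK : compact (g @` K) by apply: continuous_compact => //; exact: continuous_subspaceT.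
apply: (subclosed_compact _ cgK).
  rewrite -[X in closed X]setCK; apply: open_closedC; rewrite openE => w /= /negP.
  rewrite -ltNge => rw; apply/nbhs_planeP; exists (modulus (w - (a +i* b)) - r).
    by rewrite subr_gt0.
  move=> w' ww' /=; apply/negP; rewrite -ltNge.
  have := modulus_triangle w' w (a +i* b); rewrite [modulus (w - w')]modulusB.
  by move: ww'; clear; lra.
move=> w /= wr; exists (complex.Re w, complex.Im w); last by case: (w).
move: (Re_le_modulus (w - (a +i* b))) (Im_le_modulus (w - (a +i* b))).
rewrite !raddfB /= => /le_trans /(_ wr) + /le_trans /(_ wr).
rewrite !ler_norml /K => /andP[h1 h2] /andP[h3 h4]; split; rewrite /= in_itv /=; apply/andP; split; move: h1 h2 h3 h4; clear; lra.
Qed.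

(** Makes the compact images of edges closed, so that a point off finitely many edges has a
    neighbourhood free of them. *)
Lemma sphere_hausdorff : hausdorff_space (sphere R).
Proof.
rewrite open_hausdorff => x y xy.
have sep (z : plane R) : exists AB : set (sphere R) * set (sphere R),
    [/\ AB.1 (Some z), AB.2 None, open AB.1, open AB.2 & AB.1 `&` AB.2 = set0].
  pose B := [set w : plane R | modulus (w - z) < 1].
  pose K := [set w : plane R | modulus (w - z) <= 1].
  have oB : open B.
    rewrite openE => w /= wz; apply/nbhs_planeP; exists (1 - modulus (w - z)).
      by rewrite subr_gt0.
    move=> w' ww'; rewrite /B /=; have := modulus_triangle w w' z; move: ww'; clear; lra.
  have cK : compact K by exact: closed_ball_compact.
  have clK : closed K by apply: compact_closed => //; exact: plane_hausdorff.
  exists (Some @` B, (Some @` ~` K) `|` [set None]); split => /=.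
  - by exists z; rewrite // /B /= subrr modulus0.
  - by right.
  - exact: one_point_compactification_open_some.
  - rewrite openE => -[w|] /=.
      move=> [[w' nK [<-]]|//]; apply: (@filterS _ _ _ (Some @` ~` K)).
        by move=> ? ?; left.
      by apply: one_point_compactification_some_nbhs; apply: open_nbhs_nbhs; split=> //; exact: closed_openC.
    by move=> _; exists K => //.
  - rewrite -subset0 => y0 /= [[w Bw <-]] [[w' nK [E]]|] //.
    by apply: nK; rewrite E; exact: ltW.
case: x y xy => [x|] [y|] //= xy.
- have xy' : x != y by apply: contra_neq xy => ->.
  have := plane_hausdorff; rewrite open_hausdorff => hp.
  have [[A B] [xA yB] [oA oB /eqP AB]] := hp _ _ xy'.
  exists (Some @` A, Some @` B); split => /=.
  + by apply/mem_set; exists x => //; exact/set_mem.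
  + by apply/mem_set; exists y => //; exact/set_mem.
  + exact: one_point_compactification_open_some.
  + exact: one_point_compactification_open_some.
  + apply/eqP; rewrite -subset0 => -[w|] /= [[w1 A1 E1] [w2 B2 E2]] //.
    have e1 : w1 = w by case: E1.
    have e2 : w2 = w by case: E2.
    by have : (A `&` B) w; [split; [rewrite -e1|rewrite -e2]|rewrite AB].
- have [[A B] /= [h1 h2 h3 h4 h5]] := sep x.
  by exists (A, B); split => //=; [exact/mem_set|exact/mem_set|apply/eqP].
- have [[A B] /= [h1 h2 h3 h4 h5]] := sep y.
  exists (B, A); split => //=; [exact/mem_set|exact/mem_set|].
  by apply/eqP; rewrite setIC.
Qed.

End PlaneTopology.

(** * Faces of the drawing *)

Section DrawingTopology.
Variables (R : realType) (G : network R) (D : drawing G).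
Hypothesis ppn : proper_plane_network D.

Lemma vertex_has_edge (v : vertex G) : exists e, osrc e = v.
Proof.
case: ppn => _ conn inf _ _.
have [u uv] : exists u, u <> v.
  apply: contrapT => none; apply: inf; have -> : [set: vertex G] = [set v].
    by apply/seteqP; split=> // u _; apply: contrapT => uv; apply: none; exists u.
  exact: finite_set1.
have [[|n] /=] := conn v u I I; first by case=> _ vu; case: uv.
by case=> _ [e ev _]; exists e.
Qed.

Lemma epos_inj e (s t : R) : 0 < s < 1 -> 0 <= t <= 1 ->
  epos D e t = epos D e s -> t = s.
Proof.
case: ppn => _ _ _ _ [[ends _ _ [_ off inj]] _ _ _ _] s01 /andP[t0 t1] E.
have [e0 e1] := ends e.
have [tz|tn] := eqVneq t 0.
  by case: (off e s (osrc e) s01); rewrite -E tz e0.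
have [to|ton] := eqVneq t 1.
  by case: (off e s (otgt e) s01); rewrite -E to e1.
have t01 : 0 < t < 1 by rewrite lt_def tn t0 lt_neqAle ton t1.
have [[_ ->//]|[h _]] := inj _ _ _ _ s01 t01 (esym E).
by case: (orev_neq (esym h)).
Qed.

Lemma edge_image_compact e : compact (edge_image D e).
Proof.
case: ppn => _ _ _ _ [[_ _ cont _] _ _ _ _].
by apply: continuous_compact; [exact: cont|exact: segment_compact].
Qed.

(** Properness leaves finitely many edges meeting a compact neighbourhood of the point. The union of
    those other than [e] and its reversal is closed and misses the point, and so is the part of [e]
    with parameter outside the interior of [U]. *)
Lemma edge_local e (t0 : R) (U : set R) (z0 : plane R) : 0 < t0 < 1 -> nbhs t0 U ->
  epos D e t0 = Some z0 ->
  exists2 eps : R, 0 < eps & forall w : plane R, modulus (w - z0) < eps ->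
    domain D (Some w) /\
    (graph_image D (Some w) -> exists t, [/\ 0 <= t <= 1, U t & epos D e t = Some w]).
Proof.
move=> t01 Ut0 E0.
case: ppn => _ _ _ [oD _] [[ends rev cont [_ off inj]] sub _ _ lf].
have Dz0 : domain D (Some z0).
  apply: sub; right; exists e => //; exists t0 => //=.
  by rewrite in_itv /=; case/andP: t01 => /ltW -> /ltW ->.
have : nbhs (Some z0 : sphere R) (domain D) by apply: open_nbhs_nbhs.
move=> /one_point_compactification_some_continuous /nbhs_planeP [e1 e1p He1].
pose B := [set w : plane R | modulus (w - z0) <= e1 / 2].
pose K : set (sphere R) := Some @` B.
have cK : compact K.
  apply: continuous_compact; last exact: closed_ball_compact.
  by apply: continuous_subspaceT; exact: one_point_compactification_some_continuous.
have KD : K `<=` domain D.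
  by move=> _ [w Bw <-]; apply: He1; apply: le_lt_trans Bw _; rewrite ltr_pdivrMr // ltr_pMr // ltr1n.
have fin := lf K cK KD.
pose E1 := [set e' | edge_image D e' `&` K !=set0] `\` [set e' | e' = e \/ e' = orev e].
pose C := \bigcup_(e' in E1) edge_image D e'.
have clC : closed C.
  apply: closed_bigcup; first by apply: sub_finite_set fin => x [].
  by move=> e' _; apply: compact_closed; [exact: sphere_hausdorff|exact: edge_image_compact].
have nC : ~ C (Some z0).
  move=> [e' [_ ne] [t /=]]; rewrite in_itv /= => /andP[t0' t1'] Et.
  have [ee0 ee1] := ends e'.
  have [tz|tn] := eqVneq t 0.
    by case: (off e t0 (osrc e') t01); rewrite E0 -Et tz ee0.
  have [to|ton] := eqVneq t 1.
    by case: (off e t0 (otgt e') t01); rewrite E0 -Et to ee1.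
  have t01' : 0 < t < 1 by rewrite !lt_neqAle eq_sym tn t0' ton t1'.
  have [[h _]|[h _]] := inj _ _ _ _ t01 t01' (etrans E0 (esym Et)); apply: ne; [by left|by right].
pose C' := epos D e @` (`[0, 1] `&` ~` U°).
have clC' : closed C'.
  apply: compact_closed; first exact: sphere_hausdorff.
  apply: continuous_compact; first by apply: continuous_subspaceW (cont e) => x [].
  by apply: compact_closedI; [exact: segment_compact|apply: open_closedC; exact: open_interior].
have nC' : ~ C' (Some z0).
  move=> [t [/= t01' nU] Et]; apply: nU.
  by rewrite (epos_inj t01 _ (etrans Et (esym E0))) //; move: t01'; rewrite in_itv.
have nb : nbhs (Some z0 : sphere R) (~` C `&` ~` C').
  apply: open_nbhs_nbhs; split=> //.
  by apply: openI; exact: closed_openC.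
move/one_point_compactification_some_continuous/nbhs_planeP : nb => [e2 e2p He2].
exists (Num.min (e1 / 2) e2); first by rewrite lt_min e2p divr_gt0.
move=> w; rewrite lt_min => /andP[w1 w2].
have [nCw nCw'] := He2 w w2.
have Bw : B w by rewrite /B /= ltW.
have Kw : K (Some w) by exists w.
split; first exact: KD.
have key e' : edge_image D e' (Some w) -> exists t, [/\ 0 <= t <= 1, U t & epos D e t = Some w].
  move=> ew; have [ee|ne] := pselect (e' = e \/ e' = orev e); last first.
    by case: nCw; exists e' => //; split=> //; exists (Some w).
  have [t t01' Et] : exists2 t, 0 <= t <= 1 & epos D e t = Some w.
    case: ew => t /=; rewrite in_itv /= => t01' <-; case: ee => ->; first by exists t.
    exists (1 - t); first by move: t01'; rewrite subr_ge0 gerBl andbC.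
    by rewrite rev.
  exists t; split=> //; apply: contrapT => nUt; apply: nCw'; exists t => //; split.
    by rewrite /= in_itv.
  by move=> /interior_subset.
case=> [[v _ vE]|[e' _ ew]]; last exact: key ew.
have [e' ev] := vertex_has_edge v; apply: (key e'); exists 0; first by rewrite /= in_itv /= lexx ler01.
by have [-> _] := ends e'; rewrite ev.
Qed.

Lemma nbhs_cis_image (h : plane R -> plane R) : {within @unit_disc R, continuous h} ->
  forall z, unit_disc z -> {for z, continuous h}.
Proof.
have oU : open (@unit_disc R).
  rewrite openE => w /= wz; apply/nbhs_planeP; exists (1 - modulus w).
    by rewrite subr_gt0.
  move=> w' ww'; rewrite /unit_disc /=; have := modulus_triangle w w' 0.
  by rewrite !subr0; move: ww'; clear; lra.
by rewrite continuous_open_subspace // => ch z Uz; apply: ch; exact/mem_set.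
Qed.

(** A half turn of the chart exchanges its upper and lower halves and reverses its diameter; the
    contraction by [c] confines it to where the lower half is known to be free of the graph. *)
Definition opposite_chart (c : R) (h : plane R -> plane R) (z : plane R) : plane R :=
  h (- c%:C * z).

(** The circle of radius [r] is deformed, avoiding 0, into the circle of radius [c r] started at its
    opposite point; the image avoids [h 0] by injectivity, so the winding number is kept. *)
Lemma opposite_chart_positive (c : R) (h : plane R -> plane R) :
  0 < c < 1 -> positive_chart h -> positive_chart (opposite_chart c h).
Proof.
move=> /andP[c0 c1] [ch ih [r [theta [/andP[r0 r1] cth th1 thE]]]].
have chz := nbhs_cis_image ch.
have scale z : modulus (- c%:C * z) = c * modulus z.
  by rewrite modulusM modulusN modulus_real gtr0_norm.
have inU z : unit_disc z -> unit_disc (- c%:C * z : plane R).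
  rewrite /unit_disc /= scale => z1; apply: le_lt_trans z1.
  by rewrite ler_piMl ?modulus_ge0 // ltW.
have ncn : - c%:C != 0 :> R[i] by rewrite oppr_eq0 eq_complex /= eqxx andbT gt_eqF.
split.
- apply/subspace_continuousP => z Uz; apply: cvg_within_filter.
  apply/continuous_planeP => e e0.
  have /continuous_planeP /(_ e e0) [d d0 Hd] := chz _ (inU z Uz).
  exists d => // w wz; apply: Hd; rewrite -mulrBr scale.
  by apply: le_lt_trans wz; rewrite ler_piMl ?modulus_ge0 // ltW.
- move=> z w /set_mem zU /set_mem wU E; apply: (mulfI ncn).
  by apply: ih E; apply/mem_set; exact: inU.
(* Radius along the deformation. The weights cos^2 and sin^2 keep it between [c r] and [r] for every
   real [s], as [winds_once_homotopy] ranges over the whole line. *)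
pose rho (s : R) := r * cos (pi * s / 2) ^+ 2 + c * r * sin (pi * s / 2) ^+ 2.
have rhoP s : 0 < rho s < 1.
  have := cos2Dsin2 (pi * s / 2); have := sqr_ge0 (cos (pi * s / 2)); have := sqr_ge0 (sin (pi * s / 2)).
  rewrite /rho; set y := cos _ ^+ 2; set x := sin _ ^+ 2 => x0 y0 yx.
  have xy : y + x = 1 by [].
  have -> : r * y + c * r * x = r * (c * (y + x) + (1 - c) * y) by ring.
  rewrite xy mulr1; have k1 : c <= c + (1 - c) * y by rewrite lerDl mulr_ge0 // subr_ge0 ltW.
  have k2 : c + (1 - c) * y <= 1.
    have : (1 - c) * y <= (1 - c) * 1 by rewrite ler_pM2l ?subr_gt0 //; move: x0 xy; clear; lra.
    by clear; lra.
  apply/andP; split; first by rewrite mulr_gt0 //; apply: lt_le_trans k1.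
  by apply: le_lt_trans r1; rewrite ger_pMr.
pose k (x : R * R) : plane R := (rho x.1 * cos (pi * x.1 + 2 * pi * x.2)) +i* (rho x.1 * sin (pi * x.1 + 2 * pi * x.2)).
have kcis s t : k (s, t) = (rho s)%:C * cis (pi * s + 2 * pi * t).
  by apply/eqP; rewrite eq_complex /= !mul0r subr0 addr0 !eqxx.
have kmod s t : modulus (k (s, t)) = rho s.
  by rewrite kcis modulusM modulus_real modulus_cis mulr1 gtr0_norm //; case/andP: (rhoP s).
have kU x : unit_disc (k x) by case: x => s t; change (modulus (k (s, t)) < 1); rewrite kmod; case/andP: (rhoP s).
have k0 x : k x <> 0.
  case: x => s t => E; have := kmod s t; rewrite E modulus0.
  by move=> r_0; have := rhoP s; rewrite -r_0 ltxx.
have cmul (a : R) : continuous (fun s : R => a * s).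
  by move=> s; apply: cvgM; [exact: cvg_cst|exact: cvg_id].
have c_half : continuous (fun s : R => pi * s / 2).
  by move=> s; apply: cvgM; [exact: cmul|exact: cvg_cst].
have sq (f : R -> R) : continuous f -> continuous (fun t => f t ^+ 2).
  by move=> cf t; apply: (@continuous_comp _ _ _ f (fun x => x ^+ 2)); [exact: cf|exact: exprn_continuous].
have c_rho : continuous rho.
  move=> s; apply: cvgD; (apply: cvgM; first exact: cvg_cst).
    apply: (sq (fun s => cos (pi * s / 2))) => x.
    by apply: (@continuous_comp _ _ _ (fun s => pi * s / 2) cos); [exact: c_half|exact: continuous_cos].
  apply: (sq (fun s => sin (pi * s / 2))) => x.
  by apply: (@continuous_comp _ _ _ (fun s => pi * s / 2) sin); [exact: c_half|exact: continuous_sin].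
have c_arg : continuous (fun x : R * R => pi * x.1 + 2 * pi * x.2).
  move=> x; apply: cvgD.
    by apply: (@continuous_comp _ _ _ fst (fun s => pi * s)); [exact: cvg_fst|exact: cmul].
  by apply: (@continuous_comp _ _ _ snd (fun s => 2 * pi * s)); [exact: cvg_snd|exact: cmul].
have c_rho1 : continuous (fun x : R * R => rho x.1).
  by move=> x; apply: (@continuous_comp _ _ _ fst rho); [exact: cvg_fst|exact: c_rho].
have ck : continuous k.
  move=> x; apply: cvg_complex; (apply: cvgM; first exact: c_rho1).
    by apply: (@continuous_comp _ _ _ (fun x : R * R => pi * x.1 + 2 * pi * x.2) cos); [exact: c_arg|exact: continuous_cos].
  by apply: (@continuous_comp _ _ _ (fun x : R * R => pi * x.1 + 2 * pi * x.2) sin); [exact: c_arg|exact: continuous_sin].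
have chk : continuous (h \o k).
  by move=> x; apply: continuous_comp; [exact: ck|exact: chz].
pose H1 x := complex.Re (h (k x)) - complex.Re (h 0).
pose H2 x := complex.Im (h (k x)) - complex.Im (h 0).
have cH1 : continuous H1.
  move=> x; apply: cvgB; last exact: cvg_cst.
  by apply: (@continuous_comp _ _ _ (h \o k) (fun z : plane R => complex.Re z)); [exact: chk|exact: continuous_Re].
have cH2 : continuous H2.
  move=> x; apply: cvgB; last exact: cvg_cst.
  by apply: (@continuous_comp _ _ _ (h \o k) (fun z : plane R => complex.Im z)); [exact: chk|exact: continuous_Im].
have U0 : unit_disc (0 : plane R) by change (modulus (0 : R[i]) < 1); rewrite modulus0.
have Hnz s t : 0 < H1 (s, t) ^+ 2 + H2 (s, t) ^+ 2.
  rewrite lt_def addr_ge0 ?sqr_ge0 // andbT; apply/negP.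
  rewrite paddr_eq0 ?sqr_ge0 // !sqrf_eq0 !subr_eq0 => /andP[/eqP e1 /eqP e2].
  apply: (k0 (s, t)); apply: ih; [exact/mem_set|exact/mem_set|].
  by move: e1 e2; case: (h (k (s, t))) => a b; case: (h 0) => a' b' /= -> ->.
have per s : H1 (s, 0) = H1 (s, 1) /\ H2 (s, 0) = H2 (s, 1).
  have kk : k (s, 0) = k (s, 1).
    rewrite /k /= mulr0 addr0 mulr1; have -> : pi * s + 2 * pi = pi * s + pi *+ 2 :> R by ring.
    by rewrite cosD2pi sinD2pi.
  by rewrite /H1 /H2 kk.
have w0 : winds_once (fun t => H1 (0, t)) (fun t => H2 (0, t)).
  exists theta; split => // t t01.
  have := thE t t01 => /=.
  have k0t : k (0, t) = r%:C * cis (2 * pi * t).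
    rewrite kcis mulr0 add0r; congr (_%:C * _).
    by rewrite /rho mulr0 mul0r cos0 sin0 expr1n expr0n /= mulr0 addr0 mulr1.
  rewrite -k0t => E.
  have e1 : H1 (0, t) = complex.Re (h (k (0, t)) - h 0) by rewrite /H1 raddfB.
  have e2 : H2 (0, t) = complex.Im (h (k (0, t)) - h 0) by rewrite /H2 raddfB.
  have mE : modulus (h (k (0, t)) - h 0) = norm2 (H1 (0, t)) (H2 (0, t)).
    by rewrite modulusE e1 e2.
  rewrite -mE e1 e2; move: E; set m := modulus _ => E.
  have := congr1 (fun z : R[i] => complex.Re z) E.
  have := congr1 (fun z : R[i] => complex.Im z) E.
  by rewrite /= !mul0r subr0 addr0.
have [th' [cth' th'1 th'E]] := winds_once_homotopy cH1 cH2 Hnz per 1 w0.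
exists r, th'; split; [by rewrite r0|by []|by []|].
move=> t t01 /=.
have k1t : k (1, t) = - c%:C * (r%:C * cis (2 * pi * t)).
  rewrite kcis mulr1 /rho mulr1 cos_pihalf sin_pihalf expr0n expr1n /= mulr0 add0r mulr1.
  apply/eqP; rewrite eq_complex /= !mul0r !addr0 !subr0 oppr0 !mul0r !subr0 !addr0.
  by rewrite [pi + _]addrC cosDpi sinDpi !mulrN !mulNr -!mulrA !eqxx.
rewrite /opposite_chart mulr0 -k1t.
have [e1 e2] := th'E t t01.
have f1 : complex.Re (h (k (1, t)) - h 0) = H1 (1, t) by rewrite /H1 raddfB.
have f2 : complex.Im (h (k (1, t)) - h 0) = H2 (1, t) by rewrite /H2 raddfB.
rewrite modulusE f1 f2; move: e1 e2; set m := norm2 _ _ => e1 e2.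
apply/eqP; rewrite eq_complex f1 f2 e1 e2 /=.
by rewrite !mul0r subr0 addr0 !eqxx.
Qed.

End DrawingTopology.

Section Faces.
Variables (R : realType) (G : network R) (D : drawing G).
Hypothesis ppn : proper_plane_network D.

(* The lower half of a small disc of a chart along [e] lies in a single face. *)
Lemma left_face_opposite e (f : face D) : left_face e f -> exists g : face D, left_face (orev e) g.
Proof.
move=> [h [tau [ph tau_mono tauP up]]].
have [ch ih _] := ph.
have chz := nbhs_cis_image ch.
have [_ _ _ _ [[ends rev cont [_ off inj]] sub _ _ lf]] := ppn.
have Ux (x : R) : -1 < x < 1 -> unit_disc (x%:C : plane R).
  by move=> x1; change (modulus (x%:C : R[i]) < 1); rewrite modulus_real ltr_norml.
have cx (x : R) : -1 < x < 1 -> forall e, 0 < e -> \forall y \near x, modulus (h y%:C - h x%:C) < e.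
  move=> x1 e1 e10; have /continuous_planeP /(_ _ e10) [d d0 Hd] := chz _ (Ux _ x1).
  apply/nbhs_ballP; exists d => // y; rewrite /ball /= => xy; apply: Hd.
  by rewrite -(raddfB (@real_complex R)) modulus_real distrC.
have near_in (x : R) : -1 < x < 1 -> \forall y \near x, -1 < y < 1.
  move=> /andP[x0 x1]; near=> y; apply/andP; split.
    by near: y; exact: lt_nbhsr.
  by near: y; exact: lt_nbhsl.
(* [tau] is only given as strictly increasing. It is continuous because points of the graph close to
   [h x] lie on [e] with parameter close to [tau x]. *)
have ctau (x : R) : -1 < x < 1 -> {for x, continuous tau}.
  move=> x1 W Wx; have [t01 Ex] := tauP x x1.
  have [eps eps0 Heps] := edge_local ppn t01 Wx (esym Ex).
  change (\forall y \near x, W (tau y)); near=> y.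
  have y1 : -1 < y < 1 by near: y; exact: near_in.
  have yx : modulus (h y%:C - h x%:C) < eps by near: y; exact: cx.
  have [_ Hy] := Heps _ yx; have [ty Ey] := tauP y y1.
  have [] := Hy.
    right; exists e => //; exists (tau y) => //=.
    by rewrite in_itv /=; case/andP: ty => /ltW -> /ltW ->.
  by move=> t [t1 Wt Et]; rewrite -(epos_inj ppn ty t1 (etrans Et Ey)).
pose U := [set t | exists2 x, -1 < x < 1 & tau x = t].
have z1 : -1 < (0 : R) < 1 by rewrite ltr01 oppr_lt0 ltr01.
have half1 : -1 < (1 / 2 : R) < 1 by apply/andP; split; lra.
have half2 : -1 < (- (1 / 2) : R) < 1 by apply/andP; split; lra.
(* By the intermediate value theorem the diameter of the chart runs through all parameters close to
   [tau 0]. *)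
have nU : nbhs (tau 0) U.
  have h1 : tau (- (1 / 2)) < tau 0 by apply: tau_mono; lra.
  have h2 : tau 0 < tau (1 / 2) by apply: tau_mono; lra.
  near=> t.
  have t1 : tau (- (1 / 2)) < t by near: t; exact: lt_nbhsr.
  have t2 : t < tau (1 / 2) by near: t; exact: lt_nbhsl.
  have le12 : - (1 / 2) <= 1 / 2 :> R by lra.
  have cw : {within `[(- (1 / 2)), (1 / 2)], continuous tau}.
    apply/subspace_continuousP => x /=; rewrite in_itv /= => /andP[x1 x2].
    by apply: cvg_within_filter; apply: ctau; apply/andP; split; lra.
  have mm : Num.min (tau (- (1 / 2))) (tau (1 / 2)) <= t <= Num.max (tau (- (1 / 2))) (tau (1 / 2)).
    by rewrite ge_min le_max (ltW t1) (ltW t2) orbT.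
  have [c] := IVT le12 cw mm; rewrite in_itv /= => /andP[c1 c2] tc.
  by exists c => //; apply/andP; split; lra.
have [t01 E0] := tauP 0 z1.
have [eps eps0 Heps] := edge_local ppn t01 nU (esym E0).
have U0 : unit_disc (0%:C : plane R) by exact: Ux.
have /continuous_planeP /(_ _ eps0) [d0 d0p Hd0] := chz _ U0.
pose d := Num.min d0 1.
have dp : 0 < d by rewrite lt_min d0p ltr01.
(* Near [h 0] the graph consists of images of points of the real diameter; injectivity of [h] keeps
   these apart from the images of the lower half. *)
have clean (z : plane R) : modulus z < d -> complex.Im z < 0 ->
    (domain D `\` graph_image D) (Some (h z)).
  move=> zd zI.
  have zU : unit_disc z by apply: lt_le_trans zd _; rewrite ge_min lexx orbT.
  have hz : modulus (h z - h 0%:C) < eps.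
    by apply: Hd0; rewrite subr0; apply: lt_le_trans zd _; rewrite ge_min lexx.
  have [Dz gz] := Heps _ hz; split=> // /gz [t [t1 [x x1 xt] Et]].
  have [_ Ex] := tauP x x1.
  have hx : h x%:C = h z by rewrite -xt -Ex in Et; case: Et.
  have zx : x%:C = z by apply: ih hx; apply/mem_set => //; exact: Ux.
  by move: zI; rewrite -zx /= ltxx.
pose c := d / 2.
have c0 : 0 < c by rewrite divr_gt0.
have c1 : c < 1.
  by have : d <= 1; [rewrite ge_min lexx orbT|rewrite /c; move: dp; clear; lra].
have cd : c < d by rewrite /c; move: dp; clear; lra.
pose z1' : plane R := 0 -i* (c / 2).
have z1d : modulus z1' < d.
  apply: le_lt_trans (modulus_le_ReIm _) _; rewrite /= normr0 add0r normrN gtr0_norm ?divr_gt0 //.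
  by move: cd c0; clear; lra.
have z1I : complex.Im z1' < 0 by rewrite /= oppr_lt0 divr_gt0.
have gface : is_face D (connected_component (domain D `\` graph_image D) (Some (h z1'))).
  by exists (Some (h z1')) => //; exact: clean.
pose g : face D := exist _ _ gface.
exists g, (opposite_chart c h), (fun x => 1 - tau (- c * x)).
have cxin (x : R) : -1 < x < 1 -> -1 < - c * x < 1.
  move=> /andP[x0 x1]; have h1 : c * x < c * 1 by rewrite ltr_pM2l.
  have h2 : c * -1 < c * x by rewrite ltr_pM2l.
  by apply/andP; split; move: h1 h2 c1; clear; lra.
split.
- by apply: opposite_chart_positive => //; rewrite c0 c1.
- move=> x y x0 xy y1; rewrite ltrD2l ltrN2.
  have h1 : c * x < c * y by rewrite ltr_pM2l.
  have /andP[a1 a2] : -1 < - c * x < 1 by apply: cxin; rewrite x0 (lt_trans xy y1).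
  have /andP[b1 b2] : -1 < - c * y < 1 by apply: cxin; rewrite y1 (lt_trans x0 xy).
  by apply: tau_mono => //; move: h1; clear; lra.
- move=> x x1; have [/andP[tx0 tx1] Ex] := tauP _ (cxin _ x1); split.
    by rewrite subr_gt0 tx1 gtrBl tx0.
  rewrite rev; last by rewrite subr_ge0 gerBl (ltW tx1) (ltW tx0).
  rewrite subKr -Ex /opposite_chart; congr (Some (h _)).
  by apply/eqP; rewrite eq_complex /=; apply/andP; split; apply/eqP; ring.
- move=> z zU zI; rewrite /=.
  (* The segment from the base point [z1'] of [g] to [- c z], inside the clean half disc: its image
     connects the two points within the face. *)
  pose p (s : R) : plane R := (s * complex.Re (- c%:C * z)) +i* ((1 - s) * complex.Im z1' + s * complex.Im (- c%:C * z)).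
  have czI : complex.Im (- c%:C * z) < 0.
    by case: (z) zI => x y /=; rewrite oppr0 mul0r addr0 mulNr oppr_lt0 => y0; rewrite mulr_gt0.
  have czd : modulus (- c%:C * z) < c.
    by rewrite modulusM modulusN modulus_real gtr0_norm // gtr_pMr.
  have pd s : 0 <= s <= 1 -> modulus (p s) < d /\ complex.Im (p s) < 0.
    move=> /andP[s0 s1]; split.
      have -> : p s = (1 - s)%:C * z1' + s%:C * (- c%:C * z).
        rewrite /p; move: (- c%:C * z) => [x y]; apply/eqP; rewrite eq_complex /=.
        by apply/andP; split; apply/eqP; ring.
      apply: le_lt_trans (modulusD _ _) _; rewrite (modulusM (1 - s)%:C) (modulusM s%:C) !modulus_real.
      rewrite (ger0_norm s0) ger0_norm ?subr_ge0 //.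
      have [s1'|s1'] := eqVneq s 1.
        rewrite s1' subrr mul0r add0r mul1r; exact: lt_trans czd cd.
      have h1 : (1 - s) * modulus z1' < (1 - s) * d.
        by rewrite ltr_pM2l // subr_gt0 lt_neqAle s1'.
      have h2 : s * modulus (- c%:C * z) <= s * d.
        by rewrite ler_wpM2l // ltW // (lt_trans czd).
      by move: h1 h2; clear; lra.
    rewrite /p /=.
    have [s0'|s0'] := eqVneq s 0.
      by rewrite s0' subr0 mul1r mul0r addr0.
    have h2 : s * complex.Im (- c%:C * z) < 0 by rewrite pmulr_rlt0 // lt_neqAle eq_sym s0'.
    have h1 : (1 - s) * - (c / 2) <= 0 by rewrite mulrN oppr_le0 mulr_ge0 ?subr_ge0 // divr_ge0 // ltW.
    by move: h1 h2; rewrite /=; clear; lra.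
  have cp : continuous p.
    have lin (a : R) : continuous (fun s : R => s * a).
      by move=> s; apply: cvgM; [exact: cvg_id|exact: cvg_cst].
    move=> s; apply: cvg_complex; first exact: lin.
    apply: cvgD; last exact: lin.
    apply: cvgM; last exact: cvg_cst.
    by apply: cvgB; [exact: cvg_cst|exact: cvg_id].
  pose q (s : R) : sphere R := Some (h (p s)).
  have pU s : 0 <= s <= 1 -> unit_disc (p s).
    by move=> /pd [pd1 _]; apply: lt_le_trans pd1 _; rewrite ge_min lexx orbT.
  have cq : {within `[0, 1], continuous q}.
    apply/subspace_continuousP => s /=; rewrite in_itv /= => s01.
    apply: cvg_within_filter.
    apply: (@cvg_comp _ _ _ (h \o p) (Some : plane R -> sphere R) (nbhs s) (nbhs (h (p s)))).
      apply: (@cvg_comp _ _ _ p h (nbhs s) (nbhs (p s))); first exact: cp.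
      by apply: chz; exact: pU.
    exact: one_point_compactification_some_continuous.
  exists (q @` `[0, 1]).
    split.
    + exists 0; first by rewrite /= in_itv /= lexx ler01.
      rewrite /q; congr (Some (h _)).
      by apply/eqP; rewrite eq_complex /=; apply/andP; split; apply/eqP; ring.
    + move=> y [s s01 yE]; rewrite -yE; move: s01; rewrite /= in_itv /= => s01.
      by have [h1 h2] := pd s s01; exact: clean.
    + by apply: connected_continuous_connected; [apply/connected_intervalP; exact: interval_is_interval|exact: cq].
  exists 1; first by rewrite /= in_itv /= lexx ler01.
  rewrite /q /opposite_chart; congr (Some (h _)).
  by apply/eqP; rewrite eq_complex /= subrr !mul0r add0r !mul1r !eqxx.
Unshelve. all: by end_near. Qed.

(** A point of the domain off the graph has a face, whose edges form a cycle or a path, so that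
    there is one. If the graph filled the domain, a small circle around an interior point of an edge
    would lie on that edge, and its parameter would be a continuous injective function on a
    circle. *)
Lemma exists_left_face : exists e (f : face D), left_face e f.
Proof.
have [_ _ inf [oD _] [[ends rev cont [_ off inj]] sub _ cyc lf]] := ppn.
suff [x Dx] : exists x, (domain D `\` graph_image D) x.
  have fx : is_face D (connected_component (domain D `\` graph_image D) x) by exists x.
  pose f : face D := exist _ _ fx.
  suff [e fe] : face_edges f !=set0 by exists e, f.
  have [[n [w [n0 _ -> _]]]|[w [_ -> _]]] := cyc f.
    by exists (w 0%N); exists 0%N.
  by exists (w 0); exists 0.
apply: contrapT => none.
have cover x : domain D x -> graph_image D x.
  by move=> Dx; apply: contrapT => nx; apply: none; exists x.
have [v] : exists v : vertex G, True.
  apply: contrapT => nv; apply: inf; have -> : [set: vertex G] = set0; last exact: finite_set0.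
  by apply/seteqP; split=> // v _; case: nv; exists v.
move=> _; have [e _] := vertex_has_edge ppn v.
(* At most one of the parameters 1/3 and 2/3 is sent to the point at infinity. *)
have [t0 [z0 [t01 E0]]] : exists t0 (z0 : plane R), 0 < t0 < 1 /\ epos D e t0 = Some z0.
  have b1 : 0 < (1 / 3 : R) < 1 by apply/andP; split; lra.
  have b2 : 0 < (2 / 3 : R) < 1 by apply/andP; split; lra.
  case E1 : (epos D e (1 / 3)) => [z|]; first by exists (1 / 3), z.
  case E2 : (epos D e (2 / 3)) => [z|]; first by exists (2 / 3), z.
  have : 2 / 3 = 1 / 3 :> R.
    apply: (epos_inj ppn b1 _ (etrans E2 (esym E1))).
    by case/andP: b2 => /ltW -> /ltW ->.
  by lra.
have nI : nbhs t0 `]0, 1[%classic.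
  by case/andP: t01 => h1 h2; apply: open_nbhs_nbhs; split; [exact: interval_open|rewrite /= in_itv /= h1 h2].
have [eps eps0 Heps] := edge_local ppn t01 nI E0.
pose ci (t : R) : plane R := z0 + (eps / 2)%:C * cis t.
have ciE t : modulus (ci t - z0) < eps.
  rewrite /ci addrC addKr modulusM modulus_real modulus_cis mulr1 gtr0_norm ?divr_gt0 //.
  by rewrite ltr_pdivrMr // ltr_pMr // ltr1n.
have /choice [psi Hpsi] : forall t, exists s, 0 < s < 1 /\ epos D e s = Some (ci t).
  move=> t; have [Dt gt] := Heps _ (ciE t); have [s [_ s1 Es]] := gt (cover _ Dt).
  by exists s; split=> //; move: s1; rewrite /= in_itv.
have cci : continuous ci.
  move=> t; have -> : ci = fun s => (complex.Re z0 + (eps / 2) * cos s) +i* (complex.Im z0 + (eps / 2) * sin s).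
    apply/funext => s; rewrite /ci; case: (z0) => a b; apply/eqP; rewrite eq_complex /=.
    by rewrite !mul0r subr0 addr0 !eqxx.
  apply: cvg_complex; (apply: cvgD; first exact: cvg_cst); (apply: cvgM; first exact: cvg_cst).
    exact: continuous_cos.
  exact: continuous_sin.
have cpsi : continuous psi.
  move=> t W Wt; have [s01 Es] := Hpsi t.
  have [eps' eps'0 Heps'] := edge_local ppn s01 Wt Es.
  have nt : \forall y \near t, modulus (ci y - ci t) < eps'.
    by apply: (cci t [set w | modulus (w - ci t) < eps']); apply/nbhs_planeP; exists eps'.
  change (\forall y \near t, W (psi y)); apply: filterS nt => y yt.
  have [Dy gy] := Heps' _ yt; have [s [s1 Ws Es']] := gy (cover _ Dy).
  have [sy Ey] := Hpsi y.
  by rewrite -(epos_inj ppn sy s1 (etrans Es' (esym Ey))).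
(* Borsuk-Ulam in dimension one: [k] changes sign over a half turn, so two antipodal points share a
   parameter. *)
pose k t := psi t - psi (t + pi).
have ck : continuous k.
  move=> t; apply: cvgB; first exact: cpsi.
  apply: (@continuous_comp _ _ _ (fun t => t + pi) psi); last exact: cpsi.
  by apply: cvgD; [exact: cvg_id|exact: cvg_cst].
have ci2pi t : ci (t + pi + pi) = ci t.
  by rewrite /ci /cis !cosDpi !sinDpi !opprK.
have psi2 t : psi (t + pi + pi) = psi t.
  have [s1 E1] := Hpsi (t + pi + pi); have [s2 E2] := Hpsi t.
  apply: (epos_inj ppn s2 _ (etrans E1 (etrans _ (esym E2)))); last by rewrite ci2pi.
  by case/andP: s1 => /ltW -> /ltW ->.
have kpi : k (0 + pi) = - k 0 by rewrite /k psi2 opprB.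
have [t _ kt] : exists2 t, t \in `[0, pi] & k t = 0.
  apply: IVT; [exact: pi_ge0|exact: continuous_subspaceT|].
  move: kpi; rewrite add0r => ->.
  by have [h|h] := leP 0 (k 0); rewrite ge_min le_max oppr_le0 oppr_ge0 ?h ?(ltW h) ?orbT.
have Et : psi t = psi (t + pi) by apply/eqP; rewrite -subr_eq0; apply/eqP.
have [_ E1] := Hpsi t; have [_ E2] := Hpsi (t + pi).
have : ci t = ci (t + pi) by move: E1; rewrite Et E2 => -[].
have en : (eps / 2)%:C != 0 :> R[i] by rewrite eq_complex /= eqxx andbT gt_eqF // divr_gt0.
rewrite /ci => /addrI /(mulfI en) /eqP; rewrite /cis cosDpi sinDpi eq_complex /=.
move=> /andP[/eqP h1 /eqP h2]; have := cos2Dsin2 t.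
have opp0 (x : R) : x = - x -> x = 0.
  by move/eqP; rewrite -subr_eq0 opprK -mulr2n mulrn_eq0 /= => /eqP.
by rewrite (opp0 _ h1) (opp0 _ h2) expr0n /= addr0 => /eqP; rewrite eq_sym oner_eq0.
Qed.

End Faces.

(** * Combinatorics and geometry of the packing *)

Section Discs.
Variable R : realType.
Implicit Types (B : disc R) (D E : pdisc R).

Definition to_pdisc B : pdisc R :=
  PDisc (complex.Re (centre B)) (complex.Im (centre B)) (radius B).

Lemma to_pdisc_gt0 B : 0 < pr (to_pdisc B).
Proof. exact: radius_gt0. Qed.

Lemma d2_modulus B B' : d2 (to_pdisc B) (to_pdisc B') = modulus (centre B - centre B') ^+ 2.
Proof. by rewrite modulus_sqr !raddfB. Qed.

Lemma pw_modulus B (z : R[i]) :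
  pw (to_pdisc B) (complex.Re z) (complex.Im z) = modulus (z - centre B) ^+ 2 - radius B ^+ 2.
Proof. by rewrite modulus_sqr !raddfB. Qed.

Lemma closed_discE B z : closed_disc B z <-> pw (to_pdisc B) (complex.Re z) (complex.Im z) <= 0.
Proof.
rewrite pw_modulus subr_le0 ler_sqr ?nnegrE ?modulus_ge0 //; exact: ltW (radius_gt0 B).
Qed.

Lemma open_discE B z : open_disc B z <-> pw (to_pdisc B) (complex.Re z) (complex.Im z) < 0.
Proof.
rewrite pw_modulus subr_lt0 ltr_sqr ?nnegrE ?modulus_ge0 //; exact: ltW (radius_gt0 B).
Qed.

Lemma tangent_discsE B B' : tangent_discs B B' <->
  d2 (to_pdisc B) (to_pdisc B') = (pr (to_pdisc B) + pr (to_pdisc B')) ^+ 2.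
Proof.
rewrite d2_modulus; split=> [->//|/eqP].
rewrite eqrXn2 ?modulus_ge0 ?addr_ge0 ?(ltW (to_pdisc_gt0 _)) //.
by move/eqP.
Qed.

(* The point dividing the segment of centres in the ratio of the radii. *)
Lemma division_point D E : 0 < pr D -> 0 < pr E ->
  exists u v, pw D u v = pr D ^+ 2 * (d2 D E / (pr D + pr E) ^+ 2 - 1) /\
  pw E u v = pr E ^+ 2 * (d2 D E / (pr D + pr E) ^+ 2 - 1).
Proof.
case: D => x y r; case: E => x' y' s /= r0 s0; rewrite /pw /d2 /=.
have q0 : r + s != 0 by rewrite gt_eqF // addr_gt0.
exists (x + r / (r + s) * (x' - x)), (y + r / (r + s) * (y' - y)).
by split; field.
Qed.

Lemma open_discs_disjoint B B' : open_disc B `&` open_disc B' = set0 ->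
  (pr (to_pdisc B) + pr (to_pdisc B')) ^+ 2 <= d2 (to_pdisc B) (to_pdisc B').
Proof.
move=> H; rewrite leNgt; apply/negP => lt.
have r0 := to_pdisc_gt0 B; have s0 := to_pdisc_gt0 B'.
have [u [v [e1 e2]]] := division_point r0 s0.
have q0 : 0 < (pr (to_pdisc B) + pr (to_pdisc B')) ^+ 2 by rewrite exprn_gt0 // addr_gt0.
have neg : d2 (to_pdisc B) (to_pdisc B') / (pr (to_pdisc B) + pr (to_pdisc B')) ^+ 2 - 1 < 0.
  by rewrite subr_lt0 ltr_pdivrMr // mul1r.
have : (open_disc B `&` open_disc B') (u +i* v).
  split; apply/open_discE.
    by rewrite (e1 : pw _ (complex.Re (u +i* v)) (complex.Im (u +i* v)) = _) pmulr_rlt0 // exprn_gt0.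
  by rewrite (e2 : pw _ (complex.Re (u +i* v)) (complex.Im (u +i* v)) = _) pmulr_rlt0 // exprn_gt0.
by rewrite H.
Qed.

Lemma closed_discs_disjoint B B' : ~ (closed_disc B `&` closed_disc B' !=set0) ->
  (pr (to_pdisc B) + pr (to_pdisc B')) ^+ 2 < d2 (to_pdisc B) (to_pdisc B').
Proof.
move=> H; rewrite ltNge; apply/negP => le; apply: H.
have r0 := to_pdisc_gt0 B; have s0 := to_pdisc_gt0 B'.
have [u [v [e1 e2]]] := division_point r0 s0.
have q0 : 0 < (pr (to_pdisc B) + pr (to_pdisc B')) ^+ 2 by rewrite exprn_gt0 // addr_gt0.
have neg : d2 (to_pdisc B) (to_pdisc B') / (pr (to_pdisc B) + pr (to_pdisc B')) ^+ 2 - 1 <= 0.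
  by rewrite subr_le0 ler_pdivrMr // mul1r.
exists (u +i* v).
split; apply/closed_discE.
    by rewrite (e1 : pw _ (complex.Re (u +i* v)) (complex.Im (u +i* v)) = _) pmulr_rle0 // exprn_gt0.
  by rewrite (e2 : pw _ (complex.Re (u +i* v)) (complex.Im (u +i* v)) = _) pmulr_rle0 // exprn_gt0.
Qed.

Lemma right_angles_d2 B B' : meet_at_right_angles B B' ->
  d2 (to_pdisc B) (to_pdisc B') = pr (to_pdisc B) ^+ 2 + pr (to_pdisc B') ^+ 2.
Proof.
case=> [[x [Bx B'x]] orth]; have := orth x Bx B'x.
have : modulus (x - centre B) ^+ 2 = radius B ^+ 2 by rewrite Bx.
have : modulus (x - centre B') ^+ 2 = radius B' ^+ 2 by rewrite B'x.
rewrite !modulus_sqr /orthogonal_vectors /d2 /= !raddfB /=; clear; lra.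
Qed.

(** Twice a signed area; its sign tells on which side of the line of centres of [D] and [D'] the
    centre of [E] lies. *)
Definition cross D D' E : R :=
  (px E - px D) * (py D' - py D) - (py E - py D) * (px D' - px D).

(* The discs orthogonal to two tangent discs pass through the point of tangency
   and have their centres on the common tangent line. *)
Lemma orthogonal_to_tangent_pair D D' E E' : 0 < pr D -> 0 < pr D' ->
  d2 D D' = (pr D + pr D') ^+ 2 ->
  d2 D E = pr D ^+ 2 + pr E ^+ 2 -> d2 D' E = pr D' ^+ 2 + pr E ^+ 2 ->
  d2 D E' = pr D ^+ 2 + pr E' ^+ 2 -> d2 D' E' = pr D' ^+ 2 + pr E' ^+ 2 ->
  cross D D' E ^+ 2 = pr E ^+ 2 * (pr D + pr D') ^+ 2 /\
  d2 E E' * (pr D + pr D') ^+ 2 = (cross D D' E - cross D D' E') ^+ 2.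
Proof.
move=> r0 r'0 T O1 O2 O3 O4.
have h1 := tangent_point_on_circle r0 r'0 T.
have h2 := tangent_point_orthogonal r0 r'0 T.
have h1' := tangent_point_on_circle_r r0 r'0 T.
set u := _ / _ in h1 h2 h1'; set v := _ / _ in h1 h2 h1'.
have [a [b [ab [e1 e2 e3 e4]]]] := tangent_direction r0 r'0 T h1 h1'.
have line F : d2 D F = pr D ^+ 2 + pr F ^+ 2 -> d2 D' F = pr D' ^+ 2 + pr F ^+ 2 ->
    exists l, [/\ px F = u - l * b, py F = v + l * a & l ^+ 2 = pr F ^+ 2].
  move=> O O'; have pF := h2 F O O'.
  have dot : (px F - u) * a + (py F - v) * b = 0.
    have : 2 * pr D * ((px F - u) * a + (py F - v) * b) = 0.
      move: O pF; rewrite /d2 /pw e1 e2 => O pF.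
      transitivity (((u - pr D * a - px F) ^+ 2 + (v - pr D * b - py F) ^+ 2 - (pr D ^+ 2 + pr F ^+ 2))
        - ((u - px F) ^+ 2 + (v - py F) ^+ 2 - pr F ^+ 2) + pr D ^+ 2 * (1 - (a ^+ 2 + b ^+ 2))); first by ring.
      by rewrite O pF ab; ring.
    by move/eqP; rewrite mulf_eq0 gt_eqF ?mulr_gt0 //=; exact: eqP.
  exists ((py F - v) * a - (px F - u) * b); split.
  - transitivity (u + (px F - u) * (a ^+ 2 + b ^+ 2) - a * ((px F - u) * a + (py F - v) * b)).
      by rewrite ab dot; ring.
    by ring.
  - transitivity (v + (py F - v) * (a ^+ 2 + b ^+ 2) - b * ((px F - u) * a + (py F - v) * b)).
      by rewrite ab dot; ring.
    by ring.
  - transitivity (((px F - u) ^+ 2 + (py F - v) ^+ 2) * (a ^+ 2 + b ^+ 2) - ((px F - u) * a + (py F - v) * b) ^+ 2).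
      by ring.
    by rewrite ab dot; move: pF; rewrite /pw; clear; lra.
have [l [f1 f2 f3]] := line E O1 O2; have [l' [f1' f2' f3']] := line E' O3 O4.
have cr F m : px F = u - m * b -> py F = v + m * a -> cross D D' F = - m * (pr D + pr D').
  move=> g1 g2; rewrite /cross g1 g2 e1 e2 e3 e4.
  transitivity (- m * (pr D + pr D') * (a ^+ 2 + b ^+ 2)); first by ring.
  by rewrite ab mulr1.
rewrite (cr E l) // (cr E' l') // -f3; split; first by ring.
rewrite /d2 f1 f2 f1' f2'.
transitivity ((l - l') ^+ 2 * (a ^+ 2 + b ^+ 2) * (pr D + pr D') ^+ 2); first by ring.
by rewrite ab; ring.
Qed.

(** Both circles pass through the point of tangency with centres on the common tangent. On the same
    side of it the centres are at distance [|s - s'|], for radii [s] and [s'], and the discs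
    overlap. So an edge has at most one face on each side. *)
Lemma tangent_same_side D D' E E' : 0 < pr D -> 0 < pr D' -> 0 < pr E -> 0 < pr E' ->
  d2 D D' = (pr D + pr D') ^+ 2 ->
  d2 D E = pr D ^+ 2 + pr E ^+ 2 -> d2 D' E = pr D' ^+ 2 + pr E ^+ 2 ->
  d2 D E' = pr D ^+ 2 + pr E' ^+ 2 -> d2 D' E' = pr D' ^+ 2 + pr E' ^+ 2 ->
  (pr E + pr E') ^+ 2 <= d2 E E' -> (0 < cross D D' E) = (0 < cross D D' E') -> False.
Proof.
move=> r0 r'0 s0 s'0 T O1 O2 O3 O4 dis sg.
have [c1 dd] := orthogonal_to_tangent_pair r0 r'0 T O1 O2 O3 O4.
have [c2 _] := orthogonal_to_tangent_pair r0 r'0 T O3 O4 O1 O2.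
set q := pr D + pr D' in c1 c2 dd.
have q0 : 0 < q by rewrite addr_gt0.
set c := cross D D' E in c1 dd sg; set c' := cross D D' E' in c2 dd sg.
have val x s : 0 < s -> x ^+ 2 = s ^+ 2 * q ^+ 2 -> x = if 0 < x then s * q else - (s * q).
  move=> sp; rewrite -exprMn => /eqP; rewrite eqf_sqr => /orP[] /eqP ->.
    by rewrite mulr_gt0.
  by rewrite oppr_gt0 ltNge ltW // mulr_gt0.
have cE := val _ _ s0 c1; have c'E := val _ _ s'0 c2.
have : (c - c') ^+ 2 = (pr E - pr E') ^+ 2 * q ^+ 2.
  by rewrite cE c'E sg; case: ifP => _; ring.
rewrite -dd => h.
have : (pr E + pr E') ^+ 2 * q ^+ 2 <= (pr E - pr E') ^+ 2 * q ^+ 2.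
  by rewrite -h ler_pM2r // exprn_gt0.
rewrite ler_pM2r ?exprn_gt0 // => k; have := mulr_gt0 s0 s'0; move: k; clear; lra.
Qed.

(** Two discs touching [D] from outside at the same point would be nested, with centres at distance
    the difference of their radii. *)
Lemma tangent_points_distinct D D1 D2 u v : 0 < pr D -> 0 < pr D1 -> 0 < pr D2 ->
  d2 D D1 = (pr D + pr D1) ^+ 2 -> d2 D D2 = (pr D + pr D2) ^+ 2 ->
  (pr D1 + pr D2) ^+ 2 <= d2 D1 D2 ->
  pw D u v = 0 -> pw D1 u v = 0 -> pw D2 u v = 0 -> False.
Proof.
move=> r0 r1 r2 T1 T2 dis p0 p1 p2.
have [a [b [ab [e1 e2 e3 e4]]]] := tangent_direction r0 r1 T1 p0 p1.
have [a' [b' [ab' [f1 f2 f3 f4]]]] := tangent_direction r0 r2 T2 p0 p2.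
have rn : pr D != 0 by rewrite gt_eqF.
have aa : a = a'.
  by apply: (mulfI rn); move: e1; rewrite f1 => /addrI /oppr_inj ->.
have bb : b = b'.
  by apply: (mulfI rn); move: e2; rewrite f2 => /addrI /oppr_inj ->.
move: dis; rewrite /d2 e3 e4 f3 f4 -aa -bb.
have -> : (u + pr D1 * a - (u + pr D2 * a)) ^+ 2 + (v + pr D1 * b - (v + pr D2 * b)) ^+ 2 =
  (pr D1 - pr D2) ^+ 2 * (a ^+ 2 + b ^+ 2) by ring.
rewrite ab mulr1; have := mulr_gt0 r1 r2; clear; lra.
Qed.

End Discs.

(** * Incidences in the packing and the covering of its circles *)

Section Packing.
Variables (R : realType) (G : network R) (D : drawing G).
Variables (P : vertex G -> disc R) (Pd : face D -> disc R) (N : nat).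
Hypothesis ppn : proper_plane_network D.
Hypothesis simple : simple_graph G.
Hypothesis dcp : double_circle_packing P Pd.
Hypothesis degN : forall v : vertex G, (size (edges_from v) <= N)%N.
Hypothesis codegN : forall f : face D, (codegree f <= N%:R%:E)%E.

Local Notation A v := (to_pdisc (P v)).
Local Notation B f := (to_pdisc (Pd f)).
Local Notation inc v f := (@incident R G D f v).
Local Notation left_face e f := (@left_face R G D e f).

Let lfin : locally_finite G. Proof. by case: ppn. Qed.

Lemma vertex_discs_disjoint u v : u <> v -> (pr (A u) + pr (A v)) ^+ 2 <= d2 (A u) (A v).
Proof. by case: dcp => H _ _ _ _ /H; exact: open_discs_disjoint. Qed.

Lemma face_discs_disjoint f g : f <> g -> (pr (B f) + pr (B g)) ^+ 2 <= d2 (B f) (B g).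
Proof. by case: dcp => _ H _ _ _ /H; exact: open_discs_disjoint. Qed.

Lemma incident_orthogonal v f : inc v f -> d2 (A v) (B f) = pr (A v) ^+ 2 + pr (B f) ^+ 2.
Proof. by case: dcp => _ _ _ _ H /(H v f).2; exact: right_angles_d2. Qed.

Lemma not_incident_disjoint v f : ~ inc v f -> (pr (A v) + pr (B f)) ^+ 2 < d2 (A v) (B f).
Proof.
by case: dcp => _ _ _ _ H nvf; apply: closed_discs_disjoint; rewrite (propext (H v f).1).
Qed.

Lemma meet_incident v f x y : pw (A v) x y <= 0 -> pw (B f) x y <= 0 -> inc v f.
Proof.
case: dcp => _ _ _ _ H h1 h2; apply: (H v f).1.1; exists (x +i* y).
by split; apply/closed_discE.
Qed.

Lemma adjacent_tangent u v : adjacent u v -> d2 (A u) (A v) = (pr (A u) + pr (A v)) ^+ 2.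
Proof. by case: dcp => _ _ H _ _ uv; apply/tangent_discsE/H. Qed.

Lemma edge_tangent e : d2 (A (osrc e)) (A (otgt e)) = (pr (A (osrc e)) + pr (A (otgt e))) ^+ 2.
Proof. by apply: adjacent_tangent; exists e. Qed.

Lemma dual_tangent e f g : left_face e f -> left_face (orev e) g ->
  d2 (B f) (B g) = (pr (B f) + pr (B g)) ^+ 2.
Proof. by case: dcp => _ _ _ H _ ef eg; apply/tangent_discsE/H; exists e. Qed.

Lemma left_face_neq e f g : left_face e f -> left_face (orev e) g -> f <> g.
Proof.
move=> ef eg fg; have := dual_tangent ef eg; rewrite -fg.
have -> : d2 (B f) (B f) = 0 by rewrite /d2 !subrr expr0n addr0.
by move/eqP; rewrite eq_sym expf_eq0 /= gt_eqF // addr_gt0 ?to_pdisc_gt0.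
Qed.

Lemma otgt_orev e : otgt (orev e : oedge G) = osrc e.
Proof. by rewrite /otgt orevK. Qed.

(** A bi-infinite path would have more than [N] distinct edges, so bounded codegree leaves only
    cycles, of length at most [N]. *)
Lemma face_cycle (f : face D) : exists (n : nat) (w : nat -> oedge G),
  [/\ (0 < n <= N)%N, forall i, (i < n)%N -> left_face (w i) f,
    forall e, left_face e f -> exists2 i, (i < n)%N & e = w i &
    forall i, (i < n)%N -> otgt (w i) = osrc (w (i.+1 %% n)%N)].
Proof.
have [_ _ _ _ [_ _ _ cyc _]] := ppn.
have fin : finite_set (face_edges f).
  apply: contrapT => inf; have := codegN f.
  by rewrite /codegree /counting (asboolF inf) // leye_eq.
have cardN k (w : nat -> oedge G) : (forall i, (i < k)%N -> left_face (w i) f) ->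
    set_inj `I_k w -> (k <= N)%N.
  move=> wf wi; have := codegN f; rewrite /codegree /counting (asboolT fin) lee_fin ler_nat.
  apply: leq_trans.
  pose s := [seq w i | i <- iota 0 k].
  have us : uniq s.
    rewrite map_inj_in_uniq ?iota_uniq // => i j; rewrite !mem_iota /= => ik jk.
    by apply: wi; rewrite inE.
  have := @uniq_leq_size _ s (finmap.enum_fset (fset_set (face_edges f))) us.
  rewrite size_map size_iota; apply => e /mapP[j]; rewrite mem_iota /= add0n => jk ->.
  by have := in_fset_set fin (w j) => ->; rewrite inE; exact: wf.
have [[n [w [n0 wi wA wc]]]|[w [wi wA _]]] := cyc f.
  have wf i : (i < n)%N -> left_face (w i) f.
    by move=> i_n; have : face_edges f (w i) by rewrite wA; exists i.
  exists n, w; split => //.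
  - by rewrite n0 (cardN n w).
  - by move=> e ef; have : face_edges f e by []; rewrite wA => -[i /= i_n <-]; exists i.
exfalso; have : (N.+1 <= N)%N; last by rewrite ltnn.
apply: (cardN N.+1 (fun i => w i%:Z)).
- by move=> i _; have : face_edges f (w i%:Z) by rewrite wA; exists i%:Z.
- by move=> i j _ _ /wi [].
Qed.

(** The next edge of the cycle does not turn back: by simplicity it would be [orev e], with [f] on
    both sides of [e], and the disc of [f] would be tangent to itself. *)
Lemma left_face_next e f : left_face e f ->
  exists e', [/\ left_face e' f, osrc e' = otgt e & otgt e' <> osrc e].
Proof.
move=> ef; have [n [w [/andP[n0 _] wf fw wc]]] := face_cycle f.
have [i i_n eE] := fw e ef.
have jn : (i.+1 %% n < n)%N by rewrite ltn_mod.
exists (w (i.+1 %% n)%N); split; [exact: wf|by rewrite eE wc|].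
move=> back; have er : w (i.+1 %% n)%N = orev e.
  by apply: simple.2; [rewrite -wc // -eE|rewrite otgt_orev].
by apply: (left_face_neq ef _ erefl); rewrite -er; exact: wf.
Qed.

Lemma left_face_prev e f : left_face e f ->
  exists e', [/\ left_face e' f, otgt e' = osrc e & osrc e' <> otgt e].
Proof.
move=> ef; have [n [w [/andP[n0 _] wf fw wc]]] := face_cycle f.
have [i i_n eE] := fw e ef.
pose j := ((i + n.-1) %% n)%N.
have jn : (j < n)%N by rewrite ltn_mod.
have ji : (j.+1 %% n)%N = i.
  by rewrite /j -addn1 modnDml addn1 -addnS prednK // modnDr modn_small.
exists (w j); split; [exact: wf|by rewrite eE wc // ji|].
move=> back; have er : w j = orev e.
  by apply: simple.2; [rewrite back|rewrite otgt_orev eE wc // ji].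
by apply: (left_face_neq ef _ erefl); rewrite -er; exact: wf.
Qed.

Lemma left_face_incident e f : left_face e f -> inc (osrc e) f /\ inc (otgt e) f.
Proof. by move=> ef; split; exists e => //; [left|right]. Qed.

Lemma incident_edges v f : inc v f -> exists e1 e2,
  [/\ osrc e1 = v, osrc e2 = v, otgt e1 <> otgt e2,
     left_face e1 f \/ left_face (orev e1) f & left_face e2 f \/ left_face (orev e2) f].
Proof.
case=> e ef [ev|ev].
  have [e' [e'f e1 e2]] := left_face_prev ef.
  exists e, (orev e'); split => //.
  - by rewrite -ev.
  - by rewrite otgt_orev => h; apply: e2.
  - by left.
  - by right; rewrite orevK.
have [e' [e'f e1 e2]] := left_face_next ef.
exists (orev e), e'; split => //.
- by rewrite e1.
- by rewrite otgt_orev => h; apply: e2.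
- by right; rewrite orevK.
- by left.
Qed.

Lemma edge_quad e f : left_face e f \/ left_face (orev e) f ->
  [/\ inc (osrc e) f, inc (otgt e) f & exists g,
    [/\ inc (osrc e) g, inc (otgt e) g & d2 (B f) (B g) = (pr (B f) + pr (B g)) ^+ 2]].
Proof.
case=> ef.
  have [i1 i2] := left_face_incident ef; have [g eg] := left_face_opposite ppn ef.
  have [j1 j2] := left_face_incident eg; rewrite otgt_orev in j2.
  by split=> //; exists g; split=> //; exact: dual_tangent ef eg.
have [i1 i2] := left_face_incident ef; rewrite otgt_orev in i2.
have [g eg] := left_face_opposite ppn ef; rewrite orevK in eg.
have [j1 j2] := left_face_incident eg.
split=> //; exists g; split=> //.
by apply: (@dual_tangent (orev e)) => //; rewrite orevK.
Qed.

(** The circles of [P v] and [Pd f] meet in just two points, and two edges of [f] at [v] already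
    provide two: the points of tangency of the discs at their ends. So [(x, y)] is the point of
    tangency along one of these edges; [u] is its other end and [g] the face across it. *)
Lemma incident_quad v f x y : inc v f -> pw (A v) x y = 0 -> pw (B f) x y = 0 ->
  exists u g, [/\ inc u f, inc v g, inc u g &
    [/\ d2 (A v) (A u) = (pr (A v) + pr (A u)) ^+ 2,
        d2 (B f) (B g) = (pr (B f) + pr (B g)) ^+ 2,
        pw (A u) x y = 0 & pw (B g) x y = 0]].
Proof.
move=> vf pA pB; have [e1 [e2 [s1 s2 ne q1 q2]]] := incident_edges vf.
have r0 w : 0 < pr (A w) by exact: to_pdisc_gt0.
pose pt e := (((pr (A (otgt e)) * px (A (osrc e)) + pr (A (osrc e)) * px (A (otgt e))) / (pr (A (osrc e)) + pr (A (otgt e)))),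
  ((pr (A (otgt e)) * py (A (osrc e)) + pr (A (osrc e)) * py (A (otgt e))) / (pr (A (osrc e)) + pr (A (otgt e))))).
have ptB e g : inc (osrc e) g -> inc (otgt e) g -> pw (B g) (pt e).1 (pt e).2 = 0.
  move=> h1 h2; apply: tangent_point_orthogonal => //; [exact: edge_tangent| |]; exact: incident_orthogonal.
have ptS e : pw (A (osrc e)) (pt e).1 (pt e).2 = 0.
  by apply: tangent_point_on_circle => //; exact: edge_tangent.
have ptT e : pw (A (otgt e)) (pt e).1 (pt e).2 = 0.
  by apply: tangent_point_on_circle_r => //; exact: edge_tangent.
have fin e : osrc e = v -> left_face e f \/ left_face (orev e) f -> (x, y) = pt e ->
    exists u g, [/\ inc u f, inc v g, inc u g &
    [/\ d2 (A v) (A u) = (pr (A v) + pr (A u)) ^+ 2,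
        d2 (B f) (B g) = (pr (B f) + pr (B g)) ^+ 2,
        pw (A u) x y = 0 & pw (B g) x y = 0]].
  move=> ev ef xy; have [h1 h2 [g [h3 h4 h5]]] := edge_quad ef.
  exists (otgt e), g; split => //; first by rewrite -ev.
  split => //.
  - by rewrite -ev; exact: edge_tangent.
  - by rewrite (congr1 fst xy : x = _) (congr1 snd xy : y = _).
  - by rewrite (congr1 fst xy : x = _) (congr1 snd xy : y = _); exact: ptB.
have [i1 i1' _] := edge_quad q1; have [i2 i2' _] := edge_quad q2.
have dist : ((pt e1).1, (pt e1).2) <> ((pt e2).1, (pt e2).2).
  move=> E; have E1 : (pt e1).1 = (pt e2).1 := congr1 fst E.
  have E2 : (pt e1).2 = (pt e2).2 := congr1 snd E.
  apply: (@tangent_points_distinct _ (A v) (A (otgt e1)) (A (otgt e2)) (pt e1).1 (pt e1).2) => //.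
  - by rewrite -s1; exact: edge_tangent.
  - by rewrite -s2; exact: edge_tangent.
  - exact: vertex_discs_disjoint.
  - by rewrite -s1; exact: ptS.
  - by rewrite E1 E2; exact: ptT.
have dAB : 0 < d2 (A v) (B f).
  by rewrite incident_orthogonal // addr_gt0 // exprn_gt0 // to_pdisc_gt0.
have pA1 : pw (A v) (pt e1).1 (pt e1).2 = 0 by rewrite -s1; exact: ptS.
have pA2 : pw (A v) (pt e2).1 (pt e2).2 = 0 by rewrite -s2; exact: ptS.
case: (circles_meet_twice dAB pA1 (ptB _ _ i1 i1') pA2 (ptB _ _ i2 i2') pA pB dist) => xy.
  by apply: (fin e1) => //; rewrite xy; case: (pt e1).
by apply: (fin e2) => //; rewrite xy; case: (pt e2).
Qed.

(** The bound [N + N] is that of [vertex_faces], as [bipacking] has a single bound for both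
    families. *)
Lemma face_vertices f : exists F : nat -> vertex G, forall v, inc v f -> exists k : 'I_(N + N), F k = v.
Proof.
have [n [w [/andP[n0 nN] wf fw wc]]] := face_cycle f.
exists (fun k => osrc (w k)) => v [e ef [ev|ev]].
  have [i i_n eE] := fw e ef.
  have h : (i < N + N)%N by apply: leq_trans i_n (leq_trans nN (leq_addr _ _)).
  by exists (Ordinal h); rewrite /= -eE.
have [i i_n eE] := fw e ef.
have h : (i.+1 %% n < N + N)%N by apply: leq_trans (leq_trans nN (leq_addr _ _)); rewrite ltn_mod.
by exists (Ordinal h); rewrite /= -wc // -eE.
Qed.

(* A face at [v] is determined by an edge at [v] and a side of it. *)
Lemma vertex_faces v f0 : inc v f0 -> exists F : nat -> face D,
  forall f, inc v f -> exists k : 'I_(N + N), F k = f.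
Proof.
move=> vf0; have [e0 [_ [s0 _ _ _ _]]] := incident_edges vf0.
(* An index encodes an edge at [v] by its half and a side of that edge by its parity. *)
pose ed k := nth e0 (edges_from v) k./2.
pose side k f := inc v f /\ inc (otgt (ed k)) f /\
  (0 < cross (A v) (A (otgt (ed k))) (B f)) = odd k.
(* The default [f0] serves for sides without a face. *)
have [F HF] : exists F : nat -> face D, forall k f, side k f -> side k (F k).
  have /choice [F HF] : forall k, exists g, forall f, side k f -> side k g.
    move=> k; have [[g Hg]|none] := pselect (exists g, side k g); first by exists g.
    by exists f0 => f Hf; case: none; exists f.
  by exists F.
exists F => f vf; have [e1 [_ [s1 _ _ q1 _]]] := incident_edges vf.
have [i1 i1' _] := edge_quad q1.
have e1in : e1 \in edges_from v by rewrite mem_edges_from // s1.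
set i := index e1 (edges_from v).
have iN : (i < N)%N by apply: leq_trans (degN v); rewrite index_mem.
pose b := 0 < cross (A v) (A (otgt e1)) (B f).
pose k := (b + i.*2)%N.
have kN : (k < N + N)%N by rewrite /k addnn; case: (b); rewrite ?add1n ?add0n ?ltn_Sdouble ?ltn_double.
have kh : k./2 = i by rewrite /k half_bit_double.
have ko : odd k = b by rewrite /k oddD odd_double addbF oddb.
have edk : ed k = e1 by rewrite /ed kh nth_index.
have sf : side k f by rewrite /side edk ko.
have [h1 [h2 h3]] := HF k f sf.
exists (Ordinal kN) => /=; apply: contrapT => ne.
have [g1 [g2 g3]] := sf.
have tg : d2 (A v) (A (otgt (ed k))) = (pr (A v) + pr (A (otgt (ed k)))) ^+ 2.
  by rewrite edk -s1; exact: edge_tangent.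
apply: (@tangent_same_side _ (A v) (A (otgt (ed k))) (B (F k)) (B f)); rewrite ?to_pdisc_gt0 ?h3 ?g3 //;
  try exact: incident_orthogonal.
exact: face_discs_disjoint.
Qed.

Lemma vertex_circle_covered v f0 : inc v f0 -> exists F : nat -> face D, forall x y,
  pw (A v) x y = 0 -> exists k : 'I_(N + N), inc v (F k) /\ pw (B (F k)) x y <= 0.
Proof.
move=> vf0; have [F HF] := vertex_faces vf0; exists F.
apply: (@circle_cover _ (A v) _ (fun k : 'I_(N + N) => B (F k)) (fun k => inc v (F k))).
- exact: to_pdisc_gt0.
- by move=> k vk; split; [exact: to_pdisc_gt0|exact: incident_orthogonal].
- move=> k x y vk pA pB; have [u [g [_ vg _ [_ T _ pg]]]] := incident_quad vk pA pB.
  by have [k' kg] := HF g vg; exists k'; rewrite kg.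
- by have [k kf] := HF f0 vf0; exists k; rewrite kf.
Qed.

Lemma face_circle_covered f : exists F : nat -> vertex G, forall x y,
  pw (B f) x y = 0 -> exists k : 'I_(N + N), inc (F k) f /\ pw (A (F k)) x y <= 0.
Proof.
have [F HF] := face_vertices f; exists F.
apply: (@circle_cover _ (B f) _ (fun k : 'I_(N + N) => A (F k)) (fun k => inc (F k) f)).
- exact: to_pdisc_gt0.
- move=> k vk; split; first exact: to_pdisc_gt0.
  by rewrite d2C incident_orthogonal // addrC.
- move=> k x y vk pB pA; have [u [g [uf _ _ [T _ pu _]]]] := incident_quad vk pA pB.
  by have [k' ku] := HF u uf; exists k'; rewrite ku.
- have [n [w [/andP[n0 _] wf _ _]]] := face_cycle f.
  have [i _] := left_face_incident (wf 0%N n0).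
  by have [k kf] := HF _ i; exists k; rewrite kf.
Qed.

(** [vertex_circle_covered] needs one incident face to start with. Given a face at one end of an
    edge, the circle there is covered, in particular the point of tangency with the disc at the
    other end; the face disc covering this point meets both discs. Connectedness then carries the
    property from one edge with a left face to all vertices. *)
Lemma vertex_has_face v : exists f, inc v f.
Proof.
have [_ conn _ _ _] := ppn.
have [e [f ef]] := exists_left_face ppn.
have step e' : (exists g, inc (osrc e') g) -> exists g, inc (otgt e') g.
  move=> [g vg]; have [F HF] := vertex_circle_covered vg.
  have r0 w : 0 < pr (A w) by exact: to_pdisc_gt0.
  have T := edge_tangent e'.
  have pS := tangent_point_on_circle (r0 _) (r0 _) T.
  have pT := tangent_point_on_circle_r (r0 _) (r0 _) T.
  have [k [vk pk]] := HF _ _ pS; exists (F k).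
  by apply: meet_incident pk; rewrite pT.
have [n] := conn (osrc e) v I I.
have : exists g, inc (osrc e) g by exists f; have [] := left_face_incident ef.
elim: n (osrc e) => [|n IH] u uf /=; first by case=> _ <-.
by case=> _ [e' e'u]; apply: IH; apply: step; rewrite e'u.
Qed.

Lemma packing_bipacking : bipacking (fun v => A v) (fun f => B f) (fun v f => inc v f) (N + N).
Proof.
split.
- by move=> v; exact: to_pdisc_gt0.
- by move=> f; exact: to_pdisc_gt0.
- exact: vertex_discs_disjoint.
- exact: face_discs_disjoint.
- exact: incident_orthogonal.
- exact: not_incident_disjoint.
- by move=> v; have [f vf] := vertex_has_face v; exact: vertex_circle_covered vf.
- exact: face_circle_covered.
Qed.

End Packing.

(** * Distance of a disc to the unit circle *)

Section BoundaryGap.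
Variable R : realType.

Lemma norm2_ge_dot (x y a b : R) : a ^+ 2 + b ^+ 2 = 1 -> x * a + y * b <= norm2 x y.
Proof.
move=> ab; apply: le_trans (ler_norm _) _.
rewrite -sqrtr_sqr ler_wsqrtr //.
have -> : x ^+ 2 + y ^+ 2 = (x * a + y * b) ^+ 2 + (x * b - y * a) ^+ 2.
  by rewrite -[LHS]mulr1 -ab; ring.
by rewrite lerDl sqr_ge0.
Qed.

Lemma unit_direction (x y : R) : exists a b, a ^+ 2 + b ^+ 2 = 1 /\ (x = norm2 x y * a /\ y = norm2 x y * b).
Proof.
have [n0|n0] := eqVneq (norm2 x y) 0.
  exists 1, 0; rewrite expr1n expr0n addr0; split=> //; rewrite n0 !mul0r.
  have : x ^+ 2 + y ^+ 2 = 0.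
    by rewrite -(@sqr_sqrtr _ (x ^+ 2 + y ^+ 2)) ?addr_ge0 ?sqr_ge0 // -/(norm2 x y) n0 expr0n.
  by move/eqP; rewrite paddr_eq0 ?sqr_ge0 // !sqrf_eq0 => /andP[/eqP -> /eqP ->].
exists (x / norm2 x y), (y / norm2 x y); split; last by split; field.
have s : norm2 x y ^+ 2 = x ^+ 2 + y ^+ 2 by rewrite sqr_sqrtr // addr_ge0 ?sqr_ge0.
transitivity ((x ^+ 2 + y ^+ 2) / norm2 x y ^+ 2); first by field.
by rewrite s divff // -s expf_neq0.
Qed.

(* The orthogonal disc covering the point of a disc farthest from 0 has its
   centre at least as far from 0 as this point. *)
Lemma boundary_gap (I J : Type) (A : I -> pdisc R) (B : J -> pdisc R) inc N i :
  bipacking A B inc N -> (forall j, norm2 (px (B j)) (py (B j)) + pr (B j) < 1) ->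
  pr (A i) <= ring_bound R N * (1 - norm2 (px (A i)) (py (A i)) - pr (A i)).
Proof.
move=> bp ins; have r0 := bp_pos1 bp i.
have [a [b [ab [xa yb]]]] := unit_direction (px (A i)) (py (A i)).
set x := px (A i) in xa *; set y := py (A i) in yb *; set r := pr (A i) in r0 *.
set n := norm2 x y in xa yb *.
have [F HF] := bp_cover1 bp i.
have [] := HF (x + r * a) (y + r * b).
  rewrite /pw -/x -/y -/r; transitivity (r ^+ 2 * (a ^+ 2 + b ^+ 2) - r ^+ 2); first by ring.
  by rewrite ab; ring.
move=> k [ik pk]; set j := F k in ik pk.
apply: le_trans (ring_lemma bp ik) _; rewrite ler_pM2l ?ring_bound_gt0 //.
have := bp_inc bp ik; have := ins j; move: pk; rewrite /d2 /pw -/x -/y -/r.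
set x' := px (B j); set y' := py (B j); set s := pr (B j) => pk insj O.
have dot : n + r <= x' * a + y' * b.
  have e : x * a + y * b = n.
    by rewrite {1}xa {1}yb -[RHS]mulr1 -ab; ring.
  have : 0 <= 2 * r * (x' * a + y' * b - n - r).
    have -> : 2 * r * (x' * a + y' * b - n - r) =
       ((x - x') ^+ 2 + (y - y') ^+ 2) - r ^+ 2 - ((x + r * a - x') ^+ 2 + (y + r * b - y') ^+ 2)
       + 2 * r ^+ 2 * (a ^+ 2 + b ^+ 2 - 1) + 2 * r * (x * a + y * b - n) - r ^+ 2 * (a ^+ 2 + b ^+ 2 - 1).
      by ring.
    by rewrite O ab e !subrr !mulr0; move: pk; clear; lra.
  by rewrite pmulr_rge0 ?mulr_gt0 //; clear; lra.
have := norm2_ge_dot x' y' ab; move: dot insj; clear; lra.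
Qed.

End BoundaryGap.

(** * Size estimates and local finiteness of a packing in the unit disc *)

Section PackingInDisc.
Variables (R : realType) (G : network R) (D : drawing G).
Variables (P : vertex G -> disc R) (Pd : face D -> disc R) (N : nat).
Hypothesis ppn : proper_plane_network D.
Hypothesis simple : simple_graph G.
Hypothesis dcp : double_circle_packing P Pd.
Hypothesis pud : packing_in_unit_disc P Pd.
Hypothesis degN : forall v : vertex G, (size (edges_from v) <= N)%N.
Hypothesis codegN : forall f : face D, (codegree f <= N%:R%:E)%E.

Local Notation A v := (to_pdisc (P v)).
Local Notation B f := (to_pdisc (Pd f)).
Local Notation inc v f := (@incident R G D f v).
Local Notation r v := (radius (P v)).
Local Notation z v := (centre (P v)).

Let lfin : locally_finite G. Proof. by case: ppn. Qed.
Let bp : bipacking (fun v => A v) (fun f => B f) (fun v f => inc v f) (N + N).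
Proof. exact: packing_bipacking. Qed.
Let bpd := bipacking_dual bp.

Definition ring_constant : R := ring_bound R (N + N) + 1.
Local Notation K := ring_constant.

Lemma ring_constant_ge1 : 1 <= K.
Proof. by rewrite lerDr ltW // ring_bound_gt0. Qed.

Let K0 : 0 < K. Proof. exact: lt_le_trans ltr01 ring_constant_ge1. Qed.

Lemma ring_bound_le (x y : R) : 0 <= y -> x <= ring_bound R (N + N) * y -> x <= K * y.
Proof. by move=> y0 /le_trans; apply; rewrite ler_wpM2r // lerDl. Qed.

Lemma vertex_face_radius v f : inc v f -> r v <= K * radius (Pd f).
Proof.
by move=> vf; apply: ring_bound_le; [exact: ltW (radius_gt0 _)|exact: (ring_lemma bp vf)].
Qed.

Lemma face_vertex_radius v f : inc v f -> radius (Pd f) <= K * r v.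
Proof.
by move=> vf; apply: ring_bound_le; [exact: ltW (radius_gt0 _)|exact: (ring_lemma bpd vf)].
Qed.

(** The face disc covering the point of tangency on the circle of [P u] also meets [P v]. *)
Lemma adjacent_common_face u v : adjacent u v -> exists f, inc u f /\ inc v f.
Proof.
move=> uv; have T := adjacent_tangent dcp uv.
have p0 w : 0 < pr (A w) by exact: to_pdisc_gt0.
have pu := tangent_point_on_circle (p0 _) (p0 _) T.
have pv := tangent_point_on_circle_r (p0 _) (p0 _) T.
have [F HF] := bp_cover1 bp u; have [k [uk pk]] := HF _ _ pu.
by exists (F k); split=> //; apply: (meet_incident dcp _ pk); rewrite pv.
Qed.

Lemma adjacent_radius u v : adjacent u v -> r u <= K ^+ 2 * r v.
Proof.
move=> /adjacent_common_face [f [uf vf]]; apply: le_trans (vertex_face_radius uf) _.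
by rewrite expr2 -mulrA ler_pM2l //; exact: face_vertex_radius.
Qed.

Lemma closed_disc_in_unit_disc (Q : disc R) : closed_disc Q `<=` @unit_disc R ->
  modulus (centre Q) + radius Q < 1.
Proof.
move=> sub; have [a [b [ab [xa yb]]]] := unit_direction (complex.Re (centre Q)) (complex.Im (centre Q)).
rewrite -modulusE in xa yb; set n := modulus (centre Q) in xa yb *.
have r0 := radius_gt0 Q.
pose w : R[i] := ((n + radius Q) * a) +i* ((n + radius Q) * b).
have nm (m : R) : 0 <= m -> modulus ((m * a) +i* (m * b)) = m.
  move=> m0; rewrite modulusE /norm2 /=.
  have -> : (m * a) ^+ 2 + (m * b) ^+ 2 = m ^+ 2 * (a ^+ 2 + b ^+ 2) by ring.
  by rewrite ab mulr1 sqrtr_sqr ger0_norm.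
have : closed_disc Q w.
  rewrite /closed_disc /=.
  have -> : w - centre Q = (radius Q * a) +i* (radius Q * b).
    apply/eqP; rewrite eq_complex !raddfB /= xa yb; apply/andP; split; apply/eqP; ring.
  by rewrite nm // ltW.
have nw : modulus w = n + radius Q by apply: nm; rewrite addr_ge0 ?modulus_ge0 // ltW.
by move/sub => h; have : modulus w < 1 := h; rewrite nw.
Qed.

Lemma vertex_disc_in_unit_disc v : modulus (z v) + r v < 1.
Proof.
by apply: closed_disc_in_unit_disc => x Hx; rewrite -pud; left; exists v.
Qed.

Lemma face_disc_in_unit_disc f : modulus (centre (Pd f)) + radius (Pd f) < 1.
Proof.
by apply: closed_disc_in_unit_disc => x Hx; rewrite -pud; right; exists f.
Qed.

Lemma vertex_boundary_gap v : r v <= K * (1 - modulus (z v) - r v).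
Proof.
apply: ring_bound_le.
  by have := vertex_disc_in_unit_disc v; rewrite -subr_gt0 opprD addrA => /ltW.
by rewrite modulusE; apply: (@boundary_gap _ _ _ _ _ _ _ v bp) => f; rewrite -modulusE; exact: face_disc_in_unit_disc.
Qed.

Lemma face_boundary_gap f : radius (Pd f) <= K * (1 - modulus (centre (Pd f)) - radius (Pd f)).
Proof.
apply: ring_bound_le.
  by have := face_disc_in_unit_disc f; rewrite -subr_gt0 opprD addrA => /ltW.
by rewrite modulusE; apply: (@boundary_gap _ _ _ _ _ _ _ f bpd) => v; rewrite -modulusE; exact: vertex_disc_in_unit_disc.
Qed.

Lemma finite_face_vertices f : finite_set [set v | inc v f].
Proof.
have [F HF] := face_vertices ppn codegN f.
apply: (@sub_finite_set _ _ (F @` `I_(N + N))); last exact/finite_image/finite_II.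
move=> v /HF [k <-]; exists (k : nat) => //=; exact: ltn_ord.
Qed.

Lemma centre_pw_eq u v : pw (A v) (complex.Re (z u)) (complex.Im (z u)) <= 0 -> u = v.
Proof.
move=> h; apply: contrapT => uv; have := vertex_discs_disjoint dcp uv.
move: h; rewrite /pw /d2 /=; have := radius_gt0 (P u); have := radius_gt0 (P v).
have := mulr_gt0 (radius_gt0 (P u)) (radius_gt0 (P v)); have := exprn_gt0 2 (radius_gt0 (P u)).
lra.
Qed.

Lemma centre_pw_incident u f : pw (B f) (complex.Re (z u)) (complex.Im (z u)) <= 0 -> inc u f.
Proof.
move=> h; apply: (meet_incident dcp _ h); rewrite /pw /= !subrr expr0n !add0r oppr_le0 sqr_ge0 //.
Qed.

Lemma pw_open_near (E : pdisc R) (x y : R) : pw E x y < 0 -> 0 < pr E ->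
  exists2 m, 0 < m & forall x' y', (x' - x) ^+ 2 + (y' - y) ^+ 2 < m -> pw E x' y' <= 0.
Proof.
move=> h r0; pose s := norm2 (x - px E) (y - py E).
have s0 : 0 <= s by rewrite sqrtr_ge0.
have sE : s ^+ 2 = (x - px E) ^+ 2 + (y - py E) ^+ 2 by rewrite sqr_sqrtr // addr_ge0 ?sqr_ge0.
have sr : s < pr E.
  by rewrite -ltr_sqr ?nnegrE ?(ltW r0) // sE; move: h; rewrite /pw subr_lt0.
exists ((pr E - s) ^+ 2); first by rewrite exprn_gt0 // subr_gt0.
move=> x' y' h'; rewrite /pw subr_le0.
have : norm2 (x' - x) (y' - y) <= pr E - s.
  by rewrite -ler_sqr ?nnegrE ?sqrtr_ge0 ?subr_ge0 ?(ltW sr) // /norm2 sqr_sqrtr ?addr_ge0 ?sqr_ge0 // ltW.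
have := modulusD ((x' - x) +i* (y' - y)) ((x - px E) +i* (y - py E)).
rewrite !modulusE /= -/s.
have -> : x' - x + (x - px E) = x' - px E by ring.
have -> : y' - y + (y - py E) = y' - py E by ring.
move=> h1 h2.
have : norm2 (x' - px E) (y' - py E) <= pr E by move: h1 h2; lra.
move=> h3; have : norm2 (x' - px E) (y' - py E) ^+ 2 <= pr E ^+ 2 by rewrite ler_sqr ?nnegrE ?sqrtr_ge0 ?(ltW r0).
by rewrite /norm2 sqr_sqrtr ?addr_ge0 ?sqr_ge0.
Qed.

(** A neighbourhood of [x] is covered by at most four discs: by one if [x] is interior to it;
    otherwise [x] lies on a circle, hence in a disc of the other family, and if it is on that circle
    too, [incident_quad] and [four_cover] apply. A centre in a vertex disc belongs to that vertex, a
    centre in a face disc to one of the finitely many vertices of the face. *)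
Lemma locally_finite_packing (x : R[i]) : unit_disc x ->
  exists2 m : R, 0 < m & finite_set [set u | (complex.Re (z u) - complex.Re x) ^+ 2 + (complex.Im (z u) - complex.Im x) ^+ 2 < m].
Proof.
set x1 := complex.Re x; set x2 := complex.Im x => xU.
pose good := exists2 m : R, 0 < m & finite_set [set u | (complex.Re (z u) - x1) ^+ 2 + (complex.Im (z u) - x2) ^+ 2 < m].
have openA v : pw (A v) x1 x2 < 0 -> good.
  move=> h; have [m m0 Hm] := pw_open_near h (to_pdisc_gt0 _); exists m => //.
  apply: (@sub_finite_set _ _ [set v]); last exact: finite_set1.
  by move=> u /Hm /centre_pw_eq.
have openB f : pw (B f) x1 x2 < 0 -> good.
  move=> h; have [m m0 Hm] := pw_open_near h (to_pdisc_gt0 _); exists m => //.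
  apply: (@sub_finite_set _ _ [set v | inc v f]); last exact: finite_face_vertices.
  by move=> u /Hm /centre_pw_incident.
have corner v f : inc v f -> pw (A v) x1 x2 = 0 -> pw (B f) x1 x2 = 0 -> good.
  move=> vf pA pB; have [u [g [uf vg ug [Tu Tg pu pg]]]] := incident_quad ppn simple dcp codegN vf pA pB.
  have [m m0 Hm] := four_cover (to_pdisc_gt0 _) (to_pdisc_gt0 _) (to_pdisc_gt0 _) (to_pdisc_gt0 _)
     (incident_orthogonal dcp vf) Tg Tu pA pu pB pg.
  exists m => //.
  apply: (@sub_finite_set _ _ ([set v] `|` [set u] `|` [set v | inc v f] `|` [set v | inc v g])).
    move=> w /Hm [/centre_pw_eq ->|/centre_pw_eq ->|/centre_pw_incident h|/centre_pw_incident h].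
    + by left; left; left.
    + by left; left; right.
    + by left; right.
    + by right.
  by rewrite !finite_setU; repeat split; [exact: finite_set1|exact: finite_set1|exact: finite_face_vertices|exact: finite_face_vertices].
have closA v : pw (A v) x1 x2 <= 0 -> good.
  rewrite le_eqVlt => /orP[/eqP pA|]; last exact: openA.
  have [F HF] := bp_cover1 bp v; have [k [vk]] := HF _ _ pA.
  rewrite le_eqVlt => /orP[/eqP pB|]; last exact: openB.
  exact: corner vk pA pB.
have : ((\bigcup_(v in setT) closed_disc (P v)) `|` (\bigcup_(f in setT) closed_disc (Pd f))) x.
  by rewrite pud.
case=> [[v _ /closed_discE]|[f _ /closed_discE]]; first exact: closA.
rewrite le_eqVlt => /orP[/eqP pB|]; last exact: openB.
have [F HF] := bp_cover2 bp f; have [k [vk]] := HF _ _ pB; exact: closA.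
Qed.

(** Compactness of the smaller disc; this makes the support of the logarithmic potential finite. *)
Lemma finite_centres (rho : R) : rho < 1 -> finite_set [set v | modulus (z v) <= rho].
Proof.
move=> rho1; have := @closed_ball_compact R 0 rho; rewrite compact_cover => cpt.
have /choice [m Hm] : forall x : R[i], exists m : R, modulus x <= rho ->
    0 < m /\ finite_set [set u | modulus (z u - x) < m].
  move=> x; have [xr|xr] := leP (modulus x) rho; last by exists 0.
  have [m m0 fm] := locally_finite_packing (le_lt_trans xr rho1 : unit_disc x).
  exists (Num.sqrt m); rewrite ?xr => _; split; first by rewrite sqrtr_gt0.
  apply: sub_finite_set fm => u /= h; rewrite -!raddfB -modulus_sqr.
  by rewrite -[m]sqr_sqrtr ?(ltW m0) // ltr_sqr ?nnegrE ?modulus_ge0 ?sqrtr_ge0.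
have [] := cpt (plane R) [set x : plane R | modulus (x : R[i]) <= rho] (fun x => [set w : plane R | modulus (w - x : R[i]) < m x]).
- move=> x /= xr; rewrite openE => w /= wx; apply/nbhs_planeP.
  exists (m x - modulus (w - x)); first by rewrite subr_gt0.
  move=> w' ww'; rewrite /mkset; have := modulus_triangle w w' x; move: ww'; lra.
- move=> x; rewrite /mkset subr0 => xr; exists x => //=.
  by rewrite subrr modulus0; have [] := Hm x xr.
move=> S SD cov.
have fin : finite_set (\bigcup_(x in [set` finmap.enum_fset S]) [set u | modulus (z u - (x : R[i])) < m x]).
  apply: bigcup_finite => [|x /= xS]; first exact: finite_seq.
  by have /set_mem := SD x xS; rewrite /mkset => /Hm [].
apply: sub_finite_set fin => u ur; have [|x xS h] := cov (z u); first by rewrite /mkset subr0.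
by exists x.
Qed.

End PackingInDisc.

(** * Radii are comparable to distances to the boundary *)

Lemma ln_diff_le (R : realType) (a b : R) : 0 < a -> 0 < b -> ln b - ln a <= (b - a) / a.
Proof.
move=> a0 b0; rewrite -ln_div ?posrE //.
have e : b / a = 1 + (b - a) / a by field; rewrite gt_eqF.
have h : 0 < b / a by rewrite divr_gt0.
by move: h; rewrite e => h; apply: le_ln1Dx; move: h; clear; lra.
Qed.

(** Both one-sided bounds come from [ln b - ln a <= (b - a) / a]; the one with [tw] in the
    denominator is brought back to [tu] by [tu <= (2 + K) * tw]. *)
Lemma ln_lipschitz (R : realType) (K ru rw tu tw : R) : 1 <= K -> 0 < ru -> 0 < rw ->
  ru <= tu -> rw <= tw -> ru <= K * rw -> rw <= K * ru -> `|tu - tw| <= ru + rw ->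
  `|ln tu - ln tw| <= (1 + K) * (2 + K) * (ru / tu).
Proof.
move=> K1 ru0 rw0 rtu rtw rK1 rK2; rewrite !ler_norml => /andP[d1 d2].
have tu0 : 0 < tu by apply: lt_le_trans rtu.
have tw0 : 0 < tw by apply: lt_le_trans rtw.
have K0 : 0 < K by apply: lt_le_trans K1.
have h1 : ln tw - ln tu <= (1 + K) * (ru / tu).
  apply: le_trans (ln_diff_le tu0 tw0) _; rewrite mulrA ler_pM2r ?invr_gt0 //.
  by move: d1 rK2; clear; lra.
have h1' : (1 + K) * (ru / tu) <= (1 + K) * (2 + K) * (ru / tu).
  rewrite ler_pM2r ?divr_gt0 // ler_peMr //; first by move: K0; clear; lra.
  by move: K0; clear; lra.
have h2 : ln tu - ln tw <= (1 + K) * (2 + K) * (ru / tu).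
  apply: le_trans (ln_diff_le tw0 tu0) _.
  have tt : tu <= (2 + K) * tw.
    have : K * rw <= K * tw by rewrite ler_pM2l.
    by move: d2 rK1 rtw; clear; lra.
  have inv : tw^-1 <= (2 + K) / tu.
    by rewrite ler_pdivlMr // mulrC ler_pdivrMr.
  apply: (@le_trans _ _ ((1 + K) * ru * tw^-1)).
    by rewrite ler_pM2r ?invr_gt0 //; move: d2 rK2; clear; lra.
  have -> : (1 + K) * (2 + K) * (ru / tu) = (1 + K) * ru * ((2 + K) / tu) by ring.
  by rewrite ler_pM2l // mulr_gt0 // addr_gt0.
by apply/andP; split; move: h1 h1' h2; clear; lra.
Qed.

Lemma dyadic_interval (R : realType) (a t : R) (n : nat) : a <= t -> t < 2 ^+ n * a ->
  exists k : 'I_n, 2 ^+ k * a <= t < 2 ^+ k.+1 * a.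
Proof.
elim: n => [|n IH] at_ tn; first by move: at_ tn; rewrite expr0 mul1r => /le_lt_trans h /h; rewrite ltxx.
have [h|h] := leP (2 ^+ n * a) t; first by exists ord_max; rewrite /= h tn.
by have [k Hk] := IH at_ h; exists (widen_ord (leqnSn n) k).
Qed.

(** A number of dyadic scales for which [radius_lower_bound_step] is contradictory; the successor
    makes it positive, as that lemma requires. *)
Definition radius_depth (R : realType) (N : nat) (M p : R) : nat :=
  (Num.bound (128 * N%:R * M ^+ 2 *
    ((1 + ring_constant R N ^+ 2) * (2 + ring_constant R N ^+ 2) / ln 2) ^+ 2 / p)).+1.

Section Energy.
Variables (R : realType) (G : network R) (D : drawing G).
Variables (P : vertex G -> disc R) (Pd : face D -> disc R) (N : nat) (M p : R).
Hypothesis ppn : proper_plane_network D.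
Hypothesis simple : simple_graph G.
Hypothesis dcp : double_circle_packing P Pd.
Hypothesis pud : packing_in_unit_disc P Pd.
Hypothesis degN : forall v : vertex G, (size (edges_from v) <= N)%N.
Hypothesis codegN : forall f : face D, (codegree f <= N%:R%:E)%E.
Hypothesis condM : forall e : oedge G, cond e <= M /\ 1 <= M * cond e.
Hypothesis ut : uniformly_transient G p.

Local Notation A v := (to_pdisc (P v)).
Local Notation r v := (radius (P v)).
Local Notation z v := (centre (P v)).
Local Notation K := (ring_constant R N).

Let lfin : locally_finite G. Proof. by case: ppn. Qed.

Lemma vertex_centre_dist u v : u <> v -> r u + r v <= modulus (z u - z v).
Proof.
move=> uv; have := vertex_discs_disjoint dcp uv; rewrite d2_modulus ler_sqr //.
  by rewrite nnegrE addr_ge0 // ltW // radius_gt0.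
by rewrite nnegrE modulus_ge0.
Qed.

Lemma adjacent_centre_dist u v : adjacent u v -> modulus (z u - z v) = r u + r v.
Proof. by case: dcp => _ _ H _ _ /H. Qed.

(** The value [r v] at [v] itself keeps the logarithm finite at the pole, and the function at least
    [r v] and at least [r u] everywhere. *)
Definition pole_dist (v u : vertex G) : R := if u == v then r v else modulus (z u - z v).

Lemma pole_dist_radius v u : r u <= pole_dist v u /\ r v <= pole_dist v u.
Proof.
rewrite /pole_dist; case: eqP => [->|uv]; first by [].
have := vertex_centre_dist uv; have := radius_gt0 (P u); have := radius_gt0 (P v).
by move=> h1 h2 h3; split; lra.
Qed.

Lemma pole_dist_gt0 v u : 0 < pole_dist v u.
Proof. by have [h _] := pole_dist_radius v u; apply: lt_le_trans h; exact: radius_gt0. Qed.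

Lemma pole_dist_adjacent v u w : adjacent u w -> `|pole_dist v u - pole_dist v w| <= r u + r w.
Proof.
move=> uw; have T := adjacent_centre_dist uw; rewrite /pole_dist.
have ru := radius_gt0 (P u); have rw := radius_gt0 (P w).
case: eqP => [uv|uv]; case: eqP => [wv|wv].
- by rewrite subrr normr0 addr_ge0 // ltW.
- by rewrite modulusB -uv T opprD addrA subrr sub0r normrN gtr0_norm // lerDr ltW.
- by rewrite -wv T addrK gtr0_norm // lerDl ltW.
rewrite -T ler_norml; apply/andP; split.
  by have := modulus_triangle (z u) (z w) (z v); rewrite [modulus (z w - z u)]modulusB; lra.
by have := modulus_triangle (z w) (z u) (z v); lra.
Qed.

Lemma ln_pole_dist_adjacent v u w : adjacent u w ->
  `|ln (pole_dist v u) - ln (pole_dist v w)| <=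
  (1 + K ^+ 2) * (2 + K ^+ 2) * (r u / pole_dist v u).
Proof.
move=> uw; have wu : adjacent w u.
  by case: uw => e eu ew; exists (orev e) => //; rewrite otgt_orev.
apply: (@ln_lipschitz _ _ _ (r w)).
- by rewrite exprn_ege1 // ring_constant_ge1.
- exact: radius_gt0.
- exact: radius_gt0.
- exact: (pole_dist_radius v u).1.
- exact: (pole_dist_radius v w).1.
- exact: (adjacent_radius ppn simple dcp degN codegN uw).
- exact: (adjacent_radius ppn simple dcp degN codegN wu).
- exact: pole_dist_adjacent.
Qed.

(** The harmonic function of the annulus with radii [r v] and [2 ^+ n * r v], equal to 1 on the
    inner circle and 0 on the outer one, sampled at the centres and extended by 0. *)
Definition log_potential (v : vertex G) (n : nat) (u : vertex G) : R :=
  Num.max 0 (ln (2 ^+ n * r v) - ln (pole_dist v u)) / ln (2 ^+ n).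

Lemma sum_over_annuli (v : vertex G) (n : nat) (S : seq (vertex G)) : uniq S ->
  (forall u, u \in S -> pole_dist v u < 2 ^+ n * r v) ->
  \sum_(u <- S) (r u / pole_dist v u) ^+ 2 <= 64 * n%:R.
Proof.
move=> uS inS; have rv0 := radius_gt0 (P v).
pose ann k u := (2 ^+ k * r v <= pole_dist v u) && (pole_dist v u < 2 ^+ k.+1 * r v).
have one k : \sum_(u <- S | ann k u) (r u / pole_dist v u) ^+ 2 <= 64.
  have q0 : 0 < 2 ^+ k * r v by rewrite mulr_gt0 // exprn_gt0.
  have : \sum_(u <- [seq u <- S | ann k u]) pr (A u) ^+ 2 <= 4 * (2 * (2 ^+ k.+1 * r v)) ^+ 2.
    apply: (@disjoint_discs_area _ _ _ (fun u => A u) (complex.Re (z v)) (complex.Im (z v))).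
    - by rewrite filter_uniq.
    - by rewrite mulr_gt0 // mulr_gt0 // exprn_gt0.
    - by move=> u _; exact: to_pdisc_gt0.
    - move=> u w _ _ uw; exact: (vertex_discs_disjoint dcp uw).
    - move=> u; rewrite mem_filter => /andP[/andP[_ lt] _].
      have [h1 h2] := pole_dist_radius v u.
      have zz : modulus (z u - z v) <= pole_dist v u.
        by rewrite /pole_dist; case: eqP => [->|_ //]; rewrite subrr modulus0 ltW.
      have := Re_le_modulus (z u - z v); have := Im_le_modulus (z u - z v).
      by rewrite !raddfB /= => k1 k2; split; lra.
  rewrite big_filter => area.
  rewrite -(ler_pM2r (exprn_gt0 2 q0)).
  have -> : 64 * (2 ^+ k * r v) ^+ 2 = 4 * (2 * (2 ^+ k.+1 * r v)) ^+ 2 by rewrite [2 ^+ k.+1]exprS; ring.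
  apply: le_trans area; rewrite mulr_suml; apply: ler_sum => u /andP[h _].
  rewrite -exprMn ler_sqr ?nnegrE.
  - rewrite mulrAC ler_pdivrMr ?pole_dist_gt0 // ler_pM2l //; exact: radius_gt0.
  - by rewrite mulr_ge0 ?divr_ge0 ?(ltW q0) ?(ltW (radius_gt0 _)) ?(ltW (pole_dist_gt0 _ _)).
  - exact: ltW (radius_gt0 _).
apply: (@le_trans _ _ (\sum_(k < n) \sum_(u <- S | ann k u) (r u / pole_dist v u) ^+ 2)).
  have -> : \sum_(k < n) \sum_(u <- S | ann k u) (r u / pole_dist v u) ^+ 2 =
      \sum_(u <- S) \sum_(k < n) (if ann k u then (r u / pole_dist v u) ^+ 2 else 0).
    rewrite exchange_big /=; apply: eq_bigr => k _; by rewrite big_mkcond.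
  rewrite !big_seq; apply: ler_sum => u uin.
  have [k Hk] := dyadic_interval (pole_dist_radius v u).2 (inS u uin).
  rewrite (bigD1 k) //= /ann Hk lerDl; apply: sumr_ge0 => j _.
  by case: ifP => _ //; exact: sqr_ge0.
apply: (@le_trans _ _ (\sum_(k < n) 64)); first by apply: ler_sum => k _; exact: one.
by rewrite sumr_const card_ord mulr_natr.
Qed.

(* Otherwise the logarithmic potential of a small disc has too little energy. *)
Lemma radius_lower_bound_step (v : vertex G) (n : nat) : (0 < n)%N ->
  2 ^+ n * r v <= (1 - modulus (z v)) / 2 ->
  p * n%:R <= 128 * N%:R * M ^+ 2 * ((1 + K ^+ 2) * (2 + K ^+ 2) / ln 2) ^+ 2.
Proof.
move=> n0 far; set C := (1 + K ^+ 2) * (2 + K ^+ 2).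
have rv0 := radius_gt0 (P v); have [p0 utv] := ut; have [q esc pq] := utv v.
have L0 : 0 < ln 2 :> R by rewrite ln_gt0 // ltr1n.
have nR : 0 < n%:R :> R by rewrite ltr0n.
have M0 : 0 < M.
  have [e _] := vertex_has_edge ppn v; have [h _] := condM e.
  exact: lt_le_trans (cond_gt0 e) h.
have q0 : 0 < 2 ^+ n * r v by rewrite mulr_gt0 // exprn_gt0.
have Ln : ln (2 ^+ n) = n%:R * ln 2 :> R by rewrite lnXn // mulr_natl.
have Ln0 : 0 < ln (2 ^+ n) :> R by rewrite Ln mulr_gt0.
pose near := [set u | pole_dist v u < 2 ^+ n * r v].
(* The factor 1/2 in the hypothesis keeps these centres in a disc of radius less than 1. *)
have fin : finite_set near.
  have zv1 : 0 < 1 - modulus (z v) by rewrite subr_gt0; have := vertex_disc_in_unit_disc pud v; lra.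
  have := finite_centres ppn simple dcp pud degN codegN (rho := 1 - (1 - modulus (z v)) / 2).
  move=> /(_ _) h; apply: sub_finite_set (h _); last by lra.
  move=> u /=; rewrite /near /= /pole_dist; case: eqP => [->|uv] lt; first by lra.
  have := modulus_triangle (z v) (z u) 0; rewrite !subr0; lra.
pose S : seq (vertex G) := finmap.enum_fset (fset_set near).
have memS u : (u \in S) = (pole_dist v u < 2 ^+ n * r v).
  have := in_fset_set fin u; rewrite /S => ->.
  by apply/idP/idP => [/set_mem //|h]; exact/mem_set.
have uS : uniq S by exact: finmap.fset_uniq.
have vS : v \in S.
  by rewrite memS /pole_dist eqxx ltr_pMl // exprn_egt1 ?ltr1n // -lt0n.
pose phi := log_potential v n.
have phiv : phi v = 1.
  rewrite /phi /log_potential /pole_dist eqxx -ln_div ?posrE // mulfK ?gt_eqF //.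
  by rewrite max_r ?(ltW Ln0) // divff // gt_eqF.
have phi0 u : u \notin S -> phi u = 0.
  rewrite memS -leNgt => h; rewrite /phi /log_potential max_l ?mul0r //.
  by rewrite subr_le0 ler_ln ?posrE ?pole_dist_gt0.
have := escape_le_energy lfin simple (vertex_has_edge ppn) esc pq (ltW p0) uS vS phiv phi0.
(* Truncation at 0 does not increase differences ([cl]), so the potential varies along an edge no
   more than the normalised logarithm. *)
have edge u e : e \in edges_from u ->
    cond e * (phi u - phi (otgt e)) ^+ 2 <= M * (C / ln (2 ^+ n)) ^+ 2 * (r u / pole_dist v u) ^+ 2.
  rewrite mem_edges_from // => /eqP eu.
  have uw : adjacent u (otgt e) by exists e.
  have := ln_pole_dist_adjacent v uw; rewrite -/C => lip.
  rewrite -mulrA; apply: ler_pM; [exact: ltW (cond_gt0 e)|exact: sqr_ge0|by have [] := condM e|].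
  rewrite -exprMn -[X in X <= _]real_normK ?num_real //.
  rewrite ler_sqr ?nnegrE ?normr_ge0 //; last first.
    rewrite mulr_ge0 ?divr_ge0 ?(ltW Ln0) ?(ltW (radius_gt0 _)) ?(ltW (pole_dist_gt0 _ _)) //.
    by rewrite /C mulr_ge0 // addr_ge0 ?sqr_ge0.
  rewrite /phi /log_potential -mulrBl normrM normfV (gtr0_norm Ln0).
  rewrite mulrAC ler_pM2r ?invr_gt0 //; apply: le_trans lip.
  set a := ln _; set x := ln (pole_dist v u); set y := ln (pole_dist v (otgt e)).
  have -> : x - y = (a - y) - (a - x) by ring.
  have cl (s t : R) : `|Num.max 0 s - Num.max 0 t| <= `|s - t|.
    have [hs|hs] := leP 0 s; have [ht|ht] := leP 0 t => //.
    - by rewrite subr0 ger0_norm // ger0_norm ?subr_ge0 ?(le_trans (ltW ht)) //; lra.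
    - by rewrite sub0r normrN ger0_norm // ler0_norm; lra.
    - by rewrite subrr normr0.
  by rewrite [X in _ <= X]distrC; exact: cl.
have sumle : \sum_(u <- S) \sum_(e <- edges_from u) cond e * (phi u - phi (otgt e)) ^+ 2 <=
    N%:R * (M * (C / ln (2 ^+ n)) ^+ 2) * (64 * n%:R).
  have X0 : 0 <= M * (C / ln (2 ^+ n)) ^+ 2 by rewrite mulr_ge0 ?sqr_ge0 // ltW.
  have inS u : u \in S -> pole_dist v u < 2 ^+ n * r v by rewrite memS.
  apply: (@le_trans _ _ (\sum_(u <- S)
      N%:R * (M * (C / ln (2 ^+ n)) ^+ 2) * (r u / pole_dist v u) ^+ 2)).
    apply: ler_sum => u _.
    apply: (@le_trans _ _ (\sum_(e <- edges_from u)
        M * (C / ln (2 ^+ n)) ^+ 2 * (r u / pole_dist v u) ^+ 2)).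
      by rewrite !big_seq; apply: ler_sum => e; exact: edge.
    rewrite big_const_seq count_predT iter_addr_0 -[X in X <= _]mulr_natl -[X in _ <= X]mulrA.
    by apply: ler_wpM2r; [rewrite mulr_ge0 ?sqr_ge0|rewrite ler_nat].
  rewrite -mulr_sumr; apply: ler_wpM2l; last exact: sum_over_annuli.
  by rewrite mulr_ge0.
have w1 : 1 <= M * weight v.
  have [e /eqP ev] := vertex_has_edge ppn v.
  have [_ h] := condM e; apply: le_trans h _; rewrite ler_pM2l //.
  rewrite /weight (big_rem e) ?mem_edges_from //= lerDl.
  by apply: sumr_ge0 => e' _; exact: ltW (cond_gt0 e').
move=> energy.
have main : p <= M * (2 * (N%:R * (M * (C / ln (2 ^+ n)) ^+ 2) * (64 * n%:R))).
  apply: (@le_trans _ _ (M * (p * weight v))).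
    by rewrite mulrCA -[X in X <= _]mulr1 ler_pM2l.
  rewrite ler_pM2l //; apply: le_trans energy _; rewrite ler_pM2l //.
have -> : 128 * N%:R * M ^+ 2 * (C / ln 2) ^+ 2 =
    M * (2 * (N%:R * (M * (C / ln (2 ^+ n)) ^+ 2) * (64 * n%:R))) * n%:R.
  by rewrite Ln; field; rewrite !gt_eqF.
by rewrite ler_pM2r.
Qed.

Lemma radius_lower_bound (v : vertex G) :
  1 - modulus (z v) <= 2 ^+ (radius_depth N M p).+1 * r v.
Proof.
rewrite leNgt; apply/negP => lt; have [p0 _] := ut.
have := @radius_lower_bound_step v (radius_depth N M p) isT.
rewrite ler_pdivlMr // -mulrAC -exprSr => /(_ (ltW lt)); apply/negP; rewrite -ltNge.
rewrite [p * _]mulrC -ltr_pdivrMr // /radius_depth; set b := _ / p.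
have b0 : 0 <= b.
  by apply: divr_ge0; [apply: mulr_ge0; [apply: mulr_ge0; [apply: mulr_ge0|]|]; rewrite ?sqr_ge0|exact: ltW].
by apply: (lt_trans (archi_boundP b0)); rewrite ltr_nat.
Qed.

End Energy.

(** * Hyperbolic distance *)

Section Hyperbolic.
Variable R : realType.
Implicit Types z w : R[i].

(** This is [sinh^2 (d / 2)] for the hyperbolic distance [d]. *)
Definition hyperbolic_ratio z w : R :=
  modulus (z - w) ^+ 2 / ((1 - modulus z ^+ 2) * (1 - modulus w ^+ 2)).

Lemma modulus_div z w : w != 0 -> modulus (z / w) = modulus z / modulus w.
Proof.
move=> w0; have m0 : modulus w != 0 by apply/eqP => /modulus_eq0/eqP; apply/negP.
by rewrite -[X in _ = modulus X / _](divfK w0) [in RHS]modulusM mulfK.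
Qed.

Lemma modulus_cross z w : modulus (1 - z * w^*) ^+ 2 =
  modulus (z - w) ^+ 2 + (1 - modulus z ^+ 2) * (1 - modulus w ^+ 2).
Proof. by rewrite !modulus_sqr; case: z => a b; case: w => c d /=; ring. Qed.

(** [1 + hyperbolic_ratio z w] is [cosh^2 (d / 2)], and [cosh x <= e^x <= 2 cosh x] for [x >= 0].
    The lower bound loses only an additive constant, harmless for a rough isometry. *)
Lemma hyperbolic_dist_bounds z w : modulus z < 1 -> modulus w < 1 ->
  ln (1 + hyperbolic_ratio z w) <= hyperbolic_dist z w <= ln (4 * (1 + hyperbolic_ratio z w)).
Proof.
move=> z1 w1; rewrite /hyperbolic_dist /hyperbolic_ratio.
have C := modulus_cross z w.
set a := modulus (z - w) in C *; set b := modulus (1 - z * w^*) in C.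
set q := (1 - _) * _ in C *.
have q0 : 0 < q.
  by rewrite mulr_gt0 // subr_gt0 expr_lt1 ?modulus_ge0.
have a0 : 0 <= a by exact: modulus_ge0.
have b0 : 0 < b.
  rewrite lt_neqAle modulus_ge0 andbT eq_sym; apply/eqP => bE.
  by move: C; rewrite bE expr0n /=; have := sqr_ge0 a; lra.
have ab : a < b by rewrite -ltr_sqr ?nnegrE ?(ltW b0) // C ltrDl.
have -> : modulus ((z - w) / (1 - z * w^*)) = a / b.
  by rewrite modulus_div //; apply/eqP => E; move: b0; rewrite /b E modulus0 ltxx.
have -> : (1 + a / b) / (1 - a / b) = (b + a) ^+ 2 / q.
  have -> : q = (b - a) * (b + a) by rewrite -subr_sqr C addrC addKr.
  by field; rewrite (gt_eqF b0) !gt_eqF ?subr_gt0 //; move: a0 b0; clear; lra.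
have -> : 1 + a ^+ 2 / q = b ^+ 2 / q by rewrite C; field; rewrite gt_eqF.
have bq : 0 < b ^+ 2 / q by rewrite divr_gt0 // exprn_gt0.
have baq : 0 < (b + a) ^+ 2 / q by rewrite divr_gt0 // exprn_gt0 // ltr_wpDr.
have bq4 : 0 < 4 * (b ^+ 2 / q) by rewrite mulr_gt0.
apply/andP; split; rewrite ler_ln ?posrE //.
  by rewrite ler_pM2r ?invr_gt0 //; move: a0 b0; clear; nra.
by rewrite mulrA ler_pM2r ?invr_gt0 //; move: a0 b0 ab; clear; nra.
Qed.

Lemma hyperbolic_ratio_ge0 z w : modulus z < 1 -> modulus w < 1 -> 0 <= hyperbolic_ratio z w.
Proof.
by move=> z1 w1; rewrite /hyperbolic_ratio divr_ge0 ?sqr_ge0 // mulr_ge0 // subr_ge0 expr_le1 ?modulus_ge0 // ltW.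
Qed.

Lemma hyperbolic_ratio_le z w : modulus z < 1 -> modulus w < 1 ->
  hyperbolic_ratio z w <= modulus (z - w) ^+ 2 / ((1 - modulus z) * (1 - modulus w)).
Proof.
move=> z1 w1; have z0 := modulus_ge0 z; have w0 := modulus_ge0 w.
have dz : 0 < 1 - modulus z by rewrite subr_gt0.
have dw : 0 < 1 - modulus w by rewrite subr_gt0.
rewrite /hyperbolic_ratio ler_wpM2l ?sqr_ge0 // lef_pV2 ?posrE ?mulr_gt0 //; last first.
- by rewrite subr_gt0 expr_lt1.
- by rewrite subr_gt0 expr_lt1.
by apply: ler_pM; nra.
Qed.

Lemma hyperbolic_ratio_ge z w : modulus z < 1 -> modulus w < 1 ->
  modulus (z - w) ^+ 2 / ((1 - modulus z) * (1 - modulus w)) <= 4 * hyperbolic_ratio z w.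
Proof.
move=> z1 w1; have z0 := modulus_ge0 z; have w0 := modulus_ge0 w.
have dz : 0 < 1 - modulus z by rewrite subr_gt0.
have dw : 0 < 1 - modulus w by rewrite subr_gt0.
rewrite /hyperbolic_ratio mulrCA ler_wpM2l ?sqr_ge0 //.
have -> : 1 - modulus z ^+ 2 = (1 - modulus z) * (1 + modulus z) by ring.
have -> : 1 - modulus w ^+ 2 = (1 - modulus w) * (1 + modulus w) by ring.
have pz : 0 < 1 + modulus z by lra.
have pw : 0 < 1 + modulus w by lra.
rewrite ler_pdivlMr ?mulr_gt0 //.
have -> : ((1 - modulus z) * (1 - modulus w))^-1 *
  ((1 - modulus z) * (1 + modulus z) * ((1 - modulus w) * (1 + modulus w))) =
  (1 + modulus z) * (1 + modulus w) by field; rewrite !gt_eqF.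
nra.
Qed.

(** [n] is least such that [n] doublings of the depth of [z], the point closer to the unit circle,
    reach [|z - w|]. If [n > 0], minimality gives [1 - |w| <= 2 |z - w|], and the ratio is at least
    of order [2 ^+ n]. *)
Lemma hyperbolic_scales z w : modulus z < 1 -> modulus w < 1 -> modulus w <= modulus z ->
  exists n : nat, modulus (z - w) <= 2 ^+ n * (1 - modulus z) /\
    2 ^+ n <= 64 * (1 + hyperbolic_ratio z w).
Proof.
move=> z1 w1 wz; set a := modulus (z - w); set t := 1 - modulus z.
have t0 : 0 < t by rewrite subr_gt0.
have s0 := hyperbolic_ratio_ge0 z1 w1.
have ex : exists n, a <= 2 ^+ n * t.
  exists (Num.bound (a / t)); rewrite -ler_pdivrMr //.
  apply: le_trans (ltW (archi_boundP _)) _; first by rewrite divr_ge0 ?modulus_ge0 ?ltW.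
  by rewrite -natrX ler_nat ltnW // ltn_expl.
have [[|n] le min] := ex_minnP ex; first by exists 0; split=> //; rewrite expr0; lra.
exists n.+1; split=> //.
have lt : 2 ^+ n * t < a by rewrite ltNge; apply/negP => /min; rewrite ltnn.
have ta : t <= a by apply: le_trans (ltW lt); rewrite ler_peMl ?(ltW t0) // exprn_ege1 // ler1n.
have wt : 1 - modulus w <= t + a.
  by have := modulusD w (z - w); rewrite addrC subrK /t /a; lra.
have dw : 0 < 1 - modulus w by rewrite subr_gt0.
have : a / (2 * t) <= a ^+ 2 / (t * (1 - modulus w)).
  rewrite ler_pdivlMr ?mulr_gt0 // mulrAC ler_pdivrMr ?mulr_gt0 //.
  have : 0 <= a * t by rewrite mulr_ge0 ?modulus_ge0 ?ltW.
  by nra.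
move=> /le_trans /(_ (hyperbolic_ratio_ge z1 w1)) h.
have : 2 ^+ n < a / t by rewrite ltr_pdivlMr.
rewrite exprS; move: h; have -> : a / (2 * t) = a / t / 2 by field; rewrite gt_eqF.
lra.
Qed.

End Hyperbolic.

(** The part of [0, 1] covered by the sets linked to [U i] and the part covered by the others are
    closed and disjoint, so connectedness leaves no others; removing loops from a chain bounds its
    length. *)
Lemma interval_chain (R : realType) (n : nat) (U : 'I_n -> set R) (i j : 'I_n) :
  (forall k, closed (U k)) -> (forall t, 0 <= t <= 1 -> exists k, U k t) ->
  (exists2 t, 0 <= t <= 1 & U i t) -> (exists2 t, 0 <= t <= 1 & U j t) ->
  exists s, [/\ path (fun k l => `[< exists t, [/\ 0 <= t <= 1, U k t & U l t] >]) i s,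
    last i s = j & (size s < n)%N].
Proof.
move=> cU cov [ti ti1 Uti] [tj tj1 Utj].
pose e : rel 'I_n := fun k l => `[< exists t, [/\ 0 <= t <= 1, U k t & U l t] >].
change (exists s, [/\ path e i s, last i s = j & (size s < n)%N]).
have clo (Q : pred 'I_n) : closed (\bigcup_(k in [set k | Q k]) U k).
  by apply: closed_bigcup => [|k _]; [exact: finite_finset|exact: cU].
pose X := [set t : R | 0 <= t <= 1] `&` \bigcup_(k in [set k | connect e i k]) U k.
have XE : X = [set t : R | 0 <= t <= 1].
  have conn : connected [set t : R | 0 <= t <= 1].
    have -> : [set t : R | 0 <= t <= 1] = `[0, 1]%classic.
      by apply/seteqP; split=> t /=; rewrite in_itv.
    exact: segment_connected.
  apply: conn; first by exists ti; split=> //; exists i => //=; exact: connect0.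
  - exists (~` \bigcup_(k in [set k | ~~ connect e i k]) U k).
      exact/closed_openC/clo.
    apply/seteqP; split=> t [t1 H]; split=> //.
    + move: H => [k /= ik Ukt] [l /= il Ult]; move/negP: il; apply.
      by apply: connect_trans ik (connect1 _); apply/asboolP; exists t.
    + have [k Ukt] := cov t t1; exists k => //=; apply: contrapT => /negP nk.
      by apply: H; exists k.
  - exists (\bigcup_(k in [set k | connect e i k]) U k) => //; exact: clo.
have : X tj by rewrite XE.
move=> [_ [k /= ik Ukt]].
have ij : connect e i j.
  by apply: connect_trans ik (connect1 _); apply/asboolP; exists tj.
have [s es ->] := connectP ij; have [s' es' us' _] := shortenP es.
exists s'; split=> //.
have := max_card (mem (i :: s')); rewrite card_ord; move/card_uniqP: us' => -> //.
Qed.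

Lemma bounded_enumeration (T : choiceType) (A : set T) (c : nat) :
  (forall s : seq T, uniq s -> (forall x, x \in s -> A x) -> (size s <= c)%N) ->
  exists2 s : seq T, (size s <= c)%N & forall x, x \in s <-> A x.
Proof.
move=> bnd.
pose Q m := `[< exists s : seq T, [/\ uniq s, forall x, x \in s -> A x & size s = m] >].
have Q0 : exists m, Q m by exists 0; apply/asboolP; exists [::].
have Qc m : Q m -> (m <= c)%N by move=> /asboolP [s [us sA <-]]; exact: bnd.
have [m /asboolP [s [us sA sm]] maxm] := ex_maxnP Q0 Qc.
exists s; first by rewrite sm Qc //; apply/asboolP; exists s.
move=> x; split=> [/sA//|Ax]; apply: contrapT => /negP xs.
have : Q (size s).+1.
  apply/asboolP; exists (x :: s); split=> //=; first by rewrite xs.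
  by move=> y; rewrite in_cons => /orP[/eqP->//|/sA].
by move=> /maxm; rewrite sm ltnn.
Qed.

(** * Walks following short segments *)

Section Walks.
Variables (R : realType) (G : network R).
Implicit Types u v : vertex G.

Definition walk_le (n : nat) u v := exists2 k, (k <= n)%N & walk_within setT k u v.

Lemma walk_within_cat k l u v w : walk_within setT k u v -> walk_within setT l v w ->
  walk_within setT (k + l) u w.
Proof.
elim: k u => [|k IH] u /=; first by case=> _ <-.
by case=> _ [e eu ev] vw; split=> //; exists e => //; exact: IH ev vw.
Qed.

Lemma walk_le_trans m n u v w : walk_le m u v -> walk_le n v w -> walk_le (m + n) u w.
Proof.
by case=> k km uv [l ln vw]; exists (k + l)%N; [exact: leq_add|exact: walk_within_cat uv vw].
Qed.

Lemma walk_le_leq m n u v : (m <= n)%N -> walk_le m u v -> walk_le n u v.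
Proof. by move=> mn [k km uv]; exists k => //; exact: leq_trans mn. Qed.

Lemma walk_le_refl n u : walk_le n u u.
Proof. by exists 0. Qed.

Lemma walk_le_adjacent u v : adjacent u v -> walk_le 1 u v.
Proof. by case=> e eu ev; exists 1 => //=; split=> //; exists e. Qed.

Lemma walk_within_rev k u v : walk_within setT k u v -> walk_within setT k v u.
Proof.
elim: k u => [|k IH] u; first by case=> _ ->.
case=> _ [e eu /IH ev]; rewrite -addn1; apply: walk_within_cat ev _.
by split=> //; exists (orev e); rewrite /otgt ?orevK.
Qed.

Lemma walk_le_sym n u v : walk_le n u v -> walk_le n v u.
Proof. by case=> k kn /walk_within_rev; exists k. Qed.

Lemma graph_dist_le k u v : walk_within setT k u v -> graph_dist u v <= k%:R.
Proof.
move=> w; apply: ge_inf; last by exists k.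
by exists 0 => _ [n _ <-].
Qed.

Lemma graph_dist_walk u v : (exists k, walk_within setT k u v) ->
  exists2 k, walk_within setT k u v & graph_dist u v = k%:R.
Proof.
case=> k0 w0; have ex : exists k, `[< walk_within setT k u v >] by exists k0; exact/asboolP.
have [k /asboolP w min] := ex_minnP ex; exists k => //; apply/eqP; rewrite eq_le graph_dist_le //=.
apply: lb_le_inf; first by exists k0%:R, k0.
by move=> _ [n wn <-]; rewrite ler_nat; apply: min; exact/asboolP.
Qed.

End Walks.

(** Each disc has radius at least [m / q] and lies in the square of half-side [(1 + 2 k) m] around
    [x]; compare areas. *)
Lemma discs_near_point_bound (R : realType) (I : choiceType) (E : I -> disc R) (x : R[i]) (m q k : R)
    (s : seq I) : 0 < m -> 0 < q -> 0 < k -> uniq s ->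
  (forall i j, i <> j -> (pr (to_pdisc (E i)) + pr (to_pdisc (E j))) ^+ 2 <=
    d2 (to_pdisc (E i)) (to_pdisc (E j))) ->
  (forall i, i \in s -> m <= q * radius (E i) /\ radius (E i) <= k * m) ->
  (forall i, i \in s -> exists2 y, modulus (y - x) <= m & closed_disc (E i) y) ->
  (size s <= Num.bound (4 * (1 + 2 * k) ^+ 2 * q ^+ 2))%N.
Proof.
move=> m0 q0 k0 us disj rad hit.
have rho0 : 0 < (1 + 2 * k) * m by rewrite mulr_gt0 // addr_gt0 // mulr_gt0.
have : \sum_(i <- s) pr (to_pdisc (E i)) ^+ 2 <= 4 * ((1 + 2 * k) * m) ^+ 2.
  apply: (@disjoint_discs_area _ _ _ (fun i => to_pdisc (E i)) (complex.Re x) (complex.Im x)) => //.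
  - by move=> i _; exact: to_pdisc_gt0.
  - by move=> i j _ _; exact: disj.
  move=> i si; have [y yx Ey] := hit i si; have [_ rk] := rad i si.
  have := modulus_triangle y (centre (E i)) x; rewrite [modulus (centre _ - y)]modulusB => tri.
  have := Re_le_modulus (centre (E i) - x); have := Im_le_modulus (centre (E i) - x).
  rewrite !raddfB /= => h1 h2; rewrite /closed_disc /= in Ey.
  by split; move: h1 h2 tri yx Ey rk; rewrite mulrDl mul1r -mulrA; lra.
have low : \sum_(i <- s) pr (to_pdisc (E i)) ^+ 2 >= (size s)%:R * (m / q) ^+ 2.
  apply: (@le_trans _ _ (\sum_(i <- s) (m / q) ^+ 2)).
    by rewrite big_const_seq count_predT iter_addr_0 mulr_natl.
  rewrite !big_seq; apply: ler_sum => i si; have [mr _] := rad i si.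
  rewrite ler_sqr ?nnegrE ?divr_ge0 ?(ltW m0) ?(ltW q0) ?(ltW (to_pdisc_gt0 _)) //.
  by rewrite ler_pdivrMr // mulrC.
move=> /(le_trans low) h.
have : (size s)%:R <= 4 * (1 + 2 * k) ^+ 2 * q ^+ 2.
  have mq : 0 < (m / q) ^+ 2 by rewrite exprn_gt0 // divr_gt0.
  rewrite -(ler_pM2r mq); apply: le_trans h _; rewrite le_eqVlt; apply/orP; left; apply/eqP.
  by field; rewrite gt_eqF.
move=> le; rewrite -(ler_nat R); apply: le_trans le (ltW (archi_boundP _)).
by rewrite mulr_ge0 ?sqr_ge0 // mulr_ge0 ?sqr_ge0.
Qed.

Lemma closed_segment_preimage (R : realType) (B : disc R) (x w : R[i]) :
  closed [set t : R | closed_disc B (x + t%:C * w)].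
Proof.
have sq (f : R -> R) : continuous f -> continuous (fun t => f t ^+ 2).
  by move=> cf t; apply: (@continuous_comp _ _ _ f (fun x => x ^+ 2)); [exact: cf|exact: exprn_continuous].
have aff (a b c : R) : continuous (fun t : R => a + t * b - c).
  move=> t; apply: cvgB; last exact: cvg_cst.
  by apply: cvgD; [exact: cvg_cst|apply: cvgM; [exact: cvg_id|exact: cvg_cst]].
pose g t := (complex.Re x + t * complex.Re w - complex.Re (centre B)) ^+ 2 +
  (complex.Im x + t * complex.Im w - complex.Im (centre B)) ^+ 2 - radius B ^+ 2.
have cg : continuous g.
  move=> t; apply: cvgB; last exact: cvg_cst.
  by apply: cvgD; apply: (sq _ (aff _ _ _)).
have -> : [set t : R | closed_disc B (x + t%:C * w)] = g @^-1` [set a | a <= 0].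
  apply/seteqP; split=> t /=; rewrite closed_discE /pw /g /=.
    by case: x {g cg} => x1 x2; case: w => w1 w2 /=; rewrite !mul0r subr0 addr0.
  by case: x {g cg} => x1 x2; case: w => w1 w2 /=; rewrite !mul0r subr0 addr0.
by move/continuous_closedP : cg; apply; exact: closed_le.
Qed.

(** * Chains of discs along a segment short relative to its depth *)

Section ShortSegments.
Variables (R : realType) (G : network R) (D : drawing G).
Variables (P : vertex G -> disc R) (Pd : face D -> disc R) (N : nat) (Q : R).
Hypothesis ppn : proper_plane_network D.
Hypothesis simple : simple_graph G.
Hypothesis dcp : double_circle_packing P Pd.
Hypothesis pud : packing_in_unit_disc P Pd.
Hypothesis degN : forall v : vertex G, (size (edges_from v) <= N)%N.
Hypothesis codegN : forall f : face D, (codegree f <= N%:R%:E)%E.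
Hypothesis Q0 : 0 <= Q.
Hypothesis depth : forall v : vertex G, 1 - modulus (centre (P v)) <= Q * radius (P v).

Local Notation inc v f := (@incident R G D f v).
Local Notation r v := (radius (P v)).
Local Notation z v := (centre (P v)).
Local Notation K := (ring_constant R N).

Let K1 : 1 <= K. Proof. exact: ring_constant_ge1. Qed.

(** [{classic face D}] equips faces with the choice structure that lists of distinct discs
    require. *)
Definition packing_disc (i : vertex G + {classic face D}) : disc R :=
  match i with inl v => P v | inr f => Pd f end.

(** Represents a disc by a vertex, so that chains of discs translate into walks; a face disc may be
    represented by any vertex of the face. *)
Definition anchor (i : vertex G + {classic face D}) (u : vertex G) : Prop :=
  match i with inl v => u = v | inr f => inc u f end.

Lemma face_walk f u v : inc u f -> inc v f -> walk_le N u v.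
Proof.
have [n [w [/andP[n0 nN] wf fw wc]]] := face_cycle ppn codegN f.
have on_cycle x : inc x f -> exists2 i, (i < n)%N & x = osrc (w i).
  move=> [e ef [ev|ev]]; have [i i_n eE] := fw e ef; first by exists i; rewrite // -ev eE.
  by exists (i.+1 %% n)%N; rewrite ?ltn_mod // -wc // -eE ev.
move=> /on_cycle [a an ->] /on_cycle [b bn ->].
have forward k : walk_within setT k (osrc (w a)) (osrc (w ((a + k) %% n)%N)).
  elim: k => [|k IH]; first by rewrite addn0 modn_small.
  rewrite -addn1; apply: walk_within_cat IH _.
  split=> //; exists (w ((a + k) %% n)%N) => //; split=> //.
  by rewrite wc ?ltn_mod // addn1 -[in LHS]addn1 modnDml addn1 addnS.
have [ab|ba] := leqP a b.
  exists (b - a)%N; first by rewrite (leq_trans (leq_subr _ _)) // (leq_trans (ltnW bn)).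
  by have := forward (b - a)%N; rewrite subnKC // modn_small.
exists (b + n - a)%N.
  by apply: leq_trans nN; rewrite leq_subLR leq_add2r ltnW.
have := forward (b + n - a)%N; rewrite subnKC; first by rewrite modnDr modn_small.
by rewrite (leq_trans (ltnW an)) // leq_addl.
Qed.

Lemma anchor_exists i : exists u, anchor i u.
Proof.
case: i => [v|f]; first by exists v.
have [n [w [/andP[n0 nN] wf _ _]]] := face_cycle ppn codegN f.
by exists (osrc (w 0)); apply: (left_face_incident (wf 0 n0)).1.
Qed.

Lemma closed_discs_meet_tangent (B B' : disc R) :
  (pr (to_pdisc B) + pr (to_pdisc B')) ^+ 2 <= d2 (to_pdisc B) (to_pdisc B') ->
  closed_disc B `&` closed_disc B' !=set0 -> tangent_discs B B'.
Proof.
rewrite d2_modulus ler_sqr ?nnegrE ?modulus_ge0 ?addr_ge0 ?(ltW (radius_gt0 _)) // => le [x []].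
rewrite /closed_disc /= modulusB => h1 h2; apply/eqP; rewrite eq_le le andbT.
by apply: le_trans (modulus_triangle x _ _) _; exact: lerD.
Qed.

(** Meeting discs of one family are tangent, so their vertices are adjacent or their faces share an
    edge; meeting discs of different families are incident. The longest case goes around two
    faces. *)
Lemma anchor_meet i j u v : anchor i u -> anchor j v ->
  closed_disc (packing_disc i) `&` closed_disc (packing_disc j) !=set0 -> walk_le (N + N).+1 u v.
Proof.
case: dcp => _ _ HP HF HI.
case: i j => [u'|f] [v'|g] /= iu jv meet.
- rewrite iu jv; have [->|/eqP uv] := eqVneq u' v'; first exact: walk_le_refl.
  apply: (walk_le_leq (m := 1)) => //; apply/walk_le_adjacent/HP.
  by apply: closed_discs_meet_tangent meet; exact: (vertex_discs_disjoint dcp).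
- have := (HI u' g).1.1 meet; rewrite -iu => uf; apply: (walk_le_leq (m := N)).
    by rewrite leqW // leq_addr.
  exact: face_walk uf jv.
- rewrite setIC in meet; have := (HI v' f).1.1 meet; rewrite -jv => vf; apply: (walk_le_leq (m := N)).
    by rewrite leqW // leq_addr.
  exact: face_walk iu vf.
have [fg|/eqP fg] := eqVneq f g.
  apply: (walk_le_leq (m := N)); first by rewrite leqW // leq_addr.
  by apply: (face_walk iu); rewrite fg.
have [e ef eg] : dual_adjacent f g.
  by apply/HF; apply: closed_discs_meet_tangent meet; exact: (face_discs_disjoint dcp).
apply: (walk_le_leq (m := (N + N)%N)) => //.
apply: (walk_le_trans (v := osrc e)).
  by apply: face_walk iu (left_face_incident ef).1.
by apply: face_walk jv; rewrite -(otgt_orev e); exact: (left_face_incident eg).2.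
Qed.

Definition near (x : R[i]) (u : vertex G) := exists2 i, anchor i u & closed_disc (packing_disc i) x.

Lemma near_exists x : modulus x < 1 -> exists u, near x u.
Proof.
move=> x1; have : unit_disc (x : plane R) := x1.
rewrite -pud => -[[v _ Pv]|[f _ Pf]]; first by exists v, (inl v).
by have [u uf] := anchor_exists (inr f); exists u, (inr f).
Qed.

Lemma anchor_path (s : seq (vertex G + {classic face D})) i u v :
  path (fun j k => `[< closed_disc (packing_disc j) `&` closed_disc (packing_disc k) !=set0 >]) i s ->
  anchor i u -> anchor (last i s) v -> walk_le ((size s).+1 * (N + N).+1) u v.
Proof.
elim: s i u => [|j s IH] i u /=.
  move=> _ iu iv; rewrite mul1n; apply: anchor_meet iu iv _.
  by exists (centre (packing_disc i)); split; rewrite /closed_disc /= subrr modulus0 ltW // radius_gt0.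
move=> /andP[/asboolP ij js] iu lv; have [u' ju'] := anchor_exists j.
rewrite mulSn; apply: walk_le_trans (IH j u' js ju' lv).
exact: anchor_meet iu ju' ij.
Qed.

Local Notation Q' := (Q * K + K + 2).

(** The upper bound is the boundary gap of the disc. For the lower bound, [depth] applies directly
    to a vertex disc, and to a face disc through an incident vertex, of comparable radius, which
    explains the constant [Q * K + K + 2]. *)
Lemma packing_disc_radius i (q : R[i]) (m : R) : m <= 1 - modulus q <= 2 * m ->
  closed_disc (packing_disc i) q ->
  m <= Q' * radius (packing_disc i) /\ radius (packing_disc i) <= 2 * K * m.
Proof.
have K0 : 0 < K by apply: lt_le_trans K1.
move=> /andP[mq qm]; case: i => [v|f] /= h; rewrite /closed_disc /= in h.
  have rv := radius_gt0 (P v).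
  have tri : modulus q <= modulus (z v) + r v.
    by have := modulusD (z v) (q - z v); rewrite addrC subrK; lra.
  have tri' : modulus (z v) <= modulus q + r v.
    by have := modulusD q (z v - q); rewrite addrC subrK modulusB; lra.
  split.
    have : 0 <= Q * r v * (K - 1) by rewrite mulr_ge0 // ?subr_ge0 // mulr_ge0 // ltW.
    have : 0 < K * r v by rewrite mulr_gt0.
    by have := depth v; nra.
  apply: le_trans (vertex_boundary_gap ppn simple dcp pud degN codegN v) _.
  by rewrite [2 * K]mulrC -mulrA ler_pM2l //; lra.
have rf := radius_gt0 (Pd f); have [u uf] := anchor_exists (inr f).
have ruf := vertex_face_radius ppn simple dcp degN codegN uf.
have meet := (let: And5 _ _ _ _ H := dcp in (H u f).1).2 uf.
have [y [yu yf]] := meet; rewrite /closed_disc /= in yu yf.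
have tri' : modulus q <= modulus (centre (Pd f)) + radius (Pd f).
  by have := modulusD (centre (Pd f)) (q - centre (Pd f)); rewrite addrC subrK; lra.
have ru := radius_gt0 (P u).
split.
  have : 1 - modulus q <= Q * r u + r u + 2 * radius (Pd f).
    have := modulusD q (z u - q); rewrite addrC subrK.
    have := modulus_triangle (centre (Pd f)) (z u) q.
    have := modulus_triangle y (z u) (centre (Pd f)).
    rewrite [modulus (z u - y)]modulusB [modulus (centre (Pd f) - q)]modulusB.
    by have := depth u; lra.
  have : Q * r u <= Q * (K * radius (Pd f)) by rewrite ler_wpM2l.
  by lra.
apply: le_trans (face_boundary_gap ppn simple dcp pud degN codegN f) _.
rewrite [2 * K]mulrC -mulrA ler_pM2l //; lra.
Qed.

Definition segment_count : nat := Num.bound (4 * (1 + 2 * (2 * K)) ^+ 2 * Q' ^+ 2).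

(** Along the segment the depth stays between [m] and [2 m], so all discs met have radii comparable
    to [m] and are bounded in number. They cover the segment, so a chain of them leads from one end
    to the other. *)
Lemma short_segment_walk (x y : R[i]) (u v : vertex G) :
  modulus y <= modulus x -> modulus x < 1 -> modulus (x - y) <= 1 - modulus x ->
  near x u -> near y v -> walk_le ((segment_count + segment_count) * (N + N).+1) u v.
Proof.
move=> yx x1 xy nxu nyv.
have K0 : 0 < K by apply: lt_le_trans K1.
have Q'0 : 0 < Q' by rewrite addr_gt0 // ltr_wpDl // mulr_ge0 // ltW.
set m := 1 - modulus x in xy; have m0 : 0 < m by rewrite subr_gt0.
pose pt (t : R) : R[i] := x + t%:C * (y - x).
have pt_dist t : 0 <= t <= 1 -> modulus (pt t - x) <= m.
  move=> /andP[t0 t1]; rewrite /pt addrAC subrr add0r modulusM modulus_real ger0_norm //.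
  by rewrite modulusB; apply: le_trans xy; rewrite ler_piMl ?modulus_ge0.
have pt_depth t : 0 <= t <= 1 -> m <= 1 - modulus (pt t) <= 2 * m.
  move=> t01; have /andP[t0 t1] := t01.
  have h1 : modulus (pt t) <= (1 - t) * modulus x + t * modulus y.
    have -> : pt t = (1 - t)%:C * x + t%:C * y by rewrite /pt rmorphB rmorph1; ring.
    apply: le_trans (modulusD _ _) _; rewrite !modulusM !modulus_real !ger0_norm ?subr_ge0 //.
  have h2 : t * modulus y <= t * modulus x by rewrite ler_wpM2l.
  have := modulusD (pt t) (x - pt t); rewrite addrC subrK modulusB.
  have := pt_dist t t01; rewrite /m.
  by move=> *; apply/andP; split; lra.
pose hit i := exists2 t, 0 <= t <= 1 & closed_disc (packing_disc i) (pt t).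
have [s1 c1 e1] : exists2 s : seq (vertex G), (size s <= segment_count)%N &
    forall w, w \in s <-> hit (inl w).
  apply: bounded_enumeration => s us sh.
  apply: (@discs_near_point_bound _ _ P x m) => //; first by rewrite mulr_gt0.
  - by move=> i j; exact: (vertex_discs_disjoint dcp).
  - move=> i /sh [t t01 h]; exact: (packing_disc_radius (i := inl i) (pt_depth t t01) h).
  - by move=> i /sh [t t01 h]; exists (pt t) => //; exact: pt_dist.
have [s2 c2 e2] : exists2 s : seq {classic face D}, (size s <= segment_count)%N &
    forall w, w \in s <-> hit (inr w).
  apply: bounded_enumeration => s us sh.
  apply: (@discs_near_point_bound _ {classic face D} Pd x m) => //; first by rewrite mulr_gt0.
  - by move=> i j; exact: (face_discs_disjoint dcp).
  - move=> i /sh [t t01 h]; exact: (packing_disc_radius (i := inr i) (pt_depth t t01) h).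
  - by move=> i /sh [t t01 h]; exists (pt t) => //; exact: pt_dist.
pose L := [seq inl w | w <- s1] ++ [seq inr w | w <- s2] : seq (vertex G + {classic face D}).
have hitL i : hit i -> exists k : 'I_(size L), tnth (in_tuple L) k = i.
  move=> hi; have /tnthP [k ->] : i \in in_tuple L; last by exists k.
  rewrite /= mem_cat; case: i hi => [w /e1 h|w /e2 h].
    by apply/orP; left; apply/mapP; exists w.
  by apply/orP; right; apply/mapP; exists w.
pose U (k : 'I_(size L)) := [set t : R | closed_disc (packing_disc (tnth (in_tuple L) k)) (pt t)].
have cU k : closed (U k) by exact: closed_segment_preimage.
have [i0 iu i0x] := nxu; have [j0 jv j0y] := nyv.
have pt0 : pt 0 = x by rewrite /pt mul0r addr0.
have pt1 : pt 1 = y by rewrite /pt mul1r addrC subrK.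
have h0 : hit i0 by exists 0; rewrite ?lexx ?ler01 // pt0.
have h1 : hit j0 by exists 1; rewrite ?lexx ?ler01 // pt1.
have [k0 k0E] := hitL i0 h0; have [k1 k1E] := hitL j0 h1.
have cov t : 0 <= t <= 1 -> exists k, U k t.
  move=> t01; have /near_exists [w [i iw it]] : modulus (pt t) < 1.
    by have /andP[] := pt_depth t t01; lra.
  have [k kE] := hitL i (ex_intro2 _ _ t t01 it).
  by exists k; rewrite /U /= kE.
have [||s [ps ls ss]] := @interval_chain _ _ U k0 k1 cU cov.
- by rewrite /U /= k0E.
- by rewrite /U /= k1E.
apply: (@walk_le_leq _ _ ((size s).+1 * (N + N).+1)).
  rewrite leq_mul2r; apply/orP; right; apply: (leq_trans ss).
  by rewrite size_cat !size_map leq_add.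
rewrite -(size_map (tnth (in_tuple L))).
apply: (anchor_path (i := i0)) => //; rewrite -?k0E; last by rewrite last_map ls k1E.
rewrite path_map; apply: sub_path ps => a b /asboolP [t [_ ta tb]] /=.
by apply/asboolP; exists (pt t).
Qed.

End ShortSegments.

(** * Comparison of the two metrics *)

Section RoughIsometry.
Variables (R : realType) (G : network R) (D : drawing G).
Variables (P : vertex G -> disc R) (Pd : face D -> disc R) (N : nat) (Q : R).
Hypothesis ppn : proper_plane_network D.
Hypothesis simple : simple_graph G.
Hypothesis dcp : double_circle_packing P Pd.
Hypothesis pud : packing_in_unit_disc P Pd.
Hypothesis degN : forall v : vertex G, (size (edges_from v) <= N)%N.
Hypothesis codegN : forall f : face D, (codegree f <= N%:R%:E)%E.
Hypothesis Q0 : 0 <= Q.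
Hypothesis depth : forall v : vertex G, 1 - modulus (centre (P v)) <= Q * radius (P v).

Local Notation inc v f := (@incident R G D f v).
Local Notation r v := (radius (P v)).
Local Notation z v := (centre (P v)).
Local Notation K := (ring_constant R N).

Let K1 : 1 <= K. Proof. exact: ring_constant_ge1. Qed.
Let K0 : 0 < K. Proof. by apply: lt_le_trans K1. Qed.

Definition walk_growth : R := 2 * (K ^+ 2 * Q) + 2.
Definition mesh_walk : nat := (segment_count N Q + segment_count N Q) * (N + N).+1.

Lemma vertex_centre_lt1 v : modulus (z v) < 1.
Proof. by have := vertex_disc_in_unit_disc pud v; have := radius_gt0 (P v); lra. Qed.

Lemma adjacent_depth u v : adjacent u v -> 1 - modulus (z u) <= K ^+ 2 * Q * (1 - modulus (z v)).
Proof.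
move=> uv; apply: le_trans (depth u) _.
apply: (@le_trans _ _ (Q * (K ^+ 2 * r v))).
  by rewrite ler_wpM2l // (adjacent_radius ppn simple dcp degN codegN uv).
have H0 : 0 <= K ^+ 2 * Q by rewrite mulr_ge0 ?sqr_ge0.
rewrite mulrA [Q * _]mulrC ler_wpM2l //.
by have := vertex_disc_in_unit_disc pud v; lra.
Qed.

(** A step moves by [r u + r w], at most the sum of the depths, and changes the depth by a bounded
    factor. The two estimates go through the induction together: the displacement of the rest of the
    walk is measured by the depth of its first vertex. *)
Lemma walk_displacement n u v : walk_within setT n u v ->
  modulus (z u - z v) <= walk_growth ^+ n * (1 - modulus (z u)) /\
  1 - modulus (z u) <= walk_growth ^+ n * (1 - modulus (z v)).
Proof.
set B := walk_growth; set H := K ^+ 2 * Q.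
have H0 : 0 <= H by rewrite mulr_ge0 ?sqr_ge0.
have BE : B = 2 * H + 2 by [].
have d0 w : 0 < 1 - modulus (z w) by rewrite subr_gt0 vertex_centre_lt1.
elim: n u => [|n IH] u.
  by case=> _ ->; rewrite subrr modulus0 expr0 mul1r (ltW (d0 v)).
case=> _ [e eu /IH [IH1 IH2]]; set w := otgt e in IH1 IH2.
have uw : adjacent u w by exists e.
have wu : adjacent w u by exists (orev e); rewrite ?otgt_orev.
have h1 := adjacent_depth uw; have h2 := adjacent_depth wu; rewrite -/H in h1 h2.
have step : modulus (z u - z w) <= (1 - modulus (z u)) + (1 - modulus (z w)).
  have -> : modulus (z u - z w) = r u + r w by case: dcp => _ _ T _ _; exact/T.
  by have := vertex_disc_in_unit_disc pud u; have := vertex_disc_in_unit_disc pud w; lra.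
have tri := modulus_triangle (z w) (z u) (z v).
have Bn1 : 1 <= B ^+ n by rewrite exprn_ege1 // BE; lra.
rewrite exprS; move: IH1 IH2 h1 h2 step tri Bn1 (d0 u) (d0 w) (d0 v).
set a := modulus (z u - z v); set b := modulus (z w - z v); set c := modulus (z u - z w).
set Bn := B ^+ n; rewrite BE.
move: (1 - modulus (z u)) (1 - modulus (z w)) (1 - modulus (z v)) => du dw dv.
move=> IH1 IH2 h1 h2 step tri Bn1 du0 dw0 dv0; split.
  have : Bn * dw <= Bn * (H * du) by rewrite ler_pM2l // (lt_le_trans _ Bn1).
  have : 0 <= (Bn - 1) * ((1 + H) * du).
    by rewrite mulr_ge0 ?subr_ge0 // mulr_ge0 ?(ltW du0) // addr_ge0.
  have : 0 <= Bn * du by rewrite mulr_ge0 ?(ltW du0) // (le_trans _ Bn1).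
  by move: IH1 h2 step tri; lra.
have : H * dw <= H * (Bn * dv) by rewrite ler_wpM2l.
have : 0 <= Bn * dv by rewrite mulr_ge0 ?(ltW dv0) // (le_trans _ Bn1).
have : 0 <= H * (Bn * dv) by rewrite mulr_ge0 // mulr_ge0 ?(ltW dv0) // (le_trans _ Bn1).
by move: h1; lra.
Qed.

Lemma walk_growth_ge1 : 1 <= walk_growth.
Proof. by rewrite /walk_growth; have := mulr_ge0 (sqr_ge0 K) Q0; lra. Qed.

Lemma hyperbolic_dist_le_graph_dist u v :
  hyperbolic_dist (z u) (z v) <= 3 * ln walk_growth * graph_dist u v + ln 8.
Proof.
have [n uv ->] : exists2 k, walk_within setT k u v & graph_dist u v = k%:R.
  by apply: graph_dist_walk; case: ppn => _ conn _ _ _; exact: conn.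
have [h1 h2] := walk_displacement uv.
have du : 0 < 1 - modulus (z u) by rewrite subr_gt0 vertex_centre_lt1.
have dv : 0 < 1 - modulus (z v) by rewrite subr_gt0 vertex_centre_lt1.
have B1 := walk_growth_ge1; set B := walk_growth in h1 h2 B1 *.
have B0 : 0 < B by apply: lt_le_trans B1.
have Bn : 1 <= B ^+ (3 * n) by rewrite exprn_ege1.
(* Two factors [B ^+ n] come from the squared displacement, the third from exchanging one depth for
   the other. *)
have s : hyperbolic_ratio (z u) (z v) <= B ^+ (3 * n).
  apply: le_trans (hyperbolic_ratio_le (vertex_centre_lt1 u) (vertex_centre_lt1 v)) _.
  rewrite ler_pdivrMr ?mulr_gt0 //.
  apply: (@le_trans _ _ ((B ^+ n * (1 - modulus (z u))) ^+ 2)).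
    by rewrite ler_sqr ?nnegrE ?modulus_ge0 // mulr_ge0 ?(ltW du) // exprn_ge0 // ltW.
  have -> : B ^+ (3 * n) * ((1 - modulus (z u)) * (1 - modulus (z v))) =
      B ^+ n ^+ 2 * (1 - modulus (z u)) * (B ^+ n * (1 - modulus (z v))).
    by rewrite mulnC exprM; ring.
  have -> : forall a b : R, (a * b) ^+ 2 = a ^+ 2 * b * b by move=> a b; ring.
  by rewrite ler_pM2l // mulr_gt0 // exprn_gt0 // exprn_gt0.
have /andP[_ h] := hyperbolic_dist_bounds (vertex_centre_lt1 u) (vertex_centre_lt1 v).
apply: (le_trans h).
(* The 8 absorbs the 1: [4 * (1 + s) <= 8 * B ^+ (3 * n)], where [s] stands for the ratio. *)
have -> : 3 * ln B * n%:R + ln 8 = ln (8 * B ^+ (3 * n)).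
  rewrite lnM ?posrE ?exprn_gt0 // lnXn // -[ln B *+ _]mulr_natl natrM; ring.
have s0 := hyperbolic_ratio_ge0 (vertex_centre_lt1 u) (vertex_centre_lt1 v).
rewrite ler_ln ?posrE ?mulr_gt0 ?exprn_gt0 //; first by lra.
by lra.
Qed.

Local Notation near := (@near R G D P Pd).

Lemma mesh_step (x y : R[i]) u v : modulus y <= modulus x -> modulus x < 1 ->
  modulus (x - y) <= 1 - modulus x -> near x u -> near y v -> walk_le mesh_walk u v.
Proof. exact: (short_segment_walk ppn simple dcp pud degN codegN Q0 depth). Qed.

Lemma modulus_contract (h : R) (x : R[i]) : h <= 1 -> modulus ((1 - h)%:C * x) = (1 - h) * modulus x.
Proof. by move=> h1; rewrite modulusM modulus_real ger0_norm // subr_ge0. Qed.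

(** The last inequality says that the radial segment between the two points is at most as long as
    the depth of its outer end. *)
Lemma contract_step (x : R[i]) (h h' : R) u v : modulus x < 1 -> 0 <= h -> h <= h' -> h' <= 1 ->
  (1 + h' - 2 * h) * modulus x <= 1 ->
  near ((1 - h)%:C * x) u -> near ((1 - h')%:C * x) v -> walk_le mesh_walk u v.
Proof.
move=> x1 h0 hh h'1 c; have xx := modulus_ge0 x; have h1 := le_trans hh h'1.
apply: mesh_step; rewrite ?modulus_contract //.
- by rewrite ler_wpM2r //; lra.
- by apply: le_lt_trans x1; rewrite ler_piMl //; lra.
rewrite -mulrBl -rmorphB modulusM modulus_real.
have -> : 1 - h - (1 - h') = h' - h by ring.
by rewrite ger0_norm ?subr_ge0 //; lra.
Qed.

(** Capped at 1, where the contracted point is the origin. *)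
Definition dyadic_height (t : R) (n : nat) : R := Num.min (2 ^+ n * t) 1.

(** The points [(1 - h) x] with [h = 0, t, 2 t, 4 t, ...] move along a radius; doubling [h] is
    always a short segment in the sense of [contract_step]. The first move, from 0 to [t], accounts
    for [n.+1]. *)
Lemma contract_walk (x : R[i]) (t : R) n u v : modulus x < 1 -> 0 < t -> t <= 1 - modulus x ->
  near x u -> near ((1 - dyadic_height t n)%:C * x) v -> walk_le (n.+1 * mesh_walk) u v.
Proof.
move=> x1 t0 tx xu; have x0 := modulus_ge0 x.
elim: n v => [|n IH] v xv.
  rewrite mul1n; apply: (@contract_step x 0 (dyadic_height t 0)) xv => //.
  - by rewrite /dyadic_height expr0 mul1r le_min (ltW t0) ler01.
  - by rewrite /dyadic_height ge_min lexx orbT.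
  - rewrite /dyadic_height expr0 mul1r min_l; last by lra.
    have : t * modulus x <= (1 - modulus x) * modulus x by rewrite ler_wpM2r.
    by have := sqr_ge0 (1 - modulus x); lra.
  - by rewrite subr0 rmorph1 mul1r.
have q0 : 0 < 2 ^+ n * t by rewrite mulr_gt0 // exprn_gt0.
have y1 : modulus ((1 - dyadic_height t n)%:C * x) < 1.
  rewrite modulus_contract ?ge_min ?lexx ?orbT //; apply: le_lt_trans x1.
  rewrite ler_piMl // gerBl /dyadic_height le_min (ltW q0) ler01 //.
have [w yw] := near_exists ppn pud codegN y1.
rewrite mulSn addnC; apply: walk_le_trans (IH w yw) _.
apply: (contract_step x1 _ _ _ _ yw xv); rewrite /dyadic_height ?exprS -?mulrA.
- by rewrite le_min (ltW q0) ler01.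
- by rewrite le_min !ge_min lexx orbT andbT; apply/orP; left; lra.
- by rewrite ge_min lexx orbT.
apply: le_trans (ltW x1); rewrite ler_piMl //.
have [h1|h1] := leP (2 ^+ n * t) 1; have [h2|h2] := leP (2 * (2 ^+ n * t)) 1; lra.
Qed.

Lemma near_centre v : near (z v) v.
Proof. by exists (inl v) => //=; rewrite /closed_disc /= subrr modulus0 ltW // radius_gt0. Qed.

(** In place of the geodesic, both points are moved radially inwards by [n] doublings, until a
    single short segment joins them: [n + 1] moves on either side and one across. The starting
    height is the depth of the point closer to the unit circle, admissible for both. *)
Lemma scale_walk u v : exists n : nat,
  walk_le ((n + n + 3) * mesh_walk) u v /\ 2 ^+ n <= 64 * (1 + hyperbolic_ratio (z u) (z v)).
Proof.
have sym a b : hyperbolic_ratio (z a) (z b) = hyperbolic_ratio (z b) (z a).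
  by rewrite /hyperbolic_ratio modulusB [in LHS](mulrC (1 - _)).
wlog vu : u v / modulus (z v) <= modulus (z u).
  move=> H; have [/H//|/ltW/H [n [wn hn]]] := leP (modulus (z v)) (modulus (z u)).
  by exists n; split; [exact: walk_le_sym|rewrite sym].
have u1 := vertex_centre_lt1 u; have v1 := vertex_centre_lt1 v.
have [n [sep le]] := hyperbolic_scales u1 v1 vu; exists n; split=> //.
set t := 1 - modulus (z u) in sep; have t0 : 0 < t by rewrite subr_gt0.
set h := dyadic_height t n.
have h0 : 0 <= h by rewrite le_min ler01 andbT mulr_ge0 ?(ltW t0) // exprn_ge0.
have h1 : h <= 1 by rewrite ge_min lexx orbT.
have inside x : modulus x < 1 -> modulus ((1 - h)%:C * x) < 1.
  move=> x1; rewrite modulus_contract //; apply: le_lt_trans x1.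
  by rewrite ler_piMl ?modulus_ge0 // gerBl.
have [u' uu'] := near_exists ppn pud codegN (inside _ u1).
have [v' vv'] := near_exists ppn pud codegN (inside _ v1).
have W1 := contract_walk u1 t0 (lexx _) (near_centre u) uu'.
have W2 : walk_le (n.+1 * mesh_walk) v v'.
  by apply: contract_walk (near_centre v) vv' => //; rewrite /t; lra.
have W3 : walk_le mesh_walk u' v'.
  apply: (mesh_step _ (inside _ u1) _ uu' vv').
    by rewrite !modulus_contract // ler_wpM2l // subr_ge0.
  rewrite -mulrBr !modulus_contract //; set a := modulus (z u - z v) in sep *.
  have a0 : 0 <= a by exact: modulus_ge0.
  have : (1 - h) * a <= h.
    rewrite /h /dyadic_height; have [_|_] := leP (2 ^+ n * t) 1; last by rewrite subrr mul0r.
    apply: le_trans sep; rewrite ler_piMl // gerBl mulr_ge0 ?(ltW t0) // exprn_ge0 //.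
  have : (1 - h) * modulus (z u) <= (1 - h) * 1 by rewrite ler_wpM2l ?subr_ge0 // ltW.
  by lra.
apply: (walk_le_leq _ (walk_le_trans W1 (walk_le_trans W3 (walk_le_sym W2)))).
by rewrite -mulSn -mulnDl leq_mul2r; apply/orP; right; rewrite !addnS !addSn addn0.
Qed.

Lemma graph_dist_le_hyperbolic_dist u v :
  graph_dist u v <= mesh_walk%:R * (2 * (hyperbolic_dist (z u) (z v) + ln 64) / ln 2 + 3).
Proof.
have [n [[k kn uv] le]] := scale_walk u v.
apply: le_trans (graph_dist_le uv) _.
apply: (@le_trans _ _ ((n + n + 3) * mesh_walk)%:R); first by rewrite ler_nat.
have u1 := vertex_centre_lt1 u; have v1 := vertex_centre_lt1 v.
have s0 := hyperbolic_ratio_ge0 u1 v1; have /andP[lo _] := hyperbolic_dist_bounds u1 v1.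
have L0 : 0 < ln 2 :> R by rewrite ln_gt0 // ltr1n.
rewrite natrM mulrC ler_wpM2l // !natrD lerD2r.
have -> : n%:R + n%:R = 2 * n%:R :> R by ring.
rewrite -mulrA ler_pM2l // ler_pdivlMr //.
have -> : n%:R * ln 2 = ln (2 ^+ n) :> R by rewrite lnXn // mulr_natl.
rewrite addrC; apply: (@le_trans _ _ (ln 64 + ln (1 + hyperbolic_ratio (z u) (z v)))); last by rewrite lerD2l.
have p1 : 0 < 1 + hyperbolic_ratio (z u) (z v) by lra.
by rewrite -lnM ?posrE // ler_ln ?posrE ?exprn_gt0 // mulr_gt0.
Qed.

Lemma near_hyperbolic_dist x u : modulus x < 1 -> near x u ->
  hyperbolic_dist (z u) x <= ln (4 * (1 + (K * (2 + K)) ^+ 2)).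
Proof.
move=> x1 xu; have u1 := vertex_centre_lt1 u.
have /andP[_ h] := hyperbolic_dist_bounds u1 x1; apply: le_trans h _.
have s0 := hyperbolic_ratio_ge0 u1 x1.
suff s : hyperbolic_ratio (z u) x <= (K * (2 + K)) ^+ 2.
  have := sqr_ge0 (K * (2 + K)); move: s s0; set X := _ ^+ 2 => *.
  rewrite ler_ln ?posrE; lra.
(* [rho] is the radius of the disc through which [x] is near [u]; it bounds the separation up to a
   factor and is bounded by a multiple of either depth. *)
have [rho [rho0 ax rx ru]] : exists rho, [/\ 0 < rho, modulus (z u - x) <= (2 + K) * rho,
    rho <= K * (1 - modulus x) & rho <= K * (1 - modulus (z u))].
  have Vu := vertex_disc_in_unit_disc pud u; have ru0 := radius_gt0 (P u).
  case: xu => -[v|f] /= uv; rewrite /closed_disc /= => xv.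
    rewrite -uv in xv; exists (r u); split=> //.
    - rewrite modulusB; apply: le_trans xv _; rewrite ler_peMl ?(ltW ru0) //; move: K1; lra.
    - apply: le_trans (vertex_boundary_gap ppn simple dcp pud degN codegN u) _.
      rewrite ler_pM2l //; have := modulusD (z u) (x - z u); rewrite addrC subrK; lra.
    - apply: le_trans (vertex_boundary_gap ppn simple dcp pud degN codegN u) _.
      by rewrite ler_pM2l //; lra.
  have rf := radius_gt0 (Pd f); exists (radius (Pd f)); split=> //.
  - have := vertex_face_radius ppn simple dcp degN codegN uv.
    have meet := (let: And5 _ _ _ _ H := dcp in (H u f).1).2 uv.
    have [y [yu yf]] := meet; rewrite /closed_disc /= in yu yf.
    have := modulus_triangle y (z u) (centre (Pd f)); rewrite [modulus (z u - y)]modulusB.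
    have := modulus_triangle (centre (Pd f)) (z u) x.
    by rewrite [modulus (centre (Pd f) - x)]modulusB; lra.
  - apply: le_trans (face_boundary_gap ppn simple dcp pud degN codegN f) _.
    rewrite ler_pM2l //; have := modulusD (centre (Pd f)) (x - centre (Pd f)); rewrite addrC subrK; lra.
  - apply: le_trans (face_vertex_radius ppn simple dcp degN codegN uv) _.
    by rewrite ler_pM2l //; lra.
apply: le_trans (hyperbolic_ratio_le u1 x1) _.
have du : 0 < 1 - modulus (z u) by rewrite subr_gt0.
have dx : 0 < 1 - modulus x by rewrite subr_gt0.
have K2 : 0 < 2 + K by rewrite addr_gt0.
rewrite ler_pdivrMr ?mulr_gt0 //; apply: (@le_trans _ _ (((2 + K) * rho) ^+ 2)).
  by rewrite ler_sqr ?nnegrE ?modulus_ge0 // mulr_ge0 // ltW.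
have -> : (K * (2 + K)) ^+ 2 * ((1 - modulus (z u)) * (1 - modulus x)) =
  (2 + K) ^+ 2 * ((K * (1 - modulus (z u))) * (K * (1 - modulus x))) by ring.
by rewrite exprMn ler_pM2l ?exprn_gt0 // expr2; apply: ler_pM => //; exact: ltW.
Qed.

End RoughIsometry.

(** * Degrees, codegrees and conductances in terms of [M_G] *)

Section LocalGeometryBounds.
Variables (R : realType) (G : network R) (D : drawing G) (M : R).
Hypothesis MG : M_G D = M%:E.

Lemma M_G_bounds : [/\ forall v : vertex G, (degree v <= M%:E)%E,
  forall f : face D, (codegree f <= M%:E)%E &
  forall e : oedge G, cond e <= M /\ (cond e)^-1 <= M].
Proof.
have le (x : \bar R) : (x <= M_G D)%E -> (x <= M%:E)%E by rewrite MG.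
have sup T (g : T -> \bar R) x : (g x <= ereal_sup (range g))%E.
  by apply: ereal_sup_ubound; exists x.
split=> [v|f|e].
- by apply: le; rewrite !le_max (sup _ (@degree R G)).
- by apply: le; rewrite !le_max (sup _ (@codegree R G D)) orbT.
split; rewrite -lee_fin; apply: le; rewrite !le_max.
  by rewrite (sup _ (fun e : oedge G => (cond e)%:E)) !orbT.
by rewrite (sup _ (fun e : oedge G => (cond e)^-1%:E)) !orbT.
Qed.

Lemma size_edges_from (v : vertex G) : locally_finite G ->
  degree v = (size (edges_from v))%:R%:E :> \bar R.
Proof. by move=> lf; rewrite /degree /counting asboolT //; exact: lf. Qed.

End LocalGeometryBounds.

Theorem corollary4p17 (R : realType) (M p : R) :
  0 < p ->
  exists alpha beta : R, 0 < alpha /\ 0 < beta /\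
    forall (G : network R) (D : drawing G),
      proper_plane_network D ->
      polyhedral G ->
      uniformly_transient G p ->
      bounded_codegrees D ->
      bounded_local_geometry G ->
      M_G D = M%:E ->
      forall (P : vertex G -> disc R) (Pd : face D -> disc R),
        double_circle_packing P Pd ->
        packing_in_unit_disc P Pd ->
        rough_isometry alpha beta
          [set: vertex G] (@graph_dist R G)
          (@unit_disc R) (@hyperbolic_dist R)
          (fun v => centre (P v)).
Proof.
(* The constants must be fixed before any network is given, so the natural bound on degrees and
   codegrees is taken from [M] alone. *)
move=> _; pose N := Num.bound `|M|; have MN : M <= N%:R.
  by apply: le_trans (ler_norm M) (ltW (archi_boundP (normr_ge0 M))).
pose Q : R := 2 ^+ (radius_depth N M p).+1.
have Q0 : 0 <= Q by rewrite exprn_ge0.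
have L0 : 0 < ln 2 :> R by rewrite ln_gt0 // ltr1n.
have ln_ge1 (x : R) : 1 <= x -> 0 <= ln x by exact: ln_ge0.
pose B := walk_growth N Q; pose m : R := (mesh_walk N Q)%:R.
pose C := (ring_constant R N * (2 + ring_constant R N)) ^+ 2.
have B0 : 0 <= ln B by apply/ln_ge1/walk_growth_ge1.
have C0 : 0 <= ln (4 * (1 + C)) by apply: ln_ge1; have := sqr_ge0 (ring_constant R N * (2 + ring_constant R N)); rewrite -/C; lra.
have l8 : 0 <= ln 8 :> R by apply: ln_ge1; rewrite ler1n.
have l64 : 0 <= ln 64 :> R by apply: ln_ge1; rewrite ler1n.
have m0 : 0 <= m by [].
have mL : 0 <= 2 * m / ln 2 by rewrite divr_ge0 ?(ltW L0) // mulr_ge0.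
(* [3 * ln B] is the slope of the upper bound on the hyperbolic distance and [2 * m / ln 2] that of
   the bound on the graph distance; the 1 makes [alpha] positive. [beta] collects the additive
   errors of both and the covering radius [ln (4 * (1 + C))]. *)
pose alpha := 3 * ln B + 2 * m / ln 2 + 1.
pose beta := ln 8 + ln 64 + 3 * ln 2 + ln (4 * (1 + C)).
have alpha0 : 0 < alpha by rewrite /alpha; lra.
exists alpha, beta; do 2?split=> //; first by rewrite /beta; lra.
move=> G D ppn [simple _] ut _ _ MG P Pd dcp pud.
have lfin : locally_finite G by case: ppn.
have [degM codegM condM] := M_G_bounds MG.
have degN (v : vertex G) : (size (edges_from v) <= N)%N.
  have := degM v; rewrite size_edges_from // lee_fin => h; rewrite -(ler_nat R); exact: le_trans h MN.
have codegN (f : face D) : (codegree f <= N%:R%:E)%E by apply: le_trans (codegM f) _; rewrite lee_fin.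
have condM' (e : oedge G) : cond e <= M /\ 1 <= M * cond e.
  have [h1 h2] := condM e; split=> //.
  by rewrite -ler_pdivrMr ?cond_gt0 // div1r.
have depth := radius_lower_bound ppn simple dcp pud degN codegN condM' ut.
have lt1 := vertex_centre_lt1 pud.
split=> [v _|u v _ _|x x1].
- exact: lt1.
- apply/andP; split; last first.
    apply: le_trans (hyperbolic_dist_le_graph_dist ppn simple dcp pud degN codegN Q0 depth u v) _.
    have d0 : 0 <= graph_dist u v.
      have [k _ ->] : exists2 k, walk_within setT k u v & graph_dist u v = k%:R.
        by apply: graph_dist_walk; case: ppn => _ conn _ _ _; exact: conn.
      exact: ler0n.
    apply: lerD; last by rewrite /beta; lra.
    by rewrite ler_wpM2r // /alpha -/B; lra.
  have := graph_dist_le_hyperbolic_dist ppn simple dcp pud degN codegN Q0 depth u v.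
  have /andP[d0 _] := hyperbolic_dist_bounds (lt1 u) (lt1 v).
  have dge : 0 <= hyperbolic_dist (centre (P u)) (centre (P v)).
    by apply: le_trans d0; apply: ln_ge1; have := hyperbolic_ratio_ge0 (lt1 u) (lt1 v); lra.
  rewrite -/m; move: dge; set d := hyperbolic_dist _ _ => dge le.
  rewrite lerBlDr mulrC ler_pdivrMr //; apply: (le_trans le).
  (* Factoring out the slope turns the additive 3 into [3 / 2 * ln 2], which [beta] dominates. *)
  have -> : m * (2 * (d + ln 64) / ln 2 + 3) = (d + ln 64 + 3 / 2 * ln 2) * (2 * m / ln 2).
    by field; rewrite gt_eqF.
  by apply: ler_pM => //; rewrite /alpha /beta; lra.
have [u xu] := near_exists ppn pud codegN x1.
exists u => //; apply: le_trans (near_hyperbolic_dist ppn simple dcp pud degN codegN x1 xu) _.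
by rewrite -/C /beta; lra.
Qed.
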